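(* Let $n\ge 2$ be an integer and let $p=p_c(n)$, where $p_c(n)$ is the positive root of the quadratic equation $(n-1)p^2-(n+1)p-2=0$. Let $R>0$ and let $(u_0,u_1)\in H^1(\mathbf{R}^n)\times L^2(\mathbf{R}^n)$ be real-valued with $u_0(x)=u_1(x)=0$ for $|x|>R$. Suppose that $u_0$ and $u_1$ are non-negative and that at least one of them is positive somewhere (that is, not almost everywhere zero). Let $T\in(0,\infty]$ and suppose that the problem $$\Delta u-\partial_t^2u+|u|^p=0\quad\text{in }\mathbf{R}^n\times(0,T),\qquad u(x,0)=u_0(x),\quad u_t(x,0)=u_1(x)\quad\text{in }\mathbf{R}^n,$$ has a solution $u$ with $(u,u_t)\in C([0,T),\,H^1(\mathbf{R}^n)\times L^2(\mathbf{R}^n))$ such that $$\operatorname{supp}(u,u_t)\subset\{(x,t):|x|\le t+R\}.$$ Then $T<\infty$.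
   Context: Here $\Delta=\sum_{i=1}^n\partial^2/\partial x_i^2$ is the Laplace operator on $\mathbf{R}^n$, and $u$ is real-valued. $C([0,T),H^1\times L^2)$ denotes continuous maps of $t\in[0,T)$ into $H^1(\mathbf{R}^n)\times L^2(\mathbf{R}^n)$. The equation is understood in the sense of distributions on $\mathbf{R}^n\times(0,T)$, and the initial conditions mean that $(u,u_t)$ at $t=0$ equals $(u_0,u_1)$. Inequalities for $u_0,u_1$ are understood almost everywhere. *)

(* Defs.v *)
From HB Require Import structures.
From mathcomp Require Import all_boot all_order all_algebra.
From mathcomp Require Import all_classical all_reals all_analysis.

Set Implicit Arguments.
Unset Strict Implicit.
Unset Printing Implicit Defensive.

Import Order.TTheory GRing.Theory Num.Theory.
Import numFieldNormedType.Exports.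

Local Open Scope classical_set_scope.
Local Open Scope ring_scope.

(* R^n is 'rV[R]_n.  It carries the sigma-algebra generated by the coordinates
   (the Borel sigma-algebra). *)

Definition rV_display (n : nat) : measure_display.
Proof. exact. Qed.

Definition rV_coord (R : realType) (n : nat) (i : 'I_n) (x : 'rV[R]_n)
  : measurableTypeR R := x ord0 i.

Section rV_measurable.
Variables (R : realType) (n : nat).

Let rV_set0 : g_sigma_preimage (@rV_coord R n) set0.
Proof. exact: sigma_algebra0. Qed.

Let rV_setC A : g_sigma_preimage (@rV_coord R n) A ->
  g_sigma_preimage (@rV_coord R n) (~` A).
Proof. exact: sigma_algebraC. Qed.

Let rV_bigcup (F : (set 'rV[R]_n)^nat) :
  (forall i, g_sigma_preimage (@rV_coord R n) (F i)) ->
  g_sigma_preimage (@rV_coord R n) (\bigcup_i F i).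
Proof. exact: sigma_algebra_bigcup. Qed.

HB.instance Definition _ := @isMeasurable.Build (rV_display n) 'rV[R]_n
  (g_sigma_preimage (@rV_coord R n)) rV_set0 rV_setC rV_bigcup.

End rV_measurable.

Lemma measurable_rV_coord (R : realType) (n : nat) (i : 'I_n) :
  measurable_fun [set: 'rV[R]_n] (@rV_coord R n i).
Proof.
move=> _ A mA; apply: sub_sigma_algebra; rewrite -bigcup_seq/=.
by exists i => /=; [rewrite mem_index_enum|exists A].
Qed.

Lemma measurable_fun_rVP (R : realType) (d : measure_display)
    (T : measurableType d) (n : nat) (f : T -> 'rV[R]_n) :
  (forall i, measurable_fun [set: T] (rV_coord i \o f)) ->
  measurable_fun [set: T] f.
Proof.
move=> mf _ A mA; rewrite setTI.
have : g_sigma_preimage (@rV_coord R n) `<=`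
    [set B | measurable (f @^-1` B)].
  apply: smallest_sub.
    split => /=.
    - by rewrite preimage_set0.
    - by move=> B mB; rewrite setTD preimage_setC; exact: measurableC.
    - by move=> F mF; rewrite preimage_bigcup; exact: bigcup_measurable.
  rewrite -bigcup_seq => B [/= i _ [C mC <-]] /=.
  rewrite setTI -comp_preimage -[X in measurable X]setTI.
  exact: mf.
exact.
Qed.

Definition rV_rcons (R : realType) (n : nat)
    (z : 'rV[R]_n * measurableTypeR R) : 'rV[R]_n.+1 :=
  \row_(i < n.+1) if unlift ord_max i is Some j then z.1 ord0 j else z.2.

Lemma measurable_rV_rcons (R : realType) (n : nat) :
  measurable_fun setT (@rV_rcons R n).
Proof.
apply: measurable_fun_rVP => i.
have -> : rV_coord i \o @rV_rcons R n =
    (fun z => if unlift ord_max i is Some j then rV_coord j z.1 else z.2).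
  by apply/funext => z /=; rewrite /rV_coord mxE.
case: unlift => [j|]; last exact: measurable_snd.
by apply: measurableT_comp => //; exact: measurable_rV_coord.
Qed.

Definition rV_unrcons (R : realType) (n : nat) (x : 'rV[R]_n.+1)
    : 'rV[R]_n * measurableTypeR R :=
  (\row_j x ord0 (lift ord_max j), x ord0 ord_max).

Lemma measurable_rV_unrcons (R : realType) (n : nat) :
  measurable_fun setT (@rV_unrcons R n).
Proof.
apply/measurable_fun_pairP; split; last exact: (@measurable_rV_coord R n.+1).
apply: measurable_fun_rVP => j.
rewrite (_ : _ \o _ = @rV_coord R n.+1 (lift ord_max j)).
  exact: measurable_rV_coord.
by apply/funext => x /=; rewrite /rV_coord mxE.
Qed.

Lemma rV_rconsK (R : realType) (n : nat) :
  cancel (@rV_rcons R n) (@rV_unrcons R n).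
Proof.
move=> [x t]; rewrite /rV_unrcons /rV_rcons; congr pair.
  by apply/rowP => j; rewrite !mxE liftK.
by rewrite mxE unlift_none.
Qed.

Lemma rV_unrconsK (R : realType) (n : nat) :
  cancel (@rV_unrcons R n) (@rV_rcons R n).
Proof.
move=> x; apply/rowP => i; rewrite mxE.
by case: unliftP => [j|] -> //=; rewrite mxE.
Qed.

Section product_rV.
Local Open Scope ereal_scope.
Variables (R : realType) (n : nat).
Variable mu : {sigma_finite_measure set 'rV[R]_n -> \bar R}.

Definition product_rV : set 'rV[R]_n.+1 -> \bar R :=
  pushforward (mu \x (@lebesgue_measure R)) (@rV_rcons R n).

Let pushforward_rV : {measure set 'rV[R]_n.+1 -> \bar R} :=
  measure_function_pushforward__canonical__measure_function_Measure
    (mu \x (@lebesgue_measure R)) (@measurable_rV_rcons R n).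

HB.instance Definition _ := isMeasure.Build _ _ _ product_rV
  (measure0 pushforward_rV) (measure_ge0 pushforward_rV)
  (@measure_semi_sigma_additive _ _ _ pushforward_rV).

Lemma product_rV_sigma_finite : sigma_finite setT product_rV.
Proof.
have /sigma_finiteP[F [TF ndF Foo]] := sigma_finiteT mu.
have /sigma_finiteP[G [TG ndG Goo]] :=
  sigma_finiteT (@lebesgue_measure R).
exists (fun k => @rV_unrcons R n @^-1` (F k `*` G k)).
  rewrite -preimage_bigcup -(preimage_setT (@rV_unrcons R n)).
  congr (_ @^-1` _); apply/esym; rewrite -subTset => -[x t] _.
  have : setT x by []; have : setT t by [].
  rewrite TF TG => -[j _ Gt] [i _ Fx]; exists (maxn i j) => //; split.
    by move: x Fx; exact/subsetPset/ndF/leq_maxl.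
  by move: t Gt; exact/subsetPset/ndG/leq_maxr.
move=> k; have [mF Fk] := Foo k; have [mG Gk] := Goo k; split.
  rewrite -[X in measurable X]setTI.
  by apply: measurable_rV_unrcons => //; exact: measurableX.
rewrite /product_rV /pushforward -comp_preimage.
rewrite (_ : _ \o _ = id); last by apply/funext => z /=; rewrite rV_rconsK.
rewrite preimage_id product_measure1E//.
by rewrite lte_mul_pinfty// ge0_fin_numE.
Qed.

HB.instance Definition _ :=
  Measure_isSigmaFinite.Build _ _ _ product_rV product_rV_sigma_finite.

End product_rV.

(* The Lebesgue measure on R^n, as the n-fold product of the one-dimensional
   one. *)
Fixpoint lebesgue_rV (R : realType) (n : nat)
    : {sigma_finite_measure set 'rV[R]_n -> \bar R} :=
  match n with
  | 0 => dirac (0 : 'rV[R]_0)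
  | k.+1 => product_rV (lebesgue_rV R k)
  end.
Arguments lebesgue_rV : clear implicits.

Lemma measurable_rV_box (R : realType) (n : nat) (A : 'I_n -> set R) :
  (forall i, measurable (A i)) ->
  measurable [set x : 'rV[R]_n | forall i, A i (x ord0 i)].
Proof.
move=> mA.
rewrite (_ : mkset _ =
    \bigcap_(i in [set: 'I_n]) (rV_coord i @^-1` A i)); last first.
  by apply/seteqP; split => [x xA i _|x xA i]; exact: xA.
apply: fin_bigcap_measurable => // i _.
have := @measurable_rV_coord R n i measurableT (A i) (mA i).
by rewrite setTI.
Qed.

Lemma lebesgue_rV_box (R : realType) (n : nat) (A : 'I_n -> set R) :
  (forall i, measurable (A i)) ->
  lebesgue_rV R n [set x | forall i, A i (x ord0 i)] =
  (\prod_(i < n) lebesgue_measure (A i))%E.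
Proof.
elim: n A => [|n IHn] A mA.
  rewrite big_ord0 /= diracE mem_set// => -[].
  by [].
rewrite big_ord_recr /= /product_rV /pushforward.
rewrite (_ : _ @^-1` _ = [set x : 'rV[R]_n | forall i : 'I_n,
    A (widen_ord (leqnSn n) i) (x ord0 i)] `*` A ord_max).
  rewrite product_measure1E//.
  - by congr *%E; exact: (IHn (fun i => A (widen_ord (leqnSn n) i))).
  - exact: (@measurable_rV_box R n (fun i => A (widen_ord (leqnSn n) i))).
  - exact: mA.
have widenE (j : 'I_n) : widen_ord (leqnSn n) j = lift ord_max j.
  by apply/val_inj; rewrite /= /bump leqNgt ltn_ord.
apply/seteqP; split => [[x t] /= xtA|[x t] /= [xA tA] i].
  split=> [j|]; last by have := xtA ord_max; rewrite mxE unlift_none.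
  by have := xtA (lift ord_max j); rewrite mxE liftK -widenE.
by rewrite mxE; case: unliftP => [j|] -> //; rewrite -widenE.
Qed.

Section function_spaces.
Variables (R : realType).

(* V stands for R^n or for R^n * R. *)
Fixpoint Ck (V : normedModType R) (k : nat) (f : V -> R) : Prop :=
  continuous f /\
  match k with
  | 0 => True
  | j.+1 => forall v, (forall x, derivable f x v) /\ Ck j ('D_v f)
  end.

Definition smooth (V : normedModType R) (f : V -> R) := forall k, Ck k f.

Definition test_function (V : normedModType R) (O : set V) (phi : V -> R) :=
  smooth phi /\
  exists K : set V, [/\ compact K, K `<=` O & forall z, ~ K z -> phi z = 0].

Variable n : nat.
Implicit Types (f g : 'rV[R]_n -> R).

(* The library norm `|x| on 'rV[R]_n is the sup norm. *)
Definition euclidean_norm (x : 'rV[R]_n) : R :=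
  Num.sqrt (\sum_(i < n) x ord0 i ^+ 2).

Definition unit_rV (i : 'I_n) : 'rV[R]_n := delta_mx ord0 i.

Definition L2 f := f \in Lfun (lebesgue_rV R n) 2%:E.

Definition L2norm f : \bar R := ('N[lebesgue_rV R n]_2%:E[EFin \o f])%E.

Definition weak_partial (i : 'I_n) f g :=
  forall phi : 'rV[R]_n -> R, test_function setT phi ->
    \int[lebesgue_rV R n]_x (f x * 'D_(unit_rV i) phi x) =
    - \int[lebesgue_rV R n]_x (g x * phi x).

Definition H1 f :=
  L2 f /\ forall i : 'I_n, exists g, L2 g /\ weak_partial i f g.

(* A representative of the weak partial derivative, which for f in H1 exists
   and is unique up to a negligible set. *)
Definition weak_partial_of (i : 'I_n) f : 'rV[R]_n -> R :=
  xget (cst 0) [set g | L2 g /\ weak_partial i f g].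

Definition H1norm f : \bar R :=
  ((L2norm f ^+ 2 + \sum_(i < n) L2norm (weak_partial_of i f) ^+ 2)
     `^ 2^-1)%E.

End function_spaces.

(* Functions of space and time are curried with time first, so that u t is the
   state at time t. *)
Section wave.
Variables (R : realType) (n : nat) (T : \bar R).
Implicit Types (u v w : R -> 'rV[R]_n -> R) (phi : 'rV[R]_n * R -> R).

Definition time_interval : set R := [set t | 0 <= t /\ (t%:E < T)%E].

(* (u, v) belongs to C([0, T), H^1 * L^2). *)
Definition continuous_H1L2 u v :=
  (forall t, time_interval t -> H1 (u t) /\ L2 (v t)) /\
  (forall s, time_interval s ->
    (H1norm (u t \- u s)%R + L2norm (v t \- v s)%R)%E
      @[t --> within time_interval (nbhs s)] --> 0%E).

Definition space_time : set ('rV[R]_n * R) :=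
  [set z | 0 < z.2 /\ (z.2%:E < T)%E].

(* w is locally integrable on R^n * (0, T), in Tonelli form: a compact subset
   of R^n * (0, T) lies in the product of a ball and some [a, b]. *)
Definition locally_integrable_space_time w :=
  forall r a b : R, 0 < a -> (b%:E < T)%E ->
    (@lebesgue_measure R).-integrable `[a, b]
      (fun t => \int[lebesgue_rV R n]_(x in [set x | euclidean_norm x <= r]%R)
                  `|w t x|%:E)%E.

(* The pairing of w with phi, as a distribution on R^n * (0, T). *)
Definition pairing w phi : R :=
  \int[@lebesgue_measure R]_(t in [set t | 0 < t /\ (t%:E < T)%E])
    \int[lebesgue_rV R n]_x (w t x * phi (x, t)).

Definition d_time phi : 'rV[R]_n * R -> R := 'D_(0, 1) phi.

Definition laplacian phi : 'rV[R]_n * R -> R := fun z =>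
  \sum_(i < n) 'D_(unit_rV R i, 0) ('D_(unit_rV R i, 0) phi) z.

(* v is the time derivative of u in the sense of distributions. *)
Definition is_time_derivative u v :=
  forall phi, test_function space_time phi ->
    pairing u (d_time phi) = - pairing v phi.

(* Delta u - u_tt + |u|^p = 0 in the sense of distributions.  Local
   integrability of |u|^p is what makes it a distribution; if u is in
   C([0, T), H^1) and p is the critical exponent p_c(n), it follows from the
   Sobolev embedding, as p_c(n) < 2n/(n-2), and is then no restriction. *)
Definition wave_equation (p : R) u :=
  locally_integrable_space_time (fun t x => `|u t x| `^ p) /\
  forall phi, test_function space_time phi ->
    pairing u (laplacian phi) - pairing u (d_time (d_time phi)) +
    pairing (fun t x => `|u t x| `^ p) phi = 0.

(* supp (u, v) is included in {(x, t) : |x| <= t + rho}. *)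
Definition support_in_cone (rho : R) u v :=
  forall t, time_interval t ->
    {ae lebesgue_rV R n, forall x, t + rho < euclidean_norm x ->
      u t x = 0 /\ v t x = 0}.

Definition initial_data u v (u0 u1 : 'rV[R]_n -> R) :=
  {ae lebesgue_rV R n, forall x, u 0 x = u0 x /\ v 0 x = u1 x}.

End wave.

(* Main.v *)
Require Import Defs.
From mathcomp Require Import all_boot all_order all_algebra.
From mathcomp Require Import all_classical all_reals all_analysis.
From mathcomp Require Import measurable_realfun ring lra.
Set Implicit Arguments.
Unset Strict Implicit.
Unset Printing Implicit Defensive.
Import Order.TTheory GRing.Theory Num.Theory.
Import numFieldNormedType.Exports.
Local Open Scope classical_set_scope.
Local Open Scope ring_scope.

(** Suppose that the solution is global in time.  Write tau = t + rho + 1, let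
y = (|x| / tau)^2, and consider the self-similar solutions

  Phi_b(x, t) = sum_k c_k |x|^(2 k) tau^(- b - 2 k) = tau^(- b) F_b(y),  c_0 = 1,

of the free wave equation.  They are positive on the cone |x| <= t + rho that
carries u, and they are at least tau^(- b) there.  If b = (n - 1) / 2 - s
with 0 <= s < 1, then c_k (b + 2 k) is of the order of (k + 1)^(- s)
([wave_coef_bound]), so that the time derivative of Phi_b grows near the light
cone only like a power - (1 - s) of the distance to it ([wave_series_bound]).

The equation is tested against psi_r(t) Phi_b(x, t), where psi_r passes from 1
to 0 on [r, 2 r].  As Phi_b is a free wave, only terms containing a derivative
of psi_r are left, and these live on [r, 2 r]; the terms at t = 0 have a good
sign since the data are non-negative, and they do not all vanish.  Young's
inequality with an arbitrary weight e gives, with p' = p / (p - 1),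

  d + int_(1 < t < 2 r) psi_r tau^(- b) |u|^p
    <= e int_(r < t < 2 r) psi_r |u|^p
       + C e^(- 1 / (p - 1)) r^(- (b + 1 + s) p') Z(r),

where d > 0 depends on the data and Z(r) is the integral of the power
- (1 - s) p' of 1 + t + rho - |x| over the part r < t < 2 r of the cone
([averaged_inequality]).  The series Phi_b is truncated at a rank N depending
on r: the truncated series solves the wave equation up to its last term, which
is as small as desired on the cone for N large ([last_term_small]).  This way
only polynomials in |x| multiplied by functions of t occur as test functions.

This inequality is used twice.  With s = 0 the exponent p' is greater than 1,
Z(r) is of the order of r^n, and the choice e = E r^(- be), where
be = (n - 1) / 2 - 1 / p, shows that the integral M(r) of psi_r |u|^p over
r < t < 2 r, divided by r^be, is bounded from below ([dyadic_mass_ge]).  With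
s = 1 / p, hence b = be, the exponent (1 - s) p' is 1 and Z(r) is at most of
the order of r^n log r.  The equation of the critical exponent says that all
powers of r cancel again ([critical_balance]), and with
S(r) = int_(1 < t < r) tau^(- be) |u|^p one gets, for every E > 0,

  S(r) + ka M(r) r^(- be) <= E M(r) r^(- be) + C E^(- 1 / (p - 1)) log r

([critical_inequality]), while S(2 r) - S(r) >= ka M(r) r^(- be).  Take
r = 2^k.  The lower bound on M makes S(2^k) grow at least like k.  For E = ka
the inequality shows that S(2^k) grows at most like k.  For E large the
logarithmic term is absorbed in half of S(2^k), which makes the increments of
S(2^k) proportional to S(2^k), so that S(2^k) grows exponentially: a
contradiction ([critical_growth]). *)

(** * Coefficients of the self-similar free waves *)

(** Young's inequality for the product of (1 + x)^r and 1 with the exponents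
1 / r and 1 / (1 - r). *)
Lemma bernoulli_powR (R : realType) (x r : R) :
  0 <= 1 + x -> 0 <= r <= 1 -> (1 + x) `^ r <= 1 + r * x.
Proof.
move=> x0 /andP[r0 r1].
have [->|rn0] := eqVneq r 0; first by rewrite powRr0 mul0r addr0.
have [->|rn1] := eqVneq r 1; first by rewrite powRr1// mul1r.
have rgt0 : 0 < r by rewrite lt_def rn0.
have rlt1 : 0 < 1 - r by rewrite subr_gt0 lt_def eq_sym rn1.
have := @conjugate_powR R ((1 + x) `^ r) 1 r^-1 (1 - r)^-1.
rewrite -powRrM mulfV// powRr1// powR1 !invrK.
move/(_ (powR_ge0 _ _) ler01); rewrite !invr_gt0 => /(_ rgt0 rlt1).
rewrite mulr1 mul1r => /(_ _)/le_trans-> //; lra.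
Qed.

(** This recursion is what makes the sum of c_k |x|^(2 k) tau^(- b - 2 k) a formal
solution of the free wave equation in n space dimensions. *)
Fixpoint wave_coef (R : realType) (n : nat) (b : R) (k : nat) : R :=
  if k is j.+1 then
    wave_coef n b j * ((b + 2 * j%:R) * (b + 2 * j%:R + 1)
       / ((2 * j%:R + 2) * (2 * j%:R + n%:R)))
  else 1.

Lemma wave_coef_gt0 (R : realType) n (b : R) k : (0 < n)%N -> 0 < b ->
  0 < wave_coef n b k.
Proof.
move=> n0 b0; elim: k => [|k IH] /=; first exact: ltr01.
have k0 : 0 <= k%:R :> R by exact: ler0n.
have n1 : 0 < n%:R :> R by rewrite ltr0n.
by apply: mulr_gt0 => //; apply: divr_gt0; apply: mulr_gt0; lra.
Qed.

Lemma wave_coefS (R : realType) n (b : R) k : (0 < n)%N ->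
  wave_coef n b k.+1 * ((2 * k%:R + 2) * (2 * k%:R + n%:R)) =
  wave_coef n b k * ((b + 2 * k%:R) * (b + 2 * k%:R + 1)).
Proof.
move=> n0 /=.
have k0 : 0 <= k%:R :> R by exact: ler0n.
have n1 : 0 < n%:R :> R by rewrite ltr0n.
rewrite -mulrA mulfVK//; apply: lt0r_neq0; apply: mulr_gt0; lra.
Qed.

(** The quotient is that of two consecutive terms c_k (b + 2 k), taken at x = k.
Since b = (m - 1) / 2 - s, it is 1 - s / x + O(x^-2), and the factor
1 + s / (x + 1) removes the first-order term. *)
Lemma coef_ratio (R : realType) (m s b x : R) : 2 <= m -> 0 <= s < 1 ->
  b = (m - 1) / 2 - s -> 0 < b -> 0 <= x ->
  (b + 2 * x + 1) * (b + 2 * x + 2) / ((2 * x + 2) * (2 * x + m)) *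
    (1 + s / (x + 1)) <= 1 + 10 * m ^+ 2 / ((x + 1) * (x + 2)).
Proof.
move=> m2 /andP[s0 s1] bE b0 x0.
have h1 : 0 < (2 * x + 2) * (2 * x + m) by apply: mulr_gt0; lra.
have h2 : 0 < x + 1 by lra.
have h3 : 0 < (x + 1) * (x + 2) by apply: mulr_gt0; lra.
have -> : 1 + s / (x + 1) = (x + 1 + s) / (x + 1) by field; lra.
have -> : 1 + 10 * m ^+ 2 / ((x + 1) * (x + 2)) =
  ((x + 1) * (x + 2) + 10 * m ^+ 2) / ((x + 1) * (x + 2)).
  by field; apply/andP; split; lra.
have h4 := mulr_gt0 h1 h2.
rewrite mulf_div ler_pdivrMr// [leRHS]mulrAC ler_pdivlMr//.
have sE : s = (m - 1) / 2 - b by lra.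
suff : 0 <= (((x + 1) * (x + 2) + 10 * m ^+ 2) * ((2 * x + 2) * (2 * x + m)) -
    (b + 2 * x + 1) * (b + 2 * x + 2) * (x + 1 + s) * (x + 2)) * (x + 1).
  by rewrite mulrBl subr_ge0 => H; apply: le_trans (le_trans H _); lra.
apply: mulr_ge0; last by lra.
(* The cubic terms cancel by the relation between b, m and s; the other
   coefficients of the polynomial in x are non-negative. *)
have bm : b <= m / 2 by lra.
have b1 : (b + 1) * (b + 2) <= 3 * m ^+ 2.
  have : (b + 1) * (b + 2) <= (m / 2 + 1) * (m / 2 + 2) by apply: ler_pM; lra.
  by move/le_trans; apply; nra.
have b1' : 0 <= (b + 1) * (b + 2) by apply: mulr_ge0; lra.
set q := (b + 1) * (b + 2) in b1 b1'.
have bs : 0 <= b * s by apply: mulr_ge0; lra.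
have c2 : 0 <= 4 * (2 + 10 * m ^+ 2) + (2 * m + 4) * 3 + 2 * m
   - (8 * (1 + s) + (4 * b + 6) * (3 + s) + q).
  have : (4 * b + 6) * (3 + s) <= (2 * m + 6) * 4 by apply: ler_pM; lra.
  nra.
have c1 : 0 <= (2 * m + 4) * (2 + 10 * m ^+ 2) + 2 * m * 3
   - ((4 * b + 6) * (2 * (1 + s)) + q * (3 + s)).
  have : (4 * b + 6) * (2 * (1 + s)) <= (2 * m + 6) * 4 by apply: ler_pM; lra.
  have : q * (3 + s) <= 3 * m ^+ 2 * 4 by apply: ler_pM; lra.
  nra.
have c0 : 0 <= 2 * m * (2 + 10 * m ^+ 2) - q * (2 * (1 + s)).
  have : q * (2 * (1 + s)) <= 3 * m ^+ 2 * 4 by apply: ler_pM; lra.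
  nra.
have c3 : 16 + 2 * m = 18 + 4 * s + 4 * b by lra.
have -> : ((x + 1) * (x + 2) + 10 * m ^+ 2) * ((2 * x + 2) * (2 * x + m)) -
    (b + 2 * x + 1) * (b + 2 * x + 2) * (x + 1 + s) * (x + 2) =
   (4 * (2 + 10 * m ^+ 2) + (2 * m + 4) * 3 + 2 * m
   - (8 * (1 + s) + (4 * b + 6) * (3 + s) + q)) * x ^+ 2 +
  ((2 * m + 4) * (2 + 10 * m ^+ 2) + 2 * m * 3
   - ((4 * b + 6) * (2 * (1 + s)) + q * (3 + s))) * x +
  (2 * m * (2 + 10 * m ^+ 2) - q * (2 * (1 + s))) +
  (16 + 2 * m - (18 + 4 * s + 4 * b)) * x ^+ 3.
  by rewrite /q; ring.
rewrite c3 subrr mul0r addr0.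
apply: addr_ge0; last exact: c0.
apply: addr_ge0; apply: mulr_ge0 => //; exact: exprn_ge0.
Qed.

(** By [coef_ratio] and Bernoulli's inequality, e k = c_k (b + 2 k) (k + 1)^s
grows at step k at most by the factor 1 + A / ((k + 1) (k + 2)), and the
product of these factors is bounded because the exponents telescope. *)
Lemma wave_coef_bound (R : realType) (n : nat) (s b : R) : (2 <= n)%N ->
  0 <= s < 1 -> b = (n%:R - 1) / 2 - s -> 0 < b ->
  exists2 K, 0 < K &
  forall k, wave_coef n b k * (b + 2 * k%:R) <= K * (k.+1%:R `^ (- s)).
Proof.
move=> n2 s01 bE b0.
have n2R : 2 <= n%:R :> R by rewrite ler_nat.
pose e k := wave_coef n b k * (b + 2 * k%:R) * k.+1%:R `^ s.
pose A : R := 10 * n%:R ^+ 2.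
have A0 : 0 <= A by rewrite mulr_ge0// exprn_ge0//; lra.
have eS k : e k.+1 <= e k * (1 + A / ((k%:R + 1) * (k%:R + 2))).
  have k0 : 0 <= k%:R :> R by exact: ler0n.
  have c0 := wave_coef_gt0 k (ltnW n2) b0.
  have r1 : k.+2%:R `^ s <= k.+1%:R `^ s * (1 + s / (k%:R + 1)).
    have -> : k.+2%:R = k.+1%:R * (1 + (k%:R + 1)^-1) :> R.
      by rewrite -!natr1; field; lra.
    rewrite powRM; [|lra|by rewrite addr_ge0// invr_ge0; lra].
    rewrite ler_wpM2l ?powR_ge0//; apply: bernoulli_powR.
      by rewrite addr_ge0// invr_ge0; lra.
    by case/andP: s01 => -> /ltW ->.
  rewrite /e /=; have := coef_ratio n2R s01 bE b0 k0.
  set rr := (X in X * _ <= _ -> _) => h.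
  have rr0 : 0 <= rr.
    by rewrite /rr divr_ge0// mulr_ge0//; lra.
  have -> : wave_coef n b k * ((b + 2 * k%:R) * (b + 2 * k%:R + 1)
       / ((2 * k%:R + 2) * (2 * k%:R + n%:R))) * (b + 2 * k.+1%:R) =
     wave_coef n b k * (b + 2 * k%:R) * rr.
    by rewrite /rr -natr1; field; apply/andP; split; lra.
  have q0 : 0 <= wave_coef n b k * (b + 2 * k%:R) by rewrite mulr_ge0//; lra.
  rewrite -(mulrA _ rr) -(mulrA _ (_ `^ s)) ler_wpM2l//.
  apply: (le_trans (ler_wpM2l rr0 r1)).
  by rewrite mulrCA ler_wpM2l ?powR_ge0.
have eB k : e k <= e 0%N * expR (A * (1 - (k%:R + 1)^-1)).
  elim: k => [|k IH]; first by rewrite add0r invr1 subrr mulr0 expR0 mulr1.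
  have k0 : 0 <= k%:R :> R by exact: ler0n.
  apply: le_trans (eS k) _.
  have h0 : 0 <= A / ((k%:R + 1) * (k%:R + 2)).
    by rewrite divr_ge0// mulr_ge0//; lra.
  apply: le_trans (ler_wpM2r _ IH) _; first lra.
  rewrite -mulrA ler_wpM2l//.
    by rewrite /e/= mul1r mulr0 addr0 mulr_ge0// ?powR_ge0// ltW.
  apply: (le_trans (ler_wpM2l (expR_ge0 _) (expR_ge1Dx _))).
  rewrite -expRD ler_expR -natr1.
  rewrite le_eqVlt; apply/orP; left; apply/eqP; field.
  by apply/andP; split; lra.
exists (e 0%N * expR A).
  by rewrite mulr_gt0 ?expR_gt0// /e /= mul1r mulr0 addr0 mulr_gt0// powR_gt0.
move=> k; rewrite powRN ler_pdivlMr ?powR_gt0//.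
apply: (le_trans (eB k)); rewrite ler_wpM2l//.
  by rewrite /e/= mul1r mulr0 addr0 mulr_ge0// ?powR_ge0// ltW.
by rewrite ler_expR ler_piMr// gerBl invr_ge0.
Qed.

(** Comparison with the integral of x^(- s): Bernoulli's inequality bounds each
term by an increment of N^(1 - s) / (1 - s). *)
Lemma sum_powRN (R : realType) (s : R) (N : nat) : 0 <= s < 1 ->
  \sum_(0 <= k < N) k.+1%:R `^ (- s) <= N%:R `^ (1 - s) / (1 - s).
Proof.
move=> /andP[s0 s1]; have s1' : 0 < 1 - s by lra.
elim: N => [|N IH].
  by rewrite big_geq// powR0 ?mul0r//; lra.
rewrite big_nat_recr//=.
apply: (le_trans (lerD IH (lexx _))).
rewrite ler_pdivlMr// mulrDl mulfVK; last by lra.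
have N0 : 0 < N.+1%:R :> R by rewrite ltr0n.
have -> : N%:R = N.+1%:R * (1 + - (N.+1%:R)^-1) :> R.
  by rewrite mulrDr mulr1 mulrN mulfV ?gt_eqF// -natr1 addrK.
have hN : 0 <= 1 + - (N.+1%:R)^-1 :> R.
  by rewrite subr_ge0 invf_le1// ler1n.
rewrite powRM// ?ler0n//.
have -> : N.+1%:R `^ (- s) = N.+1%:R `^ (1 - s) / N.+1%:R :> R.
  rewrite powRD ?pnatr_eq0 ?implybT// powRr1// mulrAC mulfV ?mul1r//.
have b := @bernoulli_powR R (- (N.+1%:R)^-1) (1 - s) hN.
have {}b : (1 + - N.+1%:R^-1) `^ (1 - s) <= 1 + (1 - s) * - N.+1%:R^-1 :> R.
  by apply: b; apply/andP; split; lra.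
rewrite -!mulrA -mulrDr ler_piMr ?powR_ge0//.
apply: le_trans (lerD b (lexx _)) _.
by rewrite mulrN -addrA [X in - X]mulrC addNr addr0.
Qed.

Lemma geometric_le (R : realType) (y : R) N : 0 <= y < 1 ->
  \sum_(0 <= k < N) y ^+ k <= (1 - y)^-1.
Proof.
move=> /andP[y0 y1]; have y1' : 0 < 1 - y by lra.
suff -> : \sum_(0 <= k < N) y ^+ k = (1 - y ^+ N) / (1 - y).
  by rewrite ler_piMl ?invr_ge0 ?(ltW y1')// gerBl exprn_ge0.
elim: N => [|N IH]; first by rewrite big_geq// expr0 subrr mul0r.
by rewrite big_nat_recr//= IH exprS; field; lra.
Qed.

(** The series is cut at k = 1 / (1 - y).  Before, the geometric factor is bounded
by 1; after, (k + 1)^(- s) is at most (1 - y)^s and the geometric series is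
summed. *)
Lemma sum_powRN_geometric (R : realType) (s y : R) N : 0 <= s < 1 ->
  0 <= y < 1 ->
  \sum_(0 <= k < N) (k.+1%:R `^ (- s) * y ^+ k) <=
  (1 + (1 - s)^-1) * (1 - y) `^ (- (1 - s)).
Proof.
move=> s01 y01; case/andP: (s01) => s0 s1; case/andP: (y01) => y0 y1.
set d := 1 - y; have d0 : 0 < d by rewrite /d; lra.
have s1' : 0 < 1 - s by lra.
pose M := Num.trunc d^-1.
have di0 : 0 <= d^-1 by rewrite invr_ge0 ltW.
have /andP[Ml Mu] := trunc_itv di0.
(* the two regimes of k, added instead of distinguished *)
have key k : k.+1%:R `^ (- s) * y ^+ k <=
    (if (k < M)%N then k.+1%:R `^ (- s) else 0) + d `^ s * y ^+ k.
  have yk0 : 0 <= y ^+ k by rewrite exprn_ge0.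
  have yk1 : y ^+ k <= 1 by rewrite exprn_ile1// ltW.
  case: ifPn => kM.
    by rewrite ler_wpDr ?mulr_ge0 ?powR_ge0// ler_piMr ?powR_ge0.
  rewrite add0r ler_wpM2r//.
  have dk : 1 <= d * k.+1%:R.
    have : d^-1 <= k.+1%:R.
      by apply: (le_trans (ltW Mu)); rewrite ler_nat ltnS leqNgt.
    by move=> /(ler_wpM2l (ltW d0)); rewrite mulfV ?gt_eqF.
  rewrite powRN -div1r ler_pdivrMr ?powR_gt0//.
  rewrite -powRM ?(ltW d0)//.
  by have := ge0_ler_powR s0 (x:=1) (y:=d * k.+1%:R); rewrite powR1; apply;
    rewrite ?nnegrE// (le_trans _ dk).
apply: le_trans (ler_sum _ (fun k _ => key k)) _.
rewrite big_split/= mulrDl mul1r addrC lerD//.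
  rewrite -mulr_sumr.
  apply: le_trans (ler_wpM2l (powR_ge0 _ _) (geometric_le N y01)) _.
  rewrite -/d opprB powRB ?powRr1 ?(ltW d0)//.
  by rewrite (gt_eqF d0) implybT.
apply: (@le_trans _ _ (\sum_(0 <= k < M) k.+1%:R `^ (- s))).
  have [NM|/ltnW MN] := leqP N M.
    rewrite [leRHS](@big_cat_nat _ _ _ N)//=; apply: ler_wpDr.
      by apply: sumr_ge0 => k _; exact: powR_ge0.
    by apply: ler_sum => k _; case: ifP => // _; exact: powR_ge0.
  by rewrite (big_nat_widen 0 M N)//= [leRHS]big_mkcond.
apply: le_trans (sum_powRN M s01) _.
rewrite mulrC ler_wpM2l ?invr_ge0 ?(ltW s1')//.
rewrite powRN -powR_inv1; last exact: powR_ge0.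
rewrite -powRrM mulrN mulr1 -mulN1r powRrM powR_inv1 ?(ltW d0)//.
by apply: ge0_ler_powR; rewrite ?nnegrE ?ler0n// ltW.
Qed.

(** With y = (|x| / tau)^2 this sum is, up to a power of tau, the time derivative
of the free wave; the bound measures its growth at the light cone y = 1. *)
Lemma wave_series_bound (R : realType) (n : nat) (s b : R) : (2 <= n)%N ->
  0 <= s < 1 -> b = (n%:R - 1) / 2 - s -> 0 < b ->
  exists2 K, 0 < K & forall N y, 0 <= y < 1 ->
  \sum_(0 <= k < N) (wave_coef n b k * (b + 2 * k%:R) * y ^+ k)
    <= K * (1 - y) `^ (- (1 - s)).
Proof.
move=> n2 s01 bE b0; have [K K0 HK] := wave_coef_bound n2 s01 bE b0.
case/andP: (s01) => s0 s1; have s1' : 0 < 1 - s by lra.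
exists (K * (1 + (1 - s)^-1)).
  by rewrite mulr_gt0// addr_gt0// invr_gt0.
move=> N y y01; rewrite -mulrA.
apply: le_trans (ler_wpM2l (ltW K0) (sum_powRN_geometric N s01 y01)).
rewrite mulr_sumr; apply: ler_sum => k _.
by rewrite mulrA ler_wpM2r// exprn_ge0//; case/andP: y01.
Qed.

(** * Smooth functions of one variable *)

Section smooth1.
Variable R : realType.
Implicit Types f g : R -> R.

(** Differentiability is required as the existence of a derivative, so that the
closure properties follow by induction on the order. *)
Fixpoint C1k (k : nat) f : Prop :=
  if k is j.+1 then
    exists f', (forall x : R, is_derive x 1 f (f' x)) /\ C1k j f'
  else continuous f.

Definition smooth1 f := forall k, C1k k f.

Lemma is_derive_continuous f f' : (forall x : R, is_derive x 1 f (f' x)) ->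
  continuous f.
Proof.
by move=> df x; apply/differentiable_continuous/derivable1_diffP/(@ex_derive _ _ _ _ _ _ _ (df x)).
Qed.

Lemma C1kW k f : C1k k.+1 f -> C1k k f.
Proof.
elim: k f => [|k IH] f [f' [df Cf]]; first exact: is_derive_continuous df.
by exists f'; split => //; apply: IH.
Qed.

Lemma C1k_cst k (c : R) : C1k k (fun=> c).
Proof.
elim: k c => [|k IH] c; first exact: cst_continuous.
by exists (fun=> 0); split => // x; exact: is_derive_cst.
Qed.

Lemma C1kD k f g : C1k k f -> C1k k g -> C1k k (fun x => f x + g x).
Proof.
elim: k f g => [|k IH] f g.
  by move=> cf cg x; apply: cvgD; [exact: cf|exact: cg].
move=> [f' [df Cf]] [g' [dg Cg]]; exists (fun x => f' x + g' x); split; last exact: IH.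
by move=> x; apply: is_deriveD.
Qed.

Lemma C1kM k f g : C1k k f -> C1k k g -> C1k k (fun x => f x * g x).
Proof.
elim: k f g => [|k IH] f g.
  by move=> cf cg x; apply: cvgM; [exact: cf|exact: cg].
move=> Cf Cg; have Cf0 := C1kW Cf; have Cg0 := C1kW Cg.
case: Cf Cg => [f' [df Cf]] [g' [dg Cg]].
exists (fun x => f x * g' x + g x * f' x); split.
  by move=> x; apply: is_deriveM.
by apply: C1kD; exact: IH.
Qed.

Lemma C1k_id k : C1k k id.
Proof.
case: k => [|k]; first by move=> x; exact: cvg_id.
exists (fun=> 1); split; last exact: C1k_cst.
by move=> x; exact: is_derive_id.
Qed.

Lemma C1kV k f : (forall x, f x != 0) -> C1k k f -> C1k k (fun x => (f x)^-1).
Proof.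
move=> f0; elim: k => [|k IH].
  by move=> cf x; apply: cvgV => //; exact: cf.
move=> Cf; have Cf0 := C1kW Cf; case: Cf => [f' [df Cf]].
exists (fun x => - 1 * ((f x)^-1 * (f x)^-1 * f' x)); split.
  move=> x; have -> : -1 * ((f x)^-1 * (f x)^-1 * f' x) = - (f x) ^- 2 *: f' x.
    by rewrite /GRing.scale/= expr2 invfM; ring.
  exact: is_deriveV.
apply: C1kM; first exact: C1k_cst.
by apply: C1kM => //; apply: C1kM; exact: IH.
Qed.

Lemma is_derive_affine (c d : R) f (l x : R) : is_derive (c * x + d) 1 f l ->
  is_derive x 1 (fun x => f (c * x + d)) (c * l).
Proof.
move=> df.
have dg : is_derive x 1 (fun x : R => c * x + d) c.
  have h1 : is_derive x 1 (c \*: (@id R)) (c *: (1 : R)) by exact: is_deriveZ.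
  have h2 := is_deriveD h1 (is_derive_cst d x 1).
  by apply: (is_derive_eq h2); rewrite addr0 /GRing.scale/= mulr1.
by have := @is_derive1_comp R f (fun x => c * x + d) x l c df dg; rewrite mulrC.
Qed.

Lemma C1k_affine k f c d : C1k k f -> C1k k (fun x => f (c * x + d)).
Proof.
elim: k f => [|k IH] f.
  move=> cf x; apply: (@continuous_comp _ _ _ (fun x => c * x + d) f); last exact: cf.
  by apply: cvgD; [apply: cvgM; [exact: cvg_cst|exact: cvg_id]|exact: cvg_cst].
move=> [f' [df Cf]]; exists (fun x => c * f' (c * x + d)); split.
  by move=> x; apply: is_derive_affine; exact: df.
by apply: C1kM; [exact: C1k_cst|exact: IH].
Qed.

Lemma smooth1_cst c : smooth1 (fun=> c).
Proof. by move=> k; exact: C1k_cst. Qed.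
Lemma smooth1_id : smooth1 id.
Proof. by move=> k; exact: C1k_id. Qed.
Lemma smooth1D f g : smooth1 f -> smooth1 g -> smooth1 (fun x => f x + g x).
Proof. by move=> sf sg k; exact: C1kD. Qed.
Lemma smooth1M f g : smooth1 f -> smooth1 g -> smooth1 (fun x => f x * g x).
Proof. by move=> sf sg k; exact: C1kM. Qed.
Lemma smooth1V f : (forall x, f x != 0) -> smooth1 f -> smooth1 (fun x => (f x)^-1).
Proof. by move=> f0 sf k; exact: C1kV. Qed.
Lemma smooth1_affine f c d : smooth1 f -> smooth1 (fun x => f (c * x + d)).
Proof. by move=> sf k; exact: C1k_affine. Qed.
Lemma smooth1X f m : smooth1 f -> smooth1 (fun x => f x ^+ m).
Proof.
move=> sf; elim: m => [|m IH].
  by rewrite (_ : (fun=> _) = (fun=> 1)); [exact: smooth1_cst|by apply/funext => x; rewrite expr0].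
rewrite (_ : (fun=> _) = (fun x => f x * f x ^+ m)); first exact: smooth1M.
by apply/funext => x; rewrite exprS.
Qed.

Lemma smooth1_derive f : smooth1 f ->
  (forall x : R, is_derive x 1 f ((derive1 f) x)) /\ smooth1 (derive1 f).
Proof.
move=> sf; have [f' [df _]] := sf 1%N.
have f'E : (derive1 f) = f'.
  by apply/funext => x; rewrite derive1E (@derive_val _ _ _ _ _ _ _ (df x)).
split; first by move=> x; rewrite f'E; exact: df.
move=> k; have [g [dg Cg]] := sf k.+1.
suff -> : (derive1 f) = g by [].
by apply/funext => x; rewrite derive1E (@derive_val _ _ _ _ _ _ _ (dg x)).
Qed.

Lemma derive1_is_derive f (l x : R) : is_derive x 1 f l -> (derive1 f) x = l.
Proof. by move=> df; rewrite derive1E (@derive_val _ _ _ _ _ _ _ df). Qed.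

Lemma smooth1_continuous f : smooth1 f -> continuous f.
Proof. by move=> sf; exact: (sf 0%N). Qed.

(** The family x^(- m) exp (- 1 / x) is stable under differentiation up to linear
combinations, which makes its members smooth in one induction. *)
Definition flat (m : nat) (x : R) : R :=
  if 0 < x then x ^- m * expR (- x^-1) else 0.

Lemma flat_ge0 m x : 0 <= flat m x.
Proof. by rewrite /flat; case: ifP => // x0; rewrite mulr_ge0 ?expR_ge0// invr_ge0 exprn_ge0// ltW. Qed.

Lemma flat_gt0 m x : 0 < x -> 0 < flat m x.
Proof. by move=> x0; rewrite /flat x0 mulr_gt0 ?expR_gt0// invr_gt0 exprn_gt0. Qed.

Lemma flat0 m x : x <= 0 -> flat m x = 0.
Proof. by rewrite /flat ltNge => ->. Qed.

(** A quadratic bound at 0 is all that differentiability at 0 takes.  It comes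
from one term of the exponential series at 1 / x. *)
Lemma flat_le m x : flat m x <= (m.+2)`!%:R * x ^+ 2.
Proof.
have [x0|x0] := leP x 0; first by rewrite flat0// mulr_ge0// exprn_even_ge0.
rewrite /flat x0 expRN.
have xi : 0 <= x^-1 by rewrite invr_ge0 ltW.
have h := expR_ge1Dxn m.+1 xi.
have fp : 0 < (m.+2)`!%:R :> R by rewrite ltr0n fact_gt0.
have h2 : x^-1 ^+ m.+2 / m.+2`!%:R <= expR x^-1 by lra.
rewrite ler_pdivrMr ?expR_gt0//.
have -> : x ^- m = (m.+2)`!%:R * x ^+ 2 * (x^-1 ^+ m.+2 / m.+2`!%:R).
  rewrite -[m.+2]addn2 exprD !exprVn; field.
  by rewrite !gt_eqF ?exprn_gt0// -addn2.
by rewrite ler_wpM2l// mulr_ge0// exprn_ge0// ltW.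
Qed.

Lemma is_derive_flat m (x : R) :
  is_derive x 1 (flat m) (flat m.+2 x - m%:R * flat m.+1 x).
Proof.
have [x0|x0|->] := ltgtP x 0.
- rewrite !flat0 ?(ltW x0)// mulr0 subr0.
  apply: (@near_eq_is_derive _ _ _ (cst 0)).
  near=> y; rewrite /= flat0//; near: y.
  by apply: filterS (lt_nbhsl x0) => y; exact: ltW.
- have xn0 : x != 0 by rewrite gt_eqF.
  have d1 : is_derive x 1 (fun x : R => x^-1) (- x ^- 2 *: (1:R)).
    exact: (@is_deriveV _ id).
  have d2 : is_derive x 1 (fun x : R => expR (- x^-1)) (x ^- 2 * expR (- x^-1)).
    have dN := is_deriveN d1.
    apply: is_derive_eq (@is_derive1_comp R expR (fun x => - x^-1) x _ _ (is_derive_expR _) dN) _.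
    by rewrite /GRing.scale/= mulr1 opprK mulrC.
  have d3 : is_derive x 1 (fun x : R => x ^- m) (- (x ^+ m) ^- 2 *: ((m%:R * x ^+ m.-1) *: (1:R))).
    apply: (@is_deriveV _ (fun x => x ^+ m)); first by rewrite expf_neq0.
    by have := @is_deriveX _ _ (@id R) m x 1 1 _; rewrite exprfctE; apply.
  suff d4 : is_derive x 1 (fun x : R => x ^- m * expR (- x^-1))
      (flat m.+2 x - m%:R * flat m.+1 x).
    apply: near_eq_is_derive d4.
    near=> y; rewrite /flat ifT//; near: y; exact: lt_nbhsr.
  apply: is_derive_eq (is_deriveM d3 d2) _.
  rewrite /flat x0 /GRing.scale/= mulr1; set e := expR _.
  case: m d3 => [|m] _ /=; first by rewrite expr0 !mul0r !mulr0 !invr1; ring.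
  rewrite !exprS; field.
  by rewrite xn0 expf_neq0.
- rewrite !flat0// mulr0 subr0; apply/is_derive1_caratheodory.
  exists (fun z => flat m z / z); split.
  + move=> z; rewrite (@flat0 m 0)// !subr0; have [->|z0] := eqVneq z 0.
      by rewrite flat0// mul0r mul0r.
    by rewrite mulfVK.
  + have g0 : flat m 0 / 0 = 0 by rewrite flat0// mul0r.
    rewrite /prop_for /continuous_at g0.
    apply/cvgr0Pnorm_le => //= e e0.
    have fp : 0 < (m.+2)`!%:R :> R by rewrite ltr0n fact_gt0.
    near=> z.
    have [->|z0] := eqVneq z 0; first by rewrite flat0// mul0r normr0 ltW.
    rewrite normrM normfV ler_pdivrMr ?normr_gt0// ger0_norm ?flat_ge0//.
    apply: le_trans (flat_le _ _) _.
    rewrite -[z ^+ 2]real_normK ?num_real// expr2 mulrA ler_wpM2r//.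
    rewrite mulrC -ler_pdivlMr//; near: z.
    exists (e / (m.+2)`!%:R); first exact: divr_gt0.
    by move=> z /=; rewrite sub0r normrN => /ltW.
  + by rewrite flat0// mul0r.
Unshelve. all: by end_near. Qed.

Lemma smooth1_flat m : smooth1 (flat m).
Proof.
move=> k; elim: k m => [|k IH] m.
  exact: (is_derive_continuous (is_derive_flat m)).
exists (fun x => flat m.+2 x + (- m%:R) * flat m.+1 x); split.
  by move=> x; rewrite mulNr; exact: is_derive_flat.
by apply: C1kD => //; apply: C1kM => //; exact: C1k_cst.
Qed.

Definition step (x : R) := flat 0 x / (flat 0 x + flat 0 (1 - x)).

Lemma step_den_gt0 x : 0 < flat 0 x + flat 0 (1 - x).
Proof.
have [x0|x0] := ltP 0 x; first by rewrite ltr_wpDr ?flat_ge0 ?flat_gt0.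
by rewrite ltr_wpDl ?flat_ge0 ?flat_gt0//; lra.
Qed.

Lemma smooth1_step : smooth1 step.
Proof.
apply: smooth1M; first exact: smooth1_flat.
apply: smooth1V; first by move=> x; rewrite gt_eqF ?step_den_gt0.
apply: smooth1D; first exact: smooth1_flat.
rewrite (_ : (fun x => _) = (fun x => flat 0 (-1 * x + 1))).
  by apply: smooth1_affine; exact: smooth1_flat.
by apply/funext => x; rewrite mulN1r addrC.
Qed.

Lemma step0 x : x <= 0 -> step x = 0.
Proof. by move=> x0; rewrite /step flat0// mul0r. Qed.

Lemma step1 x : 1 <= x -> step x = 1.
Proof.
move=> x1; rewrite /step (@flat0 0 (1 - x)); last lra.
by rewrite addr0 divff// gt_eqF// flat_gt0//; lra.
Qed.

Lemma step_ge0 x : 0 <= step x.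
Proof. by rewrite divr_ge0 ?flat_ge0// ltW// step_den_gt0. Qed.

Lemma step_le1 x : step x <= 1.
Proof. by rewrite /step ler_pdivrMr ?step_den_gt0// mul1r lerDl flat_ge0. Qed.

Lemma derive_step_ge0 x : 0 <= (derive1 step) x.
Proof.
pose D := fun x : R => flat 0 x + flat 0 (1 - x).
have d1 : is_derive x 1 (fun x => flat 0 (1 - x)) (- flat 2 (1 - x)).
  have := @is_derive_affine (-1) 1 (flat 0) _ x (is_derive_flat 0 _).
  have -> : -1 * x + 1 = 1 - x by ring.
  rewrite mul0r subr0 mulN1r; apply: near_eq_is_derive.
  by near=> y; congr flat; ring.
have d0 : is_derive x 1 (flat 0) (flat 2 x).
  by apply: is_derive_eq (is_derive_flat 0 x) _; rewrite mul0r subr0.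
have dD := is_deriveD d0 d1.
have Dn : (flat 0 + (fun x => flat 0 (1 - x))) x != 0.
  by rewrite gt_eqF//; exact: step_den_gt0.
have dV := @is_deriveV _ (flat 0 + (fun x => flat 0 (1 - x))) x _ 1 Dn dD.
have ds := is_deriveM d0 dV.
rewrite (@derive1_is_derive step _ x ds) /GRing.scale/= !fctE.
have := step_den_gt0 x; set d := _ + _ => d_gt0.
have -> : flat 0 x * (- d ^- 2 * (flat 2 x - flat 2 (1 - x))) + d^-1 * flat 2 x
  = d ^- 2 * (flat 2 x * flat 0 (1 - x) + flat 0 x * flat 2 (1 - x)).
  transitivity (d ^- 2 * (flat 2 x * d - flat 0 x * (flat 2 x - flat 2 (1 - x)))).
    by field; rewrite gt_eqF.
  by rewrite /d; ring.
by rewrite mulr_ge0// ?invr_ge0 ?exprn_ge0 ?(ltW d_gt0)// addr_ge0// mulr_ge0// flat_ge0.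
Unshelve. all: by end_near. Qed.

(** A factor w that vanishes below 1 / 2 extends the power smoothly to the line. *)
Definition cut_pow (w : R -> R) (b y : R) := w y * y `^ (- b).

(** The derivative of w y^(- b) is a combination of two functions of the same kind,
with w replaced by its derivative or b by b + 1. *)
Lemma smooth1_cut_pow w b : smooth1 w -> (forall y, y < 2^-1 -> w y = 0) ->
  smooth1 (cut_pow w b).
Proof.
move=> + + k; elim: k w b => [|k IH] w b sw w0.
  have [dw sw'] := smooth1_derive sw.
  have pos (x : R) : 2^-1 <= x -> 0 < x by lra.
  move=> x; have [x0|x0] := ltP x (2^-1).
    have : (\near x, (cst 0) x = cut_pow w b x).
      near=> y; rewrite /cut_pow w0 ?mul0r//; near: y; exact: lt_nbhsl.
    move=> H; rewrite /continuous_at /cut_pow w0// mul0r.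
    by apply: cvg_trans (@cvg_cst _ (0:R) _ (nbhs x) _); exact: near_eq_cvg.
  have pc : {for x, continuous (fun y : R => y `^ (- b))}.
    apply: differentiable_continuous; apply/derivable1_diffP.
    by apply: derivable_powR; rewrite in_itv/= andbT pos.
  by apply: cvgM; [exact: (smooth1_continuous sw)|exact: pc].
have [dw sw'] := smooth1_derive sw.
have w'0 y : y < 2^-1 -> (derive1 w) y = 0.
  move=> y0; apply: derive1_is_derive.
  apply: (@near_eq_is_derive _ _ _ (cst 0)).
  by near=> z; rewrite /= w0//; near: z; exact: lt_nbhsl.
exists (fun y => cut_pow (derive1 w) b y + (- b) * cut_pow w (b + 1) y); split; last first.
  apply: C1kD; first exact: IH.
  by apply: C1kM; [exact: C1k_cst|exact: IH].
move=> y; have [y0|y0] := ltP y (2^-1).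
  rewrite /cut_pow w0// w'0// !mul0r mulr0 addr0.
  apply: (@near_eq_is_derive _ _ _ (cst 0)).
  by near=> z; rewrite /= w0 ?mul0r//; near: z; exact: lt_nbhsl.
have y1 : 0 < y by lra.
apply: is_derive_eq (is_deriveM (dw y) (is_derive1_powR (- b) y1)) _.
rewrite /cut_pow /GRing.scale/= opprD; ring.
Unshelve. all: by end_near. Qed.

Lemma is_derive_cut_pow w (b y : R) : smooth1 w -> 0 < y ->
  is_derive y 1 (cut_pow w b) (cut_pow (derive1 w) b y - b * cut_pow w (b + 1) y).
Proof.
move=> sw y0; have [dw _] := smooth1_derive sw.
apply: is_derive_eq (is_deriveM (dw y) (is_derive1_powR (- b) y0)) _.
by rewrite /cut_pow /GRing.scale/= opprD; ring.
Qed.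

End smooth1.

(** * Smooth functions of space and time *)

Section Ck_theory.
Variables (R : realType) (V : normedModType R).
Implicit Types f g : V -> R.

Lemma CkW k f : Ck k.+1 f -> Ck k f.
Proof.
elim: k f => [|k IH] f [cf df]; first by split.
by split => // v; have [dv Cf] := df v; split => //; exact: IH.
Qed.

Lemma Ck_continuous k f : Ck k f -> continuous f.
Proof. by case: k => [|k] []. Qed.

Lemma Ck_cst k (c : R) : Ck k (fun _ : V => c).
Proof.
elim: k c => [|k IH] c; split => //; try exact: cst_continuous.
move=> v; split; first by move=> x; exact: derivable_cst.
rewrite (_ : 'D_v _ = fun=> 0); first exact: IH.
by apply/funext => x; rewrite derive_cst.
Qed.

Lemma CkD k f g : Ck k f -> Ck k g -> Ck k (fun x => f x + g x).
Proof.
have cD : continuous f -> continuous g -> continuous (fun x => f x + g x).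
  by move=> cf cg x; apply: cvgD; [exact: cf|exact: cg].
elim: k f g cD => [|k IH] f g cD; first by move=> [cf _] [cg _]; split => //; exact: cD.
move=> [cf df] [cg dg]; split; first exact: cD.
move=> v; have [dfv Cf] := df v; have [dgv Cg] := dg v; split.
  by move=> x; exact: derivableD.
rewrite (_ : 'D_v _ = fun x => 'D_v f x + 'D_v g x).
  by apply: IH => // cf' cg' x; apply: cvgD; [exact: cf'|exact: cg'].
by apply/funext => x; exact: deriveD.
Qed.

Lemma CkM k f g : Ck k f -> Ck k g -> Ck k (fun x => f x * g x).
Proof.
have cM (f1 g1 : V -> R) : continuous f1 -> continuous g1 -> continuous (fun x => f1 x * g1 x).
  by move=> cf cg x; apply: cvgM; [exact: cf|exact: cg].
elim: k f g => [|k IH] f g; first by move=> [cf _] [cg _]; split => //; exact: cM.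
move=> Cf0 Cg0; have Cf1 := CkW Cf0; have Cg1 := CkW Cg0.
case: Cf0 Cg0 => [cf df] [cg dg]; split; first exact: cM.
move=> v; have [dfv Cf] := df v; have [dgv Cg] := dg v; split.
  by move=> x; exact: derivableM.
rewrite (_ : 'D_v _ = fun x => f x * 'D_v g x + g x * 'D_v f x).
  by apply: CkD; exact: IH.
by apply/funext => x; exact: deriveM.
Qed.

Lemma smooth_cst (c : R) : smooth (fun _ : V => c).
Proof. by move=> k; exact: Ck_cst. Qed.
Lemma smoothD f g : smooth f -> smooth g -> smooth (fun x => f x + g x).
Proof. by move=> sf sg k; exact: CkD. Qed.
Lemma smoothM f g : smooth f -> smooth g -> smooth (fun x => f x * g x).
Proof. by move=> sf sg k; exact: CkM. Qed.
Lemma smoothX f m : smooth f -> smooth (fun x => f x ^+ m).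
Proof.
move=> sf; elim: m => [|m IH].
  by rewrite (_ : (fun=> _) = (fun=> 1)); [exact: smooth_cst|apply/funext => x; rewrite expr0].
rewrite (_ : (fun=> _) = (fun x => f x * f x ^+ m)); first exact: smoothM.
by apply/funext => x; rewrite exprS.
Qed.
Lemma smooth_sum (I : Type) (r : seq I) (F : I -> V -> R) :
  (forall i, smooth (F i)) -> smooth (fun x => \sum_(i <- r) F i x).
Proof.
move=> sF; elim: r => [|i r IH].
  by rewrite (_ : (fun=> _) = (fun=> 0)); [exact: smooth_cst|apply/funext => x; rewrite big_nil].
rewrite (_ : (fun=> _) = (fun x => F i x + \sum_(i <- r) F i x)); first exact: smoothD.
by apply/funext => x; rewrite big_cons.
Qed.
Lemma smooth_prod (I : Type) (r : seq I) (F : I -> V -> R) :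
  (forall i, smooth (F i)) -> smooth (fun x => \prod_(i <- r) F i x).
Proof.
move=> sF; elim: r => [|i r IH].
  by rewrite (_ : (fun=> _) = (fun=> 1)); [exact: smooth_cst|apply/funext => x; rewrite big_nil].
rewrite (_ : (fun=> _) = (fun x => F i x * \prod_(i <- r) F i x)); first exact: smoothM.
by apply/funext => x; rewrite big_cons.
Qed.

Variable L : V -> R.
Hypothesis HL : forall (h : R) v x, L (h *: v + x) = h * L v + L x.
Hypothesis cL : continuous L.

(** The maps L of interest are the coordinates of the space and the projection of
space-time to the time. *)
Lemma is_derive_comp_linear (f : R -> R) (l : R) (x v : V) :
  is_derive (L x) 1 f l -> is_derive x v (f \o L) (L v * l).
Proof.
move=> [df fl]; have dif : differentiable f (L x) by apply/derivable1_diffP.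
have dLv : derivable f (L x) (L v) by exact: diff_derivable.
have E : (fun h : R => h^-1 *: (((f \o L) \o shift x) (h *: v) - (f \o L) x)) =
         (fun h : R => h^-1 *: ((f \o shift (L x)) (h *: L v) - f (L x))).
  by apply/funext => h /=; rewrite HL.
split; first by rewrite /derivable E.
rewrite /derive E -/(derive f (L x) (L v)) deriveE//.
have -> : L v = L v *: (1 : R) by rewrite /GRing.scale/= mulr1.
rewrite linearZ/= -deriveE// fl /GRing.scale/= mulr1//.
Qed.

Lemma Ck_comp_linear k (f : R -> R) : C1k k f -> Ck k (f \o L).
Proof.
elim: k f => [|k IH] f.
  by move=> cf; split => // x; apply: continuous_comp; [exact: cL|exact: cf].
move=> Cf; have cf : continuous f.
  by case: (Cf) => f' [df _]; exact: is_derive_continuous df.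
split; first by move=> x; apply: continuous_comp; [exact: cL|exact: cf].
case: Cf => f' [df Cf] v; split.
  by move=> x; have [] := is_derive_comp_linear v (df (L x)).
rewrite (_ : 'D_v _ = fun x => L v * (f' \o L) x).
  by apply: CkM; [exact: Ck_cst|exact: IH].
by apply/funext => x; have [] := is_derive_comp_linear v (df (L x)).
Qed.

Lemma smooth_comp_linear (f : R -> R) : smooth1 f -> smooth (f \o L).
Proof. by move=> sf k; exact: Ck_comp_linear. Qed.

End Ck_theory.

Section tensor.
Variables (R : realType) (n : nat).
Local Notation V := 'rV[R]_n.

Lemma Ck_fst k (h : V -> R) : Ck k h -> Ck k (fun z : V * R => h z.1).
Proof.
have cf (f : V -> R) : continuous f -> continuous (fun z : V * R => f z.1).
  move=> cf; rewrite -[X in continuous X]/(f \o (@fst V R)) => -[a b].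
  by apply: continuous_comp; [exact: (@cvg_fst _ _ (nbhs a) (nbhs b))|exact: cf].
elim: k h => [|k IH] h; first by move=> [ch _]; split => //; exact: cf.
move=> [ch dh]; split; first exact: cf.
by move=> v; have [dhv Ch] := dh v.1; split; [move=> x; exact: (dhv x.1)|exact: (IH _ Ch)].
Qed.

Lemma smooth_snd (g : R -> R) : smooth1 g -> smooth (fun z : V * R => g z.2).
Proof.
move=> sg; apply: (@smooth_comp_linear _ (V * R)%type snd) => //.
by move=> [a b]; exact: (@cvg_snd _ _ (nbhs a) (nbhs b)).
Qed.

Definition tensor (h : V -> R) (g : R -> R) (z : V * R) : R := h z.1 * g z.2.

Lemma smooth_tensor h g : smooth h -> smooth1 g -> smooth (tensor h g).
Proof.
move=> sh sg; apply: smoothM; last exact: smooth_snd.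
by move=> k; exact: Ck_fst.
Qed.

Lemma is_derive_tensor (h : V -> R) (g : R -> R) (v : V) (s : R) (z : V * R) (dg : R) :
  derivable h z.1 v -> is_derive z.2 1 g dg ->
  is_derive z (v, s) (tensor h g) ('D_v h z.1 * g z.2 + h z.1 * (s * dg)).
Proof.
move=> dh Dg.
have d1 : is_derive z (v, s) (fun z : V * R => h z.1) ('D_v h z.1) by split.
have d2 : is_derive z (v, s) (g \o snd) (s * dg).
  exact: (@is_derive_comp_linear _ (V * R)%type snd).
apply: is_derive_eq (is_deriveM d1 d2) _.
by rewrite /GRing.scale/= addrC; congr (_ + _); exact: mulrC.
Qed.

Lemma d_time_tensor h g : smooth h -> smooth1 g ->
  d_time (tensor h g) = tensor h (derive1 g).
Proof.
move=> sh sg; apply/funext => z; have [dg _] := smooth1_derive sg.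
have dh : derivable h z.1 0 by have [_ /(_ 0)[]] := sh 1%N.
rewrite /d_time; have [_ ->] := is_derive_tensor 1 dh (dg z.2).
by rewrite derive0 mul0r add0r mul1r.
Qed.

Definition space_lap (h : V -> R) (x : V) : R :=
  \sum_(i < n) 'D_(unit_rV R i) ('D_(unit_rV R i) h) x.

Lemma laplacian_tensor h g : smooth h -> smooth1 g ->
  laplacian (tensor h g) = tensor (space_lap h) g.
Proof.
move=> sh sg; apply/funext => z; have [dg _] := smooth1_derive sg.
rewrite /laplacian /tensor /space_lap mulr_suml; apply: eq_bigr => i _.
have E : 'D_(unit_rV R i, 0) (fun z : V * R => h z.1 * g z.2) =
    tensor ('D_(unit_rV R i) h) g.
  apply/funext => y.
  have dh : derivable h y.1 (unit_rV R i) by have [_ /(_ (unit_rV R i))[]] := sh 1%N.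
  have [_ ->] := is_derive_tensor 0 dh (dg y.2).
  by rewrite mul0r mulr0 addr0.
rewrite E.
have dh : derivable ('D_(unit_rV R i) h) z.1 (unit_rV R i).
  by have [_ /(_ (unit_rV R i))[_ [_ /(_ (unit_rV R i))[]]]] := sh 2%N.
have [_ ->] := is_derive_tensor 0 dh (dg z.2).
by rewrite mul0r mulr0 addr0.
Qed.

Lemma test_function_tensor (h : V -> R) (g : R -> R) (B a b : R) : smooth h -> smooth1 g -> 0 < a ->
  (forall x : V, (exists i, B < `|x ord0 i|) -> h x = 0) ->
  (forall t, ~ (a <= t <= b) -> g t = 0) ->
  test_function (@space_time R n +oo%E) (tensor h g).
Proof.
move=> sh sg a0 h0 g0; split; first exact: smooth_tensor.
exists ([set x : V | forall i, `[- B, B]%classic (x ord0 i)] `*` `[a, b]%classic); split.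
- apply: compact_setX; last exact: segment_compact.
  apply: (@rV_compact _ n (fun=> `[- B, B]%classic)) => i; exact: segment_compact.
- move=> [x t] /= [_]; rewrite in_itv/= => /andP[at_ _]; split => /=.
    exact: lt_le_trans at_.
  by rewrite ltry.
- move=> [x t] /= /not_andP[xB|tB]; rewrite /tensor/=.
    rewrite h0 ?mul0r//; apply: contrapT => H; apply: xB => i.
    rewrite in_itv/= -ler_norml leNgt; apply/negP => Bi; apply: H; by exists i.
  by rewrite g0 ?mulr0// => H; apply: tB; rewrite in_itv.
Qed.

(** The square of the Euclidean norm is a polynomial, whereas the norm itself is
not smooth at the origin. *)
Definition rsq (x : V) : R := \sum_(i < n) x ord0 i ^+ 2.

Lemma rsq_ge0 x : 0 <= rsq x.
Proof. by apply: sumr_ge0 => i _; rewrite sqr_ge0. Qed.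

Lemma coord_lin (i : 'I_n) (h : R) (v x : V) :
  (h *: v + x) ord0 i = h * v ord0 i + x ord0 i.
Proof. by rewrite !mxE. Qed.

Lemma smooth_coord (g : R -> R) (i : 'I_n) : smooth1 g ->
  smooth (fun x : V => g (x ord0 i)).
Proof.
move=> sg; apply: (@smooth_comp_linear R V (fun x => x ord0 i)) => //.
  by move=> h v x; exact: coord_lin.
exact: coord_continuous.
Qed.

Lemma smooth_rsq : smooth rsq.
Proof.
apply: smooth_sum => i; apply: smoothX; exact: (smooth_coord i (@smooth1_id R)).
Qed.

Definition plateau (B y : R) : R := step (B + 1 - y) * step (B + 1 + y).

Lemma smooth1_plateau B : smooth1 (plateau B).
Proof.
apply: smooth1M.
  rewrite (_ : (fun x => _) = (fun x => step (-1 * x + (B + 1)))).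
    by apply: smooth1_affine; exact: smooth1_step.
  by apply/funext => y; congr step; ring.
rewrite (_ : (fun x => _) = (fun x => step (1 * x + (B + 1)))).
  by apply: smooth1_affine; exact: smooth1_step.
by apply/funext => y; congr step; ring.
Qed.

Lemma plateau1 B y : `|y| <= B -> plateau B y = 1.
Proof. by rewrite ler_norml => /andP[? ?]; rewrite /plateau !step1 ?mulr1//; lra. Qed.

Lemma plateau0 B y : B + 1 < `|y| -> plateau B y = 0.
Proof.
rewrite lter_normr => /orP[h|h]; rewrite /plateau.
  by rewrite step0 ?mul0r//; lra.
by rewrite (@step0 _ (B + 1 + y)) ?mulr0//; lra.
Qed.

Lemma plateau_ge0 B y : 0 <= plateau B y.
Proof. by rewrite mulr_ge0// step_ge0. Qed.

(** A product of cut-offs in the coordinates: it is 1 on the cube of half-side B and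
0 outside the cube of half-side B + 1. *)
Definition chi (B : R) (x : V) : R := \prod_(i < n) plateau B (x ord0 i).

Lemma smooth_chi B : smooth (chi B).
Proof. by apply: smooth_prod => i; apply: smooth_coord; exact: smooth1_plateau. Qed.

Lemma chi_ge0 B x : 0 <= chi B x.
Proof. by apply: prodr_ge0 => i _; exact: plateau_ge0. Qed.

Lemma chi1 B (x : V) : (forall i, `|x ord0 i| <= B) -> chi B x = 1.
Proof. by move=> H; rewrite /chi big1// => i _; rewrite plateau1. Qed.

Lemma chi0 B (x : V) : (exists i, B + 1 < `|x ord0 i|) -> chi B x = 0.
Proof. by move=> [i H]; rewrite /chi (bigD1 i)//= plateau0// mul0r. Qed.

(** The space factor |x|^(2 k) of a test function.  For B large the cut-off is 1 on
the support of the solution and never shows. *)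
Definition hpoly (B : R) (k : nat) (x : V) : R := rsq x ^+ k * chi B x.

Lemma smooth_hpoly B k : smooth (hpoly B k).
Proof. by apply: smoothM; [apply: smoothX; exact: smooth_rsq|exact: smooth_chi]. Qed.

Lemma hpoly_ge0 B k x : 0 <= hpoly B k x.
Proof. by rewrite mulr_ge0// ?chi_ge0// exprn_ge0// rsq_ge0. Qed.

Lemma is_derive_coord (i : 'I_n) (x v : V) :
  is_derive x v (fun x : V => x ord0 i) (v ord0 i).
Proof.
have d := is_derive_id (x ord0 i) (1 : R).
have := @is_derive_comp_linear R V (fun x => x ord0 i) (coord_lin i) id 1 x v d.
by rewrite mulr1.
Qed.

Lemma is_derive_rsqX k (x : V) i :
  is_derive x (unit_rV R i) (fun x => rsq x ^+ k) (2 * k%:R * (x ord0 i * rsq x ^+ k.-1)).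
Proof.
have d1 : is_derive x (unit_rV R i) rsq (2 * x ord0 i).
  have -> : rsq = \sum_(j < n) (fun x : V => x ord0 j) ^+ 2.
    by apply/funext => y; rewrite fct_sumE /rsq; apply: eq_bigr => j _; rewrite exprfctE.
  have H := is_derive_sum (fun j => is_deriveX 2 (is_derive_coord j x (unit_rV R i))).
  apply: (is_derive_eq H).
  rewrite (bigD1 i)//= big1.
    by rewrite addr0 /unit_rV mxE !eqxx /GRing.scale/= mulr1 expr1.
  by move=> j ji; rewrite /unit_rV mxE eqxx /= (negbTE ji) scaler0.
have := is_deriveX k d1; rewrite exprfctE => H; apply: (is_derive_eq H).
by rewrite /GRing.scale/=; ring.
Qed.

Lemma space_lap_rsqX k (x : V) :
  space_lap (fun x => rsq x ^+ k) x = 2 * k%:R * (2 * k%:R + n%:R - 2) * rsq x ^+ k.-1.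
Proof.
rewrite /space_lap.
have E i : 'D_(unit_rV R i) (fun x : V => rsq x ^+ k) =
    (fun x => (2 * k%:R) *: (x ord0 i * rsq x ^+ k.-1)).
  by apply/funext => y; have [_ ->] := is_derive_rsqX k y i.
have D i : 'D_(unit_rV R i) ('D_(unit_rV R i) (fun x : V => rsq x ^+ k)) x =
  2 * k%:R * (2 * k.-1%:R * (x ord0 i ^+ 2 * rsq x ^+ k.-2) + rsq x ^+ k.-1).
  rewrite E.
  have := is_deriveZ (2 * k%:R) (is_deriveM (is_derive_coord i x (unit_rV R i)) (is_derive_rsqX k.-1 x i)).
  move=> [_ ->]; rewrite /GRing.scale/= /unit_rV mxE !eqxx /= mulr1; ring.
rewrite (eq_bigr _ (fun i _ => D i)) -mulr_sumr big_split/= -mulr_sumr.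
rewrite -mulr_suml -/(rsq x) sumr_const card_ord.
case: k {E D} => [|[|k]]/=; first by rewrite mulr0 !mul0r.
  by rewrite mulr0 mul0r add0r expr0 -mulr_natr; ring.
by rewrite -mulr_natr exprS -!natr1; ring.
Qed.

Lemma space_lap_hpoly B k (x : V) : (forall i, `|x ord0 i| < B) ->
  space_lap (hpoly B k) x = 2 * k%:R * (2 * k%:R + n%:R - 2) * rsq x ^+ k.-1.
Proof.
move=> xB; rewrite -space_lap_rsqX; apply: eq_bigr => i _.
pose U := [set x : V | forall i, `|x ord0 i| < B].
have E (y : V) : U y -> hpoly B k y = rsq y ^+ k.
  by move=> yU; rewrite /hpoly chi1 ?mulr1// => j; exact/ltW.
have nU (y : V) : U y -> \near y, U y.
  move=> yU; apply: (@filter_forall _ _ (fun j (z : V) => `|z ord0 j| < B) (nbhs y)) => j.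
  have c : {for y, continuous (fun z : V => `|z ord0 j|)}.
    by apply: continuous_comp; [exact: coord_continuous|exact: norm_continuous].
  exact: (c _ (lt_nbhsl (yU j))).
have E1 (y : V) : U y -> 'D_(unit_rV R i) (hpoly B k) y = 'D_(unit_rV R i) (fun x => rsq x ^+ k) y.
  by move=> yU; apply: near_eq_derive; apply: filterS (nU y yU) => z; exact: E.
apply: near_eq_derive; have : U x by [].
by move/nU; apply: filterS => z; exact: E1.
Qed.

End tensor.

(** * The pairing in L2 *)

Section L2_abstract.
Context d (T : measurableType d) (R : realType).
Variable mu : {measure set T -> \bar R}.
Implicit Types f g k : T -> R.
Local Notation L2m f := (f \in Lfun mu 2%:E).
Local Notation N2 f := ('N[mu]_2%:E[EFin \o f])%E.

Definition inner f k : R := \int[mu]_x (f x * k x).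

Lemma L2_measurable f : L2m f -> measurable_fun setT f.
Proof. by rewrite inE => /andP[/[!inE]]. Qed.

Lemma L2_norm_lty f : L2m f -> (N2 f < +oo)%E.
Proof. by rewrite inE => /andP[_]; rewrite inE. Qed.

Lemma L2P f : measurable_fun setT f -> (N2 f < +oo)%E -> L2m f.
Proof. by move=> mf nf; rewrite inE; apply/andP; split; rewrite inE. Qed.

Lemma N2_sqr f : (N2 f `^ 2 = \int[mu]_x (f x ^+ 2)%:E)%E.
Proof.
rewrite poweR_Lnorm//; apply: eq_integral => x _ /=.
by rewrite powR_mulrn// real_normK// num_real.
Qed.

Lemma L2P_sqr f : measurable_fun setT f ->
  (\int[mu]_x (f x ^+ 2)%:E < +oo)%E -> L2m f.
Proof.
move=> mf; rewrite -N2_sqr => h; apply: L2P => //.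
exact: (@lty_poweRy _ _ 2).
Qed.

(** (f - g)^2 <= 2 f^2 + 2 g^2. *)
Lemma L2B f g : L2m f -> L2m g -> L2m (f \- g).
Proof.
move=> lf lg; have mf := L2_measurable lf; have mg := L2_measurable lg.
have mB : measurable_fun setT (f \- g) by exact: measurable_funB.
apply: L2P_sqr => //.
have i1 := Lfun2_integrable_sqr lf; have i2 := Lfun2_integrable_sqr lg.
have := integrableD measurableT (integrableZl measurableT 2 i1) (integrableZl measurableT 2 i2).
move=> /integrableP[m3]; apply: le_lt_trans.
apply: ge0_le_integral => //=.
- by move=> x _; rewrite lee_fin sqr_ge0.
- by apply/measurable_EFinP; exact: measurable_funX.
- apply/measurable_EFinP; apply: measurableT_comp => //.
  by apply: measurable_funD; apply: measurable_funM => //; exact: measurable_funX.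
- move=> x _; rewrite lee_fin; apply: le_trans (ler_norm _).
  rewrite -subr_ge0.
  have -> : 2 * f x ^+ 2 + 2 * g x ^+ 2 - (f x - g x) ^+ 2 = (f x + g x) ^+ 2 by ring.
  exact: sqr_ge0.
Qed.

Lemma L2_abs f : L2m f -> L2m (fun x => `|f x|).
Proof.
move=> lf; have mf := L2_measurable lf.
apply: L2P; first exact: measurableT_comp.
rewrite (_ : EFin \o _ = abse \o (EFin \o f)) ?Lnorm_abse ?L2_norm_lty//.
Qed.

Lemma L2_integrableM f k : L2m f -> L2m k ->
  mu.-integrable setT (EFin \o (fun x => f x * k x)).
Proof. by move=> lf lk; apply/Lfun1_integrable; exact: Lfun2_mul_Lfun1. Qed.

Lemma inner_le f k : L2m f -> L2m k ->
  (`|inner f k|%:E <= N2 f * N2 k)%E.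
Proof.
move=> lf lk; have i := L2_integrableM lf lk.
have pq : (2^-1 + 2^-1 = 1 :> R) by rewrite [RHS]splitr !div1r.
have p0 : 0 < 2 :> R by [].
apply: le_trans (@hoelder _ _ _ mu f k 2 2 (L2_measurable lf) (L2_measurable lk) p0 p0 pq).
rewrite Lnorm1 /inner EFin_normr_Rintegral//.
apply: le_trans (le_abse_integral _ _ _) _ => //.
exact: measurable_int i.
Qed.

Lemma innerB f g k : L2m f -> L2m g -> L2m k ->
  inner (f \- g) k = inner f k - inner g k.
Proof.
move=> lf lg lk; rewrite /inner -RintegralB//; try exact: L2_integrableM.
by apply: eq_Rintegral => x _ /=; rewrite mulrBl.
Qed.

(** Only the times t >= 0 matter; F may be arbitrary elsewhere. *)
Definition L2_continuous (F : R -> T -> R) :=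
  (forall t, 0 <= t -> L2m (F t)) /\
  forall s e : R, 0 <= s -> 0 < e -> exists2 dl, 0 < dl &
    forall t : R, 0 <= t -> `|t - s| < dl -> (N2 (F t \- F s)%R <= e%:E)%E.

Lemma N2_abs_le f g : measurable_fun setT f -> measurable_fun setT g ->
  (N2 (fun x => `|f x| - `|g x|)%R <= N2 (f \- g)%R)%E.
Proof.
move=> mf mg; rewrite unlock; apply: gt0_ler_poweR.
- by rewrite invr_ge0.
- by rewrite in_itv/= leey integral_ge0// => x _; exact: poweR_ge0.
- by rewrite in_itv/= leey integral_ge0// => x _; exact: poweR_ge0.
apply: ge0_le_integral => //=.
- apply/measurable_EFinP; apply: (measurableT_comp (measurable_powR _)).
  apply: measurableT_comp => //; apply: measurable_funB; exact: measurableT_comp.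
- apply/measurable_EFinP; apply: (measurableT_comp (measurable_powR _)).
  by apply: measurableT_comp => //; apply: measurable_funB.
- move=> x _; rewrite lee_fin; apply: ge0_ler_powR; rewrite ?nnegrE//.
  exact: ler_dist_dist.
Qed.

Lemma L2_continuous_abs F : L2_continuous F ->
  L2_continuous (fun t x => `|F t x|).
Proof.
move=> [LF cF]; split; first by move=> t t0; apply: L2_abs; exact: LF.
move=> s e s0 e0; have [dl dl0 Hd] := cF s e s0 e0; exists dl => // t t0 ts.
apply: le_trans (Hd t t0 ts).
by apply: N2_abs_le; apply: L2_measurable; exact: LF.
Qed.

(** Freezing F for t <= 0 at its initial value gives a function continuous on the
whole line, so that no one-sided limits are needed. *)
Lemma continuous_inner F k : L2_continuous F -> L2m k ->
  continuous (fun t : R => inner (F (Num.max 0 t)) k).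
Proof.
move=> [LF cF] lk s.
have m0 (t : R) : 0 <= Num.max 0 t by rewrite le_max lexx.
apply/cvgrPdist_le => e e0.
have kf : N2 k \is a fin_num by rewrite ge0_fin_numE ?Lnorm_ge0 ?L2_norm_lty.
pose K := fine (N2 k).
have K0 : 0 <= K by rewrite fine_ge0// Lnorm_ge0.
have e'0 : 0 < e / (K + 1) by rewrite divr_gt0// ltr_wpDl.
have [dl dl0 Hd] := cF (Num.max 0 s) _ (m0 s) e'0.
near=> t.
rewrite -innerB//; try exact: LF.
rewrite -lee_fin; apply: le_trans (inner_le _ lk) _.
  by apply: L2B; exact: LF.
have ts : `|Num.max 0 s - Num.max 0 t| < dl.
  have : `|s - t| < dl by near: t; exact: (nbhsx_ballx s dl dl0).
  apply: le_lt_trans; rewrite /Num.max; case: ltrP => s0; case: ltrP => t0 //.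
  - by rewrite subr0 !ger0_norm; lra.
  - by rewrite sub0r normrN (ger0_norm (ltW t0)) ler0_norm; lra.
  - by rewrite subrr normr0.
have NB : (N2 (F (Num.max 0 s) \- F (Num.max 0 t))%R <= (e / (K + 1))%:E)%E.
  rewrite (_ : (N2 _ = N2 (F (Num.max 0 t) \- F (Num.max 0 s))%R)%E).
    by apply: Hd => //; rewrite distrC.
  rewrite -oppe_Lnorm; congr Lnorm; apply/funext => x /=.
  by rewrite opprB.
apply: le_trans (lee_wpmul2r _ NB) _; first exact: Lnorm_ge0.
rewrite -(fineK kf) -EFinM lee_fin -/K mulrAC ler_pdivrMr; last by lra.
by rewrite ler_wpM2l ?(ltW e0)//; lra.
Unshelve. all: by end_near. Qed.

(** No measurability is needed, because the integral of a non-negative function is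
the supremum over the simple functions below it. *)
Lemma ge0_le_integral_set (D : set T) (f g : T -> \bar R) :
  (forall x, D x -> 0 <= f x)%E -> (forall x, D x -> f x <= g x)%E ->
  (\int[mu]_(x in D) f x <= \int[mu]_(x in D) g x)%E.
Proof.
move=> f0 fg; rewrite (integral_mkcond D f) (integral_mkcond D g).
have f0' x : (0 <= (f \_ D) x)%E by apply: erestrict_ge0.
have fg' x : ((f \_ D) x <= (g \_ D) x)%E by apply: lee_restrict.
have g0' x : (0 <= (g \_ D) x)%E by exact: le_trans (fg' x).
rewrite !ge0_integralTE//; apply: le_ereal_sup => _ [h hf <-].
by exists h => //= x; exact: le_trans (hf x) (fg' x).
Qed.

End L2_abstract.

(** * Measurability and square integrability on the space *)

Section rV_measure.
Variables (R : realType) (n : nat).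
Local Notation V := 'rV[R]_n.
Local Notation mu := (lebesgue_rV R n).
Implicit Types (f h : V -> R).

Lemma measurable_coord (i : 'I_n) : measurable_fun setT (fun x : V => x ord0 i).
Proof. exact: measurable_rV_coord. Qed.

Lemma measurable_shift (v : V) : measurable_fun setT (fun x : V => x + v).
Proof.
apply: measurable_fun_rVP => i.
rewrite (_ : _ \o _ = (fun x : V => x ord0 i + v ord0 i)).
  by apply: measurable_funD => //; exact: measurable_coord.
by apply/funext => x; rewrite /rV_coord /= mxE.
Qed.

(** A derivative is the pointwise limit of difference quotients along the sequence
1 / (m + 1).  On 'rV[R]_n this replaces an appeal to continuity, as its
measurable sets are generated by the coordinates and not by the open sets. *)
Lemma measurable_derive h v : measurable_fun setT h ->
  (forall x, derivable h x v) -> measurable_fun setT ('D_v h).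
Proof.
move=> mh dh.
pose hm (m : nat) (x : V) := (m.+1%:R^-1)^-1 * (h (x + m.+1%:R^-1 *: v) - h x).
apply: (@measurable_fun_cvg _ _ _ _ hm).
  move=> m; apply: measurable_funM => //; apply: measurable_funB => //.
  apply: (@measurableT_comp _ _ _ _ _ _ h) => //; exact: measurable_shift.
move=> x _; have dx := dh x.
have : (fun k : R => k^-1 *: ((h \o shift x) (k *: v) - h x)) @ 0^' --> 'D_v h x by [].
move=> /cvgr_dnbhsP /(_ (fun m => m.+1%:R^-1)).
rewrite (_ : hm ^~ x = (fun m : nat => (m.+1%:R^-1 : R)^-1 *: ((h \o shift x) (m.+1%:R^-1 *: v) - h x))).
  apply; split; first by move=> m; rewrite invr_neq0.
  exact: cvg_harmonic.
by apply/funext => m; rewrite /hm /= [x + _]addrC.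
Qed.

Lemma measurable_rsq : measurable_fun setT (@rsq R n).
Proof.
apply: measurable_sum => i; apply: measurable_funX; exact: measurable_coord.
Qed.

Lemma measurable_chi B : measurable_fun setT (@chi R n B).
Proof.
apply: measurable_prod => i _.
have mb : measurable_fun setT (plateau B : R -> R).
  by apply: continuous_measurable_fun; apply: smooth1_continuous; exact: smooth1_plateau.
exact: (measurableT_comp mb (measurable_coord i)).
Qed.

Lemma measurable_hpoly B k : measurable_fun setT (@hpoly R n B k).
Proof.
by apply: measurable_funM; [apply: measurable_funX; exact: measurable_rsq|exact: measurable_chi].
Qed.

Lemma measurable_space_lap h : measurable_fun setT h -> smooth h ->
  measurable_fun setT (space_lap h).
Proof.
move=> mh sh; apply: measurable_sum => i.
apply: measurable_derive; last first.
  by move=> x; have [_ /(_ (unit_rV R i))[_ [_ /(_ (unit_rV R i))[]]]] := sh 2%N.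
apply: measurable_derive => // x.
by have [_ /(_ (unit_rV R i))[]] := sh 1%N.
Qed.

Lemma euclidean_normE (x : V) : euclidean_norm x = Num.sqrt (rsq x).
Proof. by []. Qed.

Lemma measurable_euclidean_norm : measurable_fun setT (@euclidean_norm R n).
Proof.
have ms : measurable_fun setT (@Num.sqrt R).
  by apply: continuous_measurable_fun; exact: sqrt_continuous.
exact: (measurableT_comp ms measurable_rsq).
Qed.

Lemma coord_le_norm (x : V) i : `|x ord0 i| <= euclidean_norm x.
Proof.
rewrite -sqrtr_sqr; apply: ler_wsqrtr; rewrite (bigD1 i)//= lerDl.
by apply: sumr_ge0 => j _; exact: sqr_ge0.
Qed.

Lemma rsqE (x : V) : rsq x = euclidean_norm x ^+ 2.
Proof. by rewrite euclidean_normE sqr_sqrtr// rsq_ge0. Qed.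

Definition box (B : R) : set V := [set x | forall i, `[- B, B]%classic (x ord0 i)].

Lemma in_box B (x : V) : box B x <-> forall i, `|x ord0 i| <= B.
Proof. by split=> H i; have := H i; rewrite /= in_itv/= -ler_norml. Qed.

Lemma measurable_box B : measurable (box B).
Proof. by apply: (@measurable_rV_box R n (fun=> `[- B, B]%classic)) => i; exact: measurable_itv. Qed.

Lemma box_measure B : 0 <= B -> mu (box B) = ((2 * B) ^+ n)%:E.
Proof.
move=> B0; rewrite (@lebesgue_rV_box R n (fun=> `[- B, B]%classic)).
  rewrite (eq_bigr (fun=> (2 * B)%:E)); last first.
    move=> i _; rewrite lebesgue_measure_itv/= lte_fin.
    case: ltP => h; first by rewrite -EFinB; congr EFin; ring.
    by congr EFin; lra.
  by rewrite prodEFin prodr_const card_ord.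
by move=> i; exact: measurable_itv.
Qed.

Lemma not_box B (x : V) : ~ box B x -> exists i, B < `|x ord0 i|.
Proof.
move=> nb; apply: contrapT => H; apply: nb; apply/in_box => i.
by rewrite leNgt; apply/negP => h; apply: H; exists i.
Qed.

Lemma bounded_L2 f M B : measurable_fun setT f -> 0 <= B ->
  (forall x, `|f x| <= M) ->
  (forall x : V, (exists i, B < `|x ord0 i|) -> f x = 0) -> L2 f.
Proof.
move=> mf B0 fM f0; apply: L2P_sqr => //.
apply: (@le_lt_trans _ _ (\int[mu]_(x in box B) (cst (M ^+ 2)%:E x))%E).
  rewrite [leRHS]integral_mkcond; apply: ge0_le_integral_set.
    by move=> x _; rewrite lee_fin sqr_ge0.
  move=> x _; rewrite patchE; case: ifPn => xB.
    by rewrite lee_fin -real_normK ?num_real// lerXn2r ?nnegrE//; exact: le_trans (fM x).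
  rewrite f0 ?expr0n//; apply: not_box => h; by rewrite mem_set in xB.
rewrite integral_cst; last exact: measurable_box.
by rewrite [X in (_ * X)%E]box_measure// -EFinM ltry.
Qed.

Lemma continuous_bounded f B : 0 <= B -> continuous f ->
  (forall x : V, (exists i, B < `|x ord0 i|) -> f x = 0) ->
  exists M, forall x, `|f x| <= M.
Proof.
move=> B0 cf f0.
have cB : compact (box B).
  by apply: (@rV_compact _ n (fun=> `[- B, B]%classic)) => i; exact: segment_compact.
have ne : box B !=set0 by exists 0; apply/in_box => i; rewrite mxE normr0.
have cn : {within box B, continuous (fun x => `|f x|)}.
  apply: continuous_subspaceT => x; apply: continuous_comp; first exact: cf.
  exact: norm_continuous.
have [c _ Hc] := EVT_max_rV ne cB cn.
exists `|f c| => x; have [xB|/not_box xB] := pselect (box B x).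
  by apply: Hc; rewrite inE.
by rewrite f0// normr0.
Qed.

Lemma L2_test h B : 0 <= B -> measurable_fun setT h -> continuous h ->
  (forall x : V, (exists i, B < `|x ord0 i|) -> h x = 0) -> L2 h.
Proof.
move=> B0 mh ch h0; have [M HM] := continuous_bounded B0 ch h0.
exact: (bounded_L2 mh B0 HM h0).
Qed.

Lemma space_lap0 h (B : R) : (forall x : V, (exists i, B < `|x ord0 i|) -> h x = 0) ->
  forall x : V, (exists i, B < `|x ord0 i|) -> space_lap h x = 0.
Proof.
move=> h0.
have nU (y : V) i : B < `|y ord0 i| -> \forall z \near y, B < `|(z : V) ord0 i|.
  move=> yU.
  have c : {for y, continuous (fun z : V => `|z ord0 i|)}.
    by apply: continuous_comp; [exact: coord_continuous|exact: norm_continuous].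
  exact: (c _ (lt_nbhsr yU)).
have D0 (f : V -> R) (v : V) : (forall x : V, (exists i, B < `|x ord0 i|) -> f x = 0) ->
    forall x : V, (exists i, B < `|x ord0 i|) -> 'D_v f x = 0.
  move=> f0 x [i xi]; rewrite -(derive_cst (0 : R) x v); apply: near_eq_derive.
  by apply: filterS (nU x i xi) => z zi; rewrite f0//; exists i.
by move=> x hx; apply: big1 => i _; apply: (D0 _ _ (D0 _ _ h0)) => //.
Qed.

Lemma continuous_space_lap h : smooth h -> continuous (space_lap h).
Proof.
move=> sh; have : smooth (space_lap h); last by move/(_ 0%N)/Ck_continuous.
apply: smooth_sum => i k.
by have [_ /(_ (unit_rV R i))[_ [_ /(_ (unit_rV R i))[]]]] := sh k.+2.
Qed.

Lemma L2_hpoly B k : 0 <= B -> L2 (@hpoly R n B k).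
Proof.
move=> B0; apply: (@L2_test _ (B + 1)); first lra.
- exact: measurable_hpoly.
- exact: Ck_continuous (@smooth_hpoly R n B k 0%N).
- by move=> x xB; rewrite /hpoly chi0 ?mulr0.
Qed.

Lemma L2_space_lap h B : 0 <= B -> measurable_fun setT h -> smooth h ->
  (forall x : V, (exists i, B < `|x ord0 i|) -> h x = 0) ->
  L2 (space_lap h).
Proof.
move=> B0 mh sh h0; apply: (L2_test B0).
- exact: measurable_space_lap.
- exact: continuous_space_lap.
- exact: space_lap0.
Qed.

End rV_measure.

Section H1L2.
Variables (R : realType) (n : nat).
Local Notation V := 'rV[R]_n.

Lemma L2norm_le_H1norm (f : V -> R) : (L2norm f <= H1norm f)%E.
Proof.
rewrite /H1norm.
have N0 : (0 <= L2norm f)%E by exact: Lnorm_ge0.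
have S0 : (0 <= \sum_(i < n) L2norm (weak_partial_of i f) ^+ 2)%E.
  by apply: sume_ge0 => i _; apply: expe_ge0; exact: Lnorm_ge0.
rewrite [leLHS](_ : _ = ((L2norm f ^+ 2) `^ 2^-1)%E); last first.
  case: (L2norm f) N0 => [r| |//] r0; last by rewrite expe2 mulyy poweRyr// invr_neq0.
  by rewrite expe2 -EFinM poweR_EFin -expr2 powR12_sqrt ?sqr_ge0// sqrtr_sqr ger0_norm.
have N2 : (0 <= L2norm f ^+ 2)%E by exact: expe_ge0.
apply: gt0_ler_poweR.
- by rewrite invr_ge0.
- by rewrite in_itv/= leey andbT; exact: N2.
- by rewrite in_itv/= leey andbT; exact: adde_ge0.
- by rewrite leeDl.
Qed.

Lemma continuous_H1L2_L2 (u v : R -> V -> R) : continuous_H1L2 +oo%E u v ->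
  L2_continuous (lebesgue_rV R n) u /\ L2_continuous (lebesgue_rV R n) v.
Proof.
move=> [L cuv].
have I (t : R) : 0 <= t -> time_interval +oo%E t by move=> t0; split; rewrite ?ltry.
suff H (s e : R) : 0 <= s -> 0 < e -> exists2 d, 0 < d &
    forall t : R, 0 <= t -> `|t - s| < d ->
    (H1norm (u t \- u s)%R + L2norm (v t \- v s)%R <= e%:E)%E.
  split; split.
  - by move=> t /I /L [[]].
  - move=> s e s0 e0; have [d d0 Hd] := H s e s0 e0; exists d => // t t0 ts.
    apply: le_trans (Hd t t0 ts); apply: le_trans (L2norm_le_H1norm _) _.
    by rewrite leeDl// Lnorm_ge0.
  - by move=> t /I /L [].
  - move=> s e s0 e0; have [d d0 Hd] := H s e s0 e0; exists d => // t t0 ts.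
    apply: le_trans (Hd t t0 ts); rewrite leeDr// poweR_ge0//.
move=> s0 e0; have /fine_cvgP[fn cv] := cuv s (I s s0).
have /= := (cvgrPdist_le _ _).1 cv e e0.
move=> near1; have : \forall t \near within (time_interval +oo%E) (nbhs s),
   (H1norm (u t \- u s)%R + L2norm (v t \- v s)%R <= e%:E)%E.
  apply: filterS2 fn (near1 _) => t h1 h2.
  rewrite -(fineK h1) lee_fin; apply: le_trans h2; rewrite sub0r normrN; exact: ler_norm.
move=> /nbhs_ballP[d /= d0 Hd]; exists d => // t t0 ts; apply: Hd.
  by rewrite /ball/= distrC.
exact: I.
Unshelve. all: by end_near. Qed.

End H1L2.

(** * Integrals in time and a switch at the initial time *)

Section time_integrals.
Variable R : realType.
Local Notation leb := (@lebesgue_measure R).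
Implicit Types X Y : R -> R.

Lemma integrable_continuous X (a b : R) : continuous X ->
  leb.-integrable `[a, b] (EFin \o X).
Proof.
move=> cX; apply: continuous_compact_integrable; first exact: segment_compact.
exact: continuous_subspaceT.
Qed.

Lemma time_integralD X Y (a b : R) : continuous X -> continuous Y ->
  \int[leb]_(t in `[a, b]) (X t + Y t) =
  \int[leb]_(t in `[a, b]) X t + \int[leb]_(t in `[a, b]) Y t.
Proof. by move=> cX cY; rewrite RintegralD//; exact: integrable_continuous. Qed.

Lemma time_integralB X Y (a b : R) : continuous X -> continuous Y ->
  \int[leb]_(t in `[a, b]) (X t - Y t) =
  \int[leb]_(t in `[a, b]) X t - \int[leb]_(t in `[a, b]) Y t.
Proof. by move=> cX cY; rewrite RintegralB//; exact: integrable_continuous. Qed.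

Lemma time_integralZ (k : R) X (a b : R) : continuous X ->
  \int[leb]_(t in `[a, b]) (k * X t) = k * \int[leb]_(t in `[a, b]) X t.
Proof. by move=> cX; rewrite RintegralZl//; exact: integrable_continuous. Qed.

Lemma continuousTM X Y : continuous X -> continuous Y -> continuous (fun t => X t * Y t).
Proof. by move=> cX cY t; apply: cvgM; [exact: cX|exact: cY]. Qed.

Lemma continuousTB X Y : continuous X -> continuous Y -> continuous (fun t => X t - Y t).
Proof. by move=> cX cY t; apply: cvgB; [exact: cX|exact: cY]. Qed.

Lemma continuousTD X Y : continuous X -> continuous Y -> continuous (fun t => X t + Y t).
Proof. by move=> cX cY t; apply: cvgD; [exact: cX|exact: cY]. Qed.

Lemma time_FTC X (a b : R) : a < b -> smooth1 X ->
  \int[leb]_(t in `[a, b]) (derive1 X) t = X b - X a.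
Proof.
move=> ab sX; have [dX sX'] := smooth1_derive sX.
rewrite /Rintegral (@continuous_FTC2 _ _ X)//.
- apply: continuous_subspaceT; exact: smooth1_continuous.
- split.
  + by move=> x _; have [] := dX x.
  + apply: cvg_at_right_filter; exact: smooth1_continuous.
  + apply: cvg_at_left_filter; exact: smooth1_continuous.
Qed.

(** A switch from 0 to 1 on [e, 2 e].  Its derivative is non-negative with integral
1, hence tends to a Dirac mass at 0 with e. *)
Definition switch (e t : R) : R := step (e^-1 * t + -1).

Lemma smooth1_switch e : smooth1 (switch e).
Proof. by apply: smooth1_affine; exact: smooth1_step. Qed.

Lemma switch0 e t : 0 < e -> t <= e -> switch e t = 0.
Proof. by move=> e0 te; rewrite /switch step0// mulrC subr_le0 ler_pdivrMr// mul1r. Qed.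

Lemma switch1 e t : 0 < e -> 2 * e <= t -> switch e t = 1.
Proof. by move=> e0 te; rewrite /switch step1// mulrC lerBrDl ler_pdivlMr. Qed.

Lemma switch_ge0 e t : 0 <= switch e t.
Proof. exact: step_ge0. Qed.

Lemma switch_le1 e t : switch e t <= 1.
Proof. exact: step_le1. Qed.

Lemma derive_switch_ge0 e t : 0 < e -> 0 <= derive1 (switch e) t.
Proof.
move=> e0; have [ds _] := smooth1_derive (@smooth1_step R).
rewrite (derive1_is_derive (is_derive_affine (ds _))).
by rewrite mulr_ge0 ?derive_step_ge0// invr_ge0 ltW.
Qed.

Lemma derive_switch0 e t : 0 < e -> 2 * e < t -> derive1 (switch e) t = 0.
Proof.
move=> e0 et; apply: derive1_is_derive.
apply: (@near_eq_is_derive _ _ _ (cst (1 : R))).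
by near=> z; rewrite /= switch1// ltW//; near: z; exact: lt_nbhsr.
Unshelve. all: by end_near. Qed.

(** The first part of the integrand converges outside [0, 2 ep], and the second
one concentrates at 0.  Only the upper bound is of use, and it needs no limit
of integrals. *)
Lemma switch_limit X Y (b e : R) : continuous X -> continuous Y -> 0 < b -> 0 < e ->
  exists2 e0, 0 < e0 & forall ep, 0 < ep <= e0 ->
    \int[leb]_(t in `[0, b]) (switch ep t * X t + derive1 (switch ep) t * Y t) <=
    \int[leb]_(t in `[0, b]) X t + Y 0 + e.
Proof.
move=> cX cY b0 e_gt0.
have e2 : 0 < e / 2 by rewrite divr_gt0.
have /(cvgrPdist_le _ _).1/(_ _ e2)/nbhs_ballP[d /= d0 Hd] := cY 0.
have cnX : {within `[0, b], continuous (fun t => `|X t|)}.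
  apply: continuous_subspaceT => x; apply: continuous_comp; first exact: cX.
  exact: norm_continuous.
have [m _ Hm] := EVT_max (ltW b0) cnX.
set M := `|X m| in Hm; have M0 : 0 <= M by exact: normr_ge0.
clearbody M.
(* d / 4 keeps [0, 2 ep] where Y is close to Y 0, b / 2 lets the switch end
   before b, and the last bound makes the loss 2 M ep at most e / 2 *)
exists (Num.min (d / 4) (Num.min (b / 2) (e / (4 * (M + 1))))).
  by rewrite !lt_min !divr_gt0//; lra.
move=> ep /andP[ep0]; rewrite !le_min => /and3P[epd epb epM].
have cs := smooth1_continuous (smooth1_switch ep).
have [_ ss'] := smooth1_derive (smooth1_switch ep).
have cs' := smooth1_continuous ss'.
have cs1 : continuous (fun t => 1 - switch ep t).
  by apply: continuousTB => //; exact: cst_continuous.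
have i1 : \int[leb]_(t in `[0, b]) (1 - switch ep t) <= 2 * ep.
  rewrite -lee_fin /Rintegral fineK; last first.
    by apply: integrable_fin_num => //; exact: integrable_continuous.
  pose A : set R := `[0, 2 * ep]%classic.
  apply: (@le_trans _ _ (\int[leb]_(t in `[0%R, b]) (\1_A t : R)%:E)%E).
    apply: ge0_le_integral_set.
      by move=> t _; rewrite lee_fin subr_ge0 switch_le1.
    move=> t /=; rewrite in_itv/= => /andP[t0 tb]; rewrite lee_fin indicE.
    have [te|te] := leP t (2 * ep).
      have At : A t by rewrite /A/= in_itv/= t0.
      by rewrite mem_set// mulr1n gerBl switch_ge0.
    by rewrite switch1 ?(ltW te)// subrr ler0n.
  have mA : measurable A by exact: measurable_itv.
  rewrite integral_indic//; apply: (@le_trans _ _ (leb A)).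
    by apply: le_measure; rewrite ?inE//=; exact: measurableI.
  by rewrite lebesgue_measure_itv/= lte_fin ifT ?mulr_gt0// -EFinB subr0.
have i2 : \int[leb]_(t in `[0, b]) derive1 (switch ep) t = 1.
  by rewrite time_FTC//; [rewrite switch1 ?switch0 ?subr0//; lra|exact: smooth1_switch].
apply: (@le_trans _ _ (\int[leb]_(t in `[0, b])
   ((X t + M * (1 - switch ep t)) + (Y 0 + e / 2) * derive1 (switch ep) t))).
  apply: le_Rintegral => //.
  - apply: integrable_continuous; apply: continuousTD; exact: continuousTM.
  - apply: integrable_continuous; apply: continuousTD.
      by apply: continuousTD => //; apply: continuousTM => //; exact: cst_continuous.
    by apply: continuousTM => //; exact: cst_continuous.
  - move=> t /=; rewrite in_itv/= => /andP[t0 tb]; apply: lerD.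
      have := Hm t; rewrite in_itv/= t0 tb => /(_ isT); rewrite ler_norml => /andP[h1 h2].
      have : 0 <= (X t + M) * (1 - switch ep t).
        by rewrite mulr_ge0 ?subr_ge0 ?switch_le1//; lra.
      by lra.
    have [te|te] := leP t (2 * ep); last by rewrite derive_switch0// mul0r mulr0.
    rewrite mulrC ler_wpM2r ?derive_switch_ge0//.
    have := Hd t; rewrite /ball/= sub0r normrN ger0_norm// => /(_ _).
    have td : t < d by lra.
    by move=> /(_ td); rewrite ler_norml => /andP[h1 h2]; lra.
have cM : continuous (fun t => M * (1 - switch ep t)).
  by apply: continuousTM => //; exact: cst_continuous.
rewrite time_integralD; last 2 first.
- exact: continuousTD.
- by apply: continuousTM => //; exact: cst_continuous.
rewrite time_integralD// !time_integralZ// i2.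
have : M * \int[leb]_(t in `[0, b]) (1 - switch ep t) <= M * (2 * ep).
  by rewrite ler_wpM2l.
have : ep * (4 * (M + 1)) <= e by rewrite -ler_pdivlMr//; lra.
rewrite mulr1; set I1 := M * _; set I2 := Rintegral _ _ _; move: I1 I2 => I1 I2.
have : 0 <= M * ep by rewrite mulr_ge0// ltW.
by clear -ep0 e_gt0; lra.
Qed.

End time_integrals.

(** * The weak inequality for product test functions *)

Lemma cancel_terms (R : realType) (a1 a2 a3 a4 a5 : R) : a1 + a3 = - a5 ->
  - (a5 + a4 + a2) = a1 - a2 + (a3 - a4).
Proof. by lra. Qed.

Section weak_inequality.
Variables (R : realType) (n : nat) (p rho : R).
Local Notation V := 'rV[R]_n.
Local Notation mu := (lebesgue_rV R n).
Local Notation leb := (@lebesgue_measure R).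
Variables (u v : R -> V -> R).
Hypothesis p0 : 0 < p.
Hypothesis rho0 : 0 < rho.
Hypothesis cu : L2_continuous mu u.
Hypothesis cv : L2_continuous mu v.
Hypothesis hut : is_time_derivative +oo%E u v.
Hypothesis heq : wave_equation +oo%E p u.
Hypothesis hsupp : support_in_cone +oo%E rho u v.

(** As in [continuous_inner], w is frozen for t <= 0. *)
Definition moment (w : R -> V -> R) (h : V -> R) (t : R) : R :=
  inner mu (w (Num.max 0 t)) h.

Lemma momentE w h t : 0 <= t -> moment w h t = inner mu (w t) h.
Proof. by move=> t0; rewrite /moment (max_idPr t0). Qed.

Lemma continuous_moment w h : L2_continuous mu w -> L2 h ->
  continuous (moment w h).
Proof. by move=> cw lh; exact: continuous_inner. Qed.

Let D : set R := [set t | 0 < t /\ (t%:E < +oo)%E].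

Lemma pairing_tensor (w : R -> V -> R) (h : V -> R) (g : R -> R) (a b : R) :
  L2_continuous mu w -> L2 h -> 0 < a -> (forall t, ~ (a <= t <= b) -> g t = 0) ->
  pairing +oo%E w (tensor h g) = \int[leb]_(t in `[0, b]) (g t * moment w h t).
Proof.
move=> cw lh a0 g0; rewrite /pairing Rintegral_mkcond [RHS]Rintegral_mkcond.
apply: eq_Rintegral => t _; rewrite !patchE.
have [/andP[at_ tb]|tab] := boolP (a <= t <= b); last first.
  have g0t : g t = 0 by apply: g0; apply/negP.
  rewrite g0t mul0r; case: ifPn => tD; case: ifPn => // tb;
    by rewrite /tensor/= Rintegral_mkcond /Rintegral integral0_eq// => x _;
       rewrite patchE/= g0t !mulr0; case: ifP.
have t0 : 0 < t by exact: lt_le_trans at_.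
rewrite mem_set; last by split; rewrite ?ltry.
rewrite mem_set; last by rewrite /= in_itv/= tb (ltW t0).
rewrite momentE ?(ltW t0)// /inner -RintegralZl//.
  by apply: eq_Rintegral => x _; rewrite /tensor/=; ring.
by apply: L2_integrableM => //; apply: cw.1; exact: ltW.
Qed.

Definition pmass (t : R) : \bar R := (\int[mu]_x (`|u t x| `^ p)%:E)%E.

Definition rball (r : R) : set V := [set x | euclidean_norm x <= r].

Lemma measurable_rball r : measurable (rball r).
Proof.
rewrite (_ : rball r = setT `&` (@euclidean_norm R n) @^-1` `]-oo, r]%classic).
  by apply: measurable_euclidean_norm => //; exact: measurable_itv.
by rewrite setTI; apply/seteqP; split => x /=; rewrite in_itv.
Qed.

Lemma measurable_up t : 0 <= t -> measurable_fun setT (fun x => `|u t x| `^ p).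
Proof.
move=> t0; apply: (measurableT_comp (measurable_powR p)).
by apply: measurableT_comp => //; apply: (@L2_measurable _ _ _ mu); exact: cu.1.
Qed.

(** The solution vanishes outside the cone, hence local integrability in space-time
controls the integral over the whole space. *)
Lemma pmass_rball t r : 0 <= t -> t + rho <= r ->
  pmass t = (\int[mu]_(x in rball r) (`|u t x| `^ p)%:E)%E.
Proof.
move=> t0 tr; rewrite [RHS]integral_mkcond.
have mu1 := measurable_up t0; have mb := measurable_rball r.
apply: ge0_ae_eq_integral => //.
- exact/measurable_EFinP.
- apply/(measurable_restrictT _ _).1 => //; apply: measurable_funTS; exact/measurable_EFinP.
- by move=> x _; apply: erestrict_ge0 => y _; rewrite lee_fin powR_ge0.
have : {ae mu, forall x, t + rho < euclidean_norm x -> u t x = 0 /\ v t x = 0}.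
  by apply: hsupp; split; rewrite ?ltry.
apply: filterS => x Hx _; rewrite patchE; case: ifPn => // /negP xr.
have [->] : u t x = 0 /\ v t x = 0.
  apply: Hx; rewrite ltNge; apply/negP => h; apply: xr; rewrite inE /rball/=.
  exact: le_trans tr.
by rewrite normr0 powR0// gt_eqF.
Qed.

Lemma integrable_pmass a b : 0 < a -> leb.-integrable `[a, b] pmass.
Proof.
move=> a0; have := heq.1 (b + rho) a b a0 (ltry b).
apply: eq_integrable => // t; rewrite inE/= in_itv/= => /andP[at_ tb].
have t0 : 0 <= t by exact: le_trans (ltW a0) at_.
rewrite (@pmass_rball t (b + rho)) ?lerD2r//.
apply: eq_integral => x _; rewrite ger0_norm ?powR_ge0//.
Qed.

Lemma pmass_ge0 t : (0 <= pmass t)%E.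
Proof. by apply: integral_ge0 => x _; rewrite lee_fin powR_ge0. Qed.

Lemma pmassZ t (k : R) : 0 <= t -> 0 <= k ->
  (\int[mu]_x (k%:E * (`|u t x| `^ p)%:E) = k%:E * pmass t)%E.
Proof.
move=> t0 k0; rewrite ge0_integralZl_EFin//.
by apply/measurable_EFinP; exact: measurable_up.
Qed.

Lemma derive1_mul (f g : R -> R) : smooth1 f -> smooth1 g ->
  derive1 (fun t => f t * g t) = (fun t => f t * derive1 g t + derive1 f t * g t).
Proof.
move=> sf sg; apply/funext => t.
have [df _] := smooth1_derive sf; have [dg _] := smooth1_derive sg.
apply: derive1_is_derive; apply: is_derive_eq (is_deriveM (df t) (dg t)) _.
by rewrite /GRing.scale/= [g t * _]mulrC.
Qed.

Lemma derive1_out (f : R -> R) (a b : R) : (forall t, ~ (a <= t <= b) -> f t = 0) ->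
  forall t, ~ (a <= t <= b) -> derive1 f t = 0.
Proof.
move=> f0 t tab; apply: derive1_is_derive.
apply: (@near_eq_is_derive _ _ _ (cst (0 : R))).
move/negP: tab; rewrite negb_and -!ltNge => /orP[ta|bt]; near=> z; rewrite /= f0//.
  by move/andP => [h _]; move: h; apply/negP; rewrite -ltNge; near: z; exact: lt_nbhsl.
by move/andP => [_ h]; move: h; apply/negP; rewrite -ltNge; near: z; exact: lt_nbhsr.
Unshelve. all: by end_near. Qed.

Section one_h.
Variables (h : V -> R) (B : R).
Hypothesis B0 : 0 <= B.
Hypothesis sh : smooth h.
Hypothesis mh : measurable_fun setT h.
Hypothesis h_ge0 : forall x, 0 <= h x.
Hypothesis h0 : forall x : V, (exists i, B < `|x ord0 i|) -> h x = 0.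

Let lh : L2 h.
Proof. by apply: (L2_test B0) => //; exact: (Ck_continuous (sh 0%N)). Qed.

Let llh : L2 (space_lap h).
Proof. exact: (L2_space_lap B0). Qed.

(** One derivative in time is moved from the test function to u, which turns it
into v.  The second one stays on H, as v need not be differentiable. *)
Lemma weak_identity (H : R -> R) (a b : R) : smooth1 H -> 0 < a ->
  (forall t, ~ (a <= t <= b) -> H t = 0) ->
  pairing +oo%E (fun t x => `|u t x| `^ p) (tensor h H) =
  - (\int[leb]_(t in `[0, b]) (derive1 H t * moment v h t) +
     \int[leb]_(t in `[0, b]) (H t * moment u (space_lap h) t)).
Proof.
move=> sH a0 H0.
have [dH sH'] := smooth1_derive sH.
have H'0 := derive1_out H0.
have tf := test_function_tensor sh sH a0 h0 H0.
have tf' := test_function_tensor sh sH' a0 h0 H'0.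
have := heq.2 _ tf; rewrite laplacian_tensor// !d_time_tensor//.
have := hut tf'; rewrite d_time_tensor// => ->.
rewrite (pairing_tensor cu llh a0 H0) (pairing_tensor cv lh a0 H'0).
set I1 := Rintegral _ _ _; set I2 := Rintegral _ _ _; set P := pairing _ _ _.
move: I1 I2 P => I1 I2 P E; lra.
Qed.

Lemma time_derivative_identity (K : R -> R) (a b : R) : smooth1 K -> 0 < a ->
  (forall t, ~ (a <= t <= b) -> K t = 0) ->
  \int[leb]_(t in `[0, b]) (derive1 K t * moment u h t) =
  - \int[leb]_(t in `[0, b]) (K t * moment v h t).
Proof.
move=> sK a0 K0; have K'0 := derive1_out K0.
have tf := test_function_tensor sh sK a0 h0 K0.
have := hut tf; rewrite d_time_tensor//.
by rewrite (pairing_tensor cu lh a0 K'0) (pairing_tensor cv lh a0 K0).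
Qed.

(** The function h is at least c on the support of u at the times considered.  The
value c = 0 is allowed: the test functions with a positive power of |x| only
contribute through their sign. *)
Lemma pairing_power_ge (H G : R -> R) (c a t0 b : R) : 0 < a -> 0 <= c ->
  (forall x : V, euclidean_norm x <= b + rho -> c <= h x) ->
  continuous H ->
  (forall t, 0 <= H t) -> (forall t, ~ (a <= t <= b) -> H t = 0) ->
  a <= t0 ->
  (forall t, t0 <= t <= b -> H t = G t) ->
  \int[leb]_(t in `[t0, b]) (c * (G t * fine (pmass t))) <=
  pairing +oo%E (fun t x => `|u t x| `^ p) (tensor h H).
Proof.
move=> a0 c0 ch cH H_ge0 H0 at0 HG.
have [M HM] : exists M, forall x, `|h x| <= M.
  by apply: (continuous_bounded B0 _ h0); exact: (Ck_continuous (sh 0%N)).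
have [M' HM'] : exists M', forall t, H t <= M'.
  have [ab|ba] := leP a b; last first.
    exists 0 => t; rewrite H0// => /andP[h1 h2].
    by have := le_lt_trans (le_trans h1 h2) ba; rewrite ltxx.
  have cnH : {within `[a, b], continuous H} by exact: continuous_subspaceT.
  have [m _ Hm] := EVT_max ab cnH; exists (Num.max 0 (H m)) => t.
  rewrite le_max; have [tab|tab] := boolP (t \in `[a, b]); first by rewrite Hm ?orbT.
  by rewrite H0 ?lexx//; move/negP: tab; rewrite in_itv.
have M0 : 0 <= M by exact: le_trans (normr_ge0 _) (HM 0).
have M'0 : 0 <= M' by exact: le_trans (H_ge0 0) (HM' 0).
pose q (t : R) := \int[mu]_x (`|u t x| `^ p * tensor h H (x, t)).
have q_ge0 t : 0 <= q t.
  by apply: Rintegral_ge0 => x _; rewrite !mulr_ge0 ?powR_ge0.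
have mI t : 0 <= t -> (pmass t < +oo)%E -> forall f : V -> R, measurable_fun setT f ->
    (forall x, 0 <= f x <= M * M' + c * M') ->
    mu.-integrable setT (EFin \o (fun x => `|u t x| `^ p * f x)).
  move=> t_ge0 fin f mf fM; apply/integrableP; split.
    apply/measurable_EFinP; apply: measurable_funM => //; exact: measurable_up.
  apply: (@le_lt_trans _ _ (\int[mu]_x ((M * M' + c * M')%:E * (`|u t x| `^ p)%:E))%E).
    apply: ge0_le_integral_set => // x _ /=; have /andP[f0 f1] := fM x.
    by rewrite lee_fin ger0_norm ?mulr_ge0 ?powR_ge0// mulrC ler_wpM2r ?powR_ge0.
  rewrite pmassZ ?addr_ge0 ?mulr_ge0//.
  by rewrite lte_mul_pinfty// ?lee_fin ?addr_ge0 ?mulr_ge0.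
have mt t : measurable_fun setT (fun x : V => tensor h H (x, t)).
  exact: (@measurable_funM _ _ _ _ h (cst (H t))).
have tb t (x : V) : 0 <= tensor h H (x, t) <= M * M' + c * M'.
  rewrite /tensor/= mulr_ge0//= ler_wpDr ?mulr_ge0//.
  by apply: ler_pM => //; exact: le_trans (ler_norm _) (HM x).
pose C := (M * M' + c * M' + 1)%:E : \bar R.
have C0 : (0 < C)%E by rewrite lte_fin ltr_wpDl// addr_ge0// mulr_ge0.
have q_up t : a <= t <= b -> ((q t)%:E <= C * pmass t)%E.
  move=> /andP[at_ tb']; have t_ge0 : 0 <= t by exact: le_trans (ltW a0) at_.
  have [fin|] := ltP (pmass t) +oo%E; last first.
    by rewrite leye_eq => /eqP ->; rewrite gt0_muley// leey.
  have i1 := mI t t_ge0 fin _ (mt t) (tb t).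
  rewrite /q /Rintegral fineK; last exact: (integrable_fin_num measurableT i1).
  rewrite -pmassZ//; last by rewrite -lee_fin ltW.
  apply: ge0_le_integral_set => x _ /=.
    by rewrite lee_fin !mulr_ge0 ?powR_ge0.
  rewrite -EFinM lee_fin mulrC ler_wpM2r ?powR_ge0//.
  by have /andP[_ /le_trans] := tb t x; apply; lra.
have q_low t : t0 <= t <= b -> c * (G t * fine (pmass t)) <= q t.
  move=> /[dup] t0b /andP[t0t tb'].
  have t_ge0 : 0 <= t by exact: le_trans (le_trans (ltW a0) at0) t0t.
  have [fin|] := ltP (pmass t) +oo%E; last first.
    by rewrite leye_eq => /eqP ->; rewrite /= !mulr0.
  have pE := @pmass_rball t (b + rho) t_ge0; rewrite lerD2r in pE.
  have {}pE := pE tb'.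
  have mb := measurable_rball (b + rho).
  pose f (x : V) := c * H t * \1_(rball (b + rho)) x.
  have mf : measurable_fun setT f.
    by apply: measurable_funM => //; exact: measurable_indic.
  have fb x : 0 <= f x <= M * M' + c * M'.
    rewrite /f indicE; case: (x \in _); rewrite ?mulr1 ?mulr0.
      by rewrite mulr_ge0//= ler_wpDl ?mulr_ge0// ler_wpM2l.
    by rewrite lexx/= addr_ge0// mulr_ge0.
  have -> : c * (G t * fine (pmass t)) = \int[mu]_x (`|u t x| `^ p * f x).
    rewrite -(HG t t0b) mulrA pE.
    have -> : fine (\int[mu]_(x in rball (b + rho)) (`|u t x| `^ p)%:E)%E =
        \int[mu]_(x in rball (b + rho)) (`|u t x| `^ p) by [].
    rewrite -RintegralZl//.
      rewrite Rintegral_mkcond; apply: eq_Rintegral => x _.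
      by rewrite patchE /f indicE; case: (x \in _); rewrite ?mulr1 ?mulr0// mulrC.
    apply: (@integrableS _ _ _ mu setT) => //.
    apply/integrableP; split; first by apply/measurable_EFinP; exact: measurable_up.
    apply: le_lt_trans fin; apply: ge0_le_integral_set => // x _ /=.
    by rewrite lee_fin ger0_norm// powR_ge0.
  apply: (le_Rintegral measurableT (mI t t_ge0 fin f mf fb)
    (mI t t_ge0 fin _ (mt t) (tb t))) => x _.
  rewrite ler_wpM2l ?powR_ge0// /f /tensor/= indicE.
  case: (boolP (x \in rball (b + rho))) => xr; rewrite ?mulr1 ?mulr0 ?mulr_ge0//.
  by rewrite ler_wpM2r//; apply: ch; rewrite inE in xr.
have q_out t : ~ (a <= t <= b) -> q t = 0.
  move=> tab; rewrite /q /Rintegral integral0_eq// => x _.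
  by rewrite /tensor/= H0// !mulr0.
(* without this the real-valued integral of q could default to 0 *)
have ifin : (\int[leb]_(t in D) (q t)%:E < +oo)%E.
  apply: (@le_lt_trans _ _ (\int[leb]_(t in `[a, b]) (C * pmass t))%E).
    rewrite integral_mkcond [leRHS]integral_mkcond; apply: ge0_le_integral_set => t _.
      by rewrite patchE; case: ifP => // _; rewrite lee_fin.
    rewrite !patchE; have [tab|tab] := boolP (a <= t <= b).
      rewrite [X in (_ <= X)%E]ifT; last by rewrite inE/= in_itv.
      case: ifP => _; first exact: q_up.
      by rewrite mule_ge0 ?(ltW C0)// pmass_ge0.
    rewrite q_out; last exact/negP.
    by case: ifP => _; case: ifP => // _; rewrite mule_ge0 ?(ltW C0)// pmass_ge0.
  have ip := integrable_pmass b a0.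
  rewrite ge0_integralZl//.
  - apply: lte_mul_pinfty; rewrite ?(ltW C0)//.
    have /integrableP[_ ib] := ip; apply: le_lt_trans ib.
    by apply: ge0_le_integral_set => t _; [exact: pmass_ge0|exact: lee_abs].
  - exact: measurable_int ip.
  - by move=> t _; exact: pmass_ge0.
  - exact: ltW.
rewrite /pairing -/D; apply: fine_le.
- rewrite ge0_fin_numE; last first.
    apply: integral_ge0 => t /=; rewrite in_itv/= => tb'.
    rewrite lee_fin mulr_ge0// mulr_ge0 ?fine_ge0 ?pmass_ge0//.
    by rewrite -HG.
  apply: le_lt_trans ifin.
  rewrite integral_mkcond [leRHS]integral_mkcond; apply: ge0_le_integral_set => t _.
    rewrite patchE; case: ifPn => // /[1!inE]/=; rewrite in_itv/= => tb'.
    by rewrite lee_fin mulr_ge0// mulr_ge0 ?fine_ge0 ?pmass_ge0// -HG.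
  rewrite !patchE; case: ifPn => [/[1!inE]/=|_]; last by case: ifP => // _; rewrite lee_fin; exact: (q_ge0 t).
  rewrite in_itv/= => /[dup] tb' /andP[t0t _].
  have t_gt0 : 0 < t by exact: lt_le_trans (lt_le_trans a0 at0) t0t.
  have Dt : D t by split; rewrite ?ltry.
  by rewrite (mem_set Dt) lee_fin; exact: q_low.
- rewrite ge0_fin_numE; first exact: ifin.
  by apply: integral_ge0 => t _; rewrite lee_fin; exact: (q_ge0 t).
- rewrite integral_mkcond [leRHS]integral_mkcond; apply: ge0_le_integral_set => t _.
    rewrite patchE; case: ifPn => // /[1!inE]/=; rewrite in_itv/= => tb'.
    by rewrite lee_fin mulr_ge0// mulr_ge0 ?fine_ge0 ?pmass_ge0// -HG.
  rewrite !patchE; case: ifPn => [/[1!inE]/=|_]; last by case: ifP => // _; rewrite lee_fin; exact: (q_ge0 t).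
  rewrite in_itv/= => /[dup] tb' /andP[t0t _].
  have t_gt0 : 0 < t by exact: lt_le_trans (lt_le_trans a0 at0) t0t.
  have Dt : D t by split; rewrite ?ltry.
  by rewrite (mem_set Dt) lee_fin; exact: q_low.
Qed.

(** The distributional equation concerns test functions supported in t > 0.  It is
applied to the product of G with a switch at time ep, and the derivatives of the
switch produce the terms at t = 0 as ep tends to 0, by [switch_limit]. *)
Lemma weak_inequality (G : R -> R) (c t0 b : R) : 0 <= c ->
  (forall x : V, euclidean_norm x <= b + rho -> c <= h x) ->
  smooth1 G -> (forall t, 0 <= t -> 0 <= G t) -> (forall t, b < t -> G t = 0) ->
  0 < t0 -> 0 < b ->
  \int[leb]_(t in `[t0, b]) (c * (G t * fine (pmass t))) <=
  \int[leb]_(t in `[0, b]) (derive1 (derive1 G) t * moment u h t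
      - G t * moment u (space_lap h) t)
  + (derive1 G 0 * moment u h 0 - G 0 * moment v h 0).
Proof.
move=> c0 ch sG G_ge0 G0 t00 b0.
have [dG sG'] := smooth1_derive sG; have [dG' sG''] := smooth1_derive sG'.
pose X (t : R) : R := derive1 (derive1 G) t * moment u h t - G t * moment u (space_lap h) t.
pose Y (t : R) : R := derive1 G t * moment u h t - G t * moment v h t.
have cU := continuous_moment cu lh; have cV := continuous_moment cv lh.
have cW := continuous_moment cu llh.
have cG := smooth1_continuous sG; have cG' := smooth1_continuous sG'.
have cG'' := smooth1_continuous sG''.
have cX : continuous X.
  exact: (@continuousTB _ (fun t => derive1 (derive1 G) t * moment u h t) (fun t => G t * moment u (space_lap h) t) (continuousTM cG'' cU) (continuousTM cG cW)).
have cY : continuous Y.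
  exact: (@continuousTB _ (fun t => derive1 G t * moment u h t) (fun t => G t * moment v h t) (continuousTM cG' cU) (continuousTM cG cV)).
apply/ler_addgt0Pr => e e0.
have [e1 e10 He1] := switch_limit cX cY b0 e0.
pose ep := Num.min e1 (t0 / 2).
have ep0 : 0 < ep by rewrite lt_min e10/= divr_gt0.
have ept : ep <= t0 / 2 by rewrite ge_min lexx orbT.
have epe1 : ep <= e1 by rewrite ge_min lexx.
clearbody ep.
have := He1 ep; rewrite ep0 epe1 => /(_ isT); apply: le_trans.
have ss := smooth1_switch ep; have [_ ss'] := smooth1_derive ss.
have cs := smooth1_continuous ss; have cs' := smooth1_continuous ss'.
pose H t := switch ep t * G t.
have sH : smooth1 H by exact: smooth1M.
have out (F : R -> R) : (forall t, b < t -> F t = 0) ->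
    forall t, ~ (ep <= t <= b) -> switch ep t * F t = 0.
  move=> F0 t /negP; rewrite negb_and -!ltNge => /orP[te|bt].
    by rewrite switch0 ?mul0r// ltW.
  by rewrite F0// mulr0.
have G'0 t : b < t -> derive1 G t = 0.
  move=> bt; apply: derive1_is_derive.
  apply: (@near_eq_is_derive _ _ _ (cst (0 : R))).
  by near=> z; rewrite /= G0//; near: z; exact: lt_nbhsr.
have H0 := out G G0.
have sK : smooth1 (fun t => switch ep t * derive1 G t) by exact: smooth1M.
have E1 := weak_identity sH ep0 H0.
have E2 := time_derivative_identity sK ep0 (out _ G'0).
have HGe t : t0 <= t <= b -> H t = G t.
  by move=> /andP[t0t _]; rewrite /H switch1 ?mul1r//; apply: le_trans t0t; rewrite mulrC -ler_pdivlMr.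
have H_ge0 t : 0 <= H t.
  have [t_ge0|t_lt0] := leP 0 t; first by rewrite mulr_ge0 ?switch_ge0 ?G_ge0.
  by rewrite /H switch0 ?mul0r// (le_trans (ltW t_lt0))// ltW.
have ept0 : ep <= t0.
  by apply: (le_trans ept); rewrite ler_pdivrMr// ler_peMr ?(ltW t00)// ler1n.
have := pairing_power_ge ep0 c0 ch (smooth1_continuous sH) H_ge0 H0 ept0 HGe.
move=> /le_trans; apply; rewrite E1 le_eqVlt; apply/orP; left; apply/eqP.
pose A1 (t : R) : R := switch ep t * (derive1 (derive1 G) t * moment u h t).
pose A2 (t : R) : R := H t * moment u (space_lap h) t.
pose A3 (t : R) : R := derive1 (switch ep) t * (derive1 G t * moment u h t).
pose A4 (t : R) : R := derive1 (switch ep) t * (G t * moment v h t).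
pose A5 (t : R) : R := switch ep t * derive1 G t * moment v h t.
have cA1 : continuous A1 := continuousTM cs (continuousTM cG'' cU).
have cA2 : continuous A2 := continuousTM (continuousTM cs cG) cW.
have cA3 : continuous A3 := continuousTM cs' (continuousTM cG' cU).
have cA4 : continuous A4 := continuousTM cs' (continuousTM cG cV).
have cA5 : continuous A5 := continuousTM (continuousTM cs cG') cV.
have E3 : \int[leb]_(t in `[0, b]) (derive1 H t * moment v h t) =
    \int[leb]_(t in `[0, b]) A5 t + \int[leb]_(t in `[0, b]) A4 t.
  rewrite -(time_integralD _ _ cA5 cA4) (derive1_mul ss sG).
  by apply: eq_Rintegral => t _; rewrite /A4 /A5; ring.
have E4 : \int[leb]_(t in `[0, b]) (derive1 (fun t => switch ep t * derive1 G t) t * moment u h t) =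
    \int[leb]_(t in `[0, b]) A1 t + \int[leb]_(t in `[0, b]) A3 t.
  rewrite -(time_integralD _ _ cA1 cA3) (derive1_mul ss sG').
  by apply: eq_Rintegral => t _; rewrite /A1 /A3; ring.
have E5 : \int[leb]_(t in `[0, b]) (switch ep t * X t + derive1 (switch ep) t * Y t) =
   (\int[leb]_(t in `[0, b]) A1 t - \int[leb]_(t in `[0, b]) A2 t) +
   (\int[leb]_(t in `[0, b]) A3 t - \int[leb]_(t in `[0, b]) A4 t).
  have e1B := time_integralB 0 b cA1 cA2; have e2B := time_integralB 0 b cA3 cA4.
  rewrite -[X in _ = X + _]e1B -[X in _ = _ + X]e2B.
  rewrite -(time_integralD 0 b (continuousTB cA1 cA2) (continuousTB cA3 cA4)).
  by apply: eq_Rintegral => t _; rewrite /X /Y /A1 /A2 /A3 /A4 /H; ring.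
rewrite E3 E5; apply: cancel_terms; rewrite -E4; exact: E2.
Unshelve. all: by end_near. Qed.

End one_h.
End weak_inequality.

(** * Powers and cut-offs in time *)

Section time_functions.
Variable R : realType.

Lemma derive1_affine (f : R -> R) (c d x : R) : smooth1 f ->
  derive1 (fun t => f (c * t + d)) x = c * derive1 f (c * x + d).
Proof.
move=> sf; have [df _] := smooth1_derive sf.
exact: (derive1_is_derive (is_derive_affine (df _))).
Qed.

(** The function (t + a)^(- b) for t + a >= 1, made smooth on the whole line. *)
Definition tpow (a b t : R) : R := cut_pow (switch 2^-1) b (1 * t + a).

Lemma smooth1_tpow a b : smooth1 (tpow a b).
Proof.
apply: (@smooth1_affine _ (cut_pow (switch 2^-1) b)); apply: smooth1_cut_pow.
  exact: smooth1_switch.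
by move=> y y0; rewrite switch0 ?ltW// invr_gt0.
Qed.

Lemma tpowE a b t : 1 <= t + a -> tpow a b t = (t + a) `^ (- b).
Proof. by move=> h; rewrite /tpow /cut_pow mul1r switch1 ?mul1r ?invr_gt0// mulfV. Qed.

Lemma derive_tpow a b t : 1 < t + a -> derive1 (tpow a b) t = - b * tpow a (b + 1) t.
Proof.
move=> h; rewrite derive1_affine; last first.
  apply: smooth1_cut_pow; first exact: smooth1_switch.
  by move=> y y0; rewrite switch0 ?ltW// invr_gt0.
have y0 : 0 < 1 * t + a by rewrite mul1r (lt_trans _ h).
rewrite (derive1_is_derive (is_derive_cut_pow b (@smooth1_switch R 2^-1) y0)).
by rewrite /tpow {1}/cut_pow derive_switch0 ?invr_gt0 ?mulfV ?mul1r// mul0r sub0r mulNr.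
Qed.

Lemma derive2_tpow a b t : 1 < t + a ->
  derive1 (derive1 (tpow a b)) t = b * (b + 1) * tpow a (b + 2) t.
Proof.
move=> h; have [d1 _] := smooth1_derive (smooth1_tpow a (b + 1)).
apply: derive1_is_derive.
have d2 := is_deriveZ (- b) (d1 t).
have -> : b * (b + 1) * tpow a (b + 2) t = - b *: derive1 (tpow a (b + 1)) t.
  by rewrite derive_tpow// /GRing.scale/= -addrA; ring.
apply: near_eq_is_derive d2.
near=> z; rewrite derive_tpow//.
rewrite -ltrBlDr; near: z; apply: lt_nbhsr; by rewrite ltrBlDr.
Unshelve. all: by end_near. Qed.

(** The function is 1 up to r and 0 from 2 r on.  A high power of a step makes its
derivatives small where the cut-off itself is small. *)
Definition cutoff (r : R) (m : nat) (t : R) : R := step (- r^-1 * t + 2) ^+ m.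

Lemma smooth1_cutoff r m : smooth1 (cutoff r m).
Proof. by apply: smooth1X; apply: smooth1_affine; exact: smooth1_step. Qed.

Lemma cutoff1 r m t : 0 < r -> t <= r -> cutoff r m t = 1.
Proof.
move=> r0 tr; rewrite /cutoff step1 ?expr1n//.
have : r^-1 * t <= 1 by rewrite mulrC ler_pdivrMr// mul1r.
by lra.
Qed.

Lemma cutoff0 r m t : 0 < r -> 2 * r <= t -> cutoff r m.+1 t = 0.
Proof.
move=> r0 tr; rewrite /cutoff step0 ?expr0n//.
have : 2 <= r^-1 * t by rewrite mulrC ler_pdivlMr.
by lra.
Qed.

Lemma cutoff_ge0 r m t : 0 <= cutoff r m t.
Proof. by rewrite exprn_ge0// step_ge0. Qed.

Lemma cutoff_le1 r m t : cutoff r m t <= 1.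
Proof. by rewrite exprn_ile1// ?step_ge0 ?step_le1. Qed.

Lemma derive_cutoff1 r m t : 0 < r -> t < r ->
  derive1 (cutoff r m) t = 0 /\ derive1 (derive1 (cutoff r m)) t = 0.
Proof.
move=> r0.
have H s : s < r -> derive1 (cutoff r m) s = 0.
  move=> sr; apply: derive1_is_derive; apply: (@near_eq_is_derive _ _ _ (cst (1 : R))).
  by near=> z; rewrite /= cutoff1// ltW//; near: z; exact: lt_nbhsl.
move=> tr; split; first exact: H.
apply: derive1_is_derive; apply: (@near_eq_is_derive _ _ _ (cst (0 : R))).
by near=> z; rewrite /= H//; near: z; exact: lt_nbhsl.
Unshelve. all: by end_near. Qed.

Lemma derive_cutoff r m t :
  derive1 (cutoff r m.+1) t =
  - r^-1 * (m.+1%:R * step (- r^-1 * t + 2) ^+ m * derive1 (@step R) (- r^-1 * t + 2)).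
Proof.
have s1 := @smooth1_step R; have [ds _] := smooth1_derive s1.
rewrite /cutoff (@derive1_affine (fun y => step y ^+ m.+1)); last exact: smooth1X.
congr (_ * _); apply: derive1_is_derive.
have := is_deriveX m.+1 (ds (- r^-1 * t + 2)); rewrite exprfctE => d.
by apply: is_derive_eq d _.
Qed.

Lemma derive2_cutoff r m t :
  derive1 (derive1 (cutoff r m.+2)) t =
  r^-1 ^+ 2 * (m.+2%:R * step (- r^-1 * t + 2) ^+ m *
   (m.+1%:R * derive1 (@step R) (- r^-1 * t + 2) ^+ 2
    + step (- r^-1 * t + 2) * derive1 (derive1 (@step R)) (- r^-1 * t + 2))).
Proof.
have s1 := @smooth1_step R; have [ds s1'] := smooth1_derive s1.
have [ds' s1''] := smooth1_derive s1'.
have -> : derive1 (cutoff r m.+2) =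
  (fun t => - r^-1 * (m.+2%:R * step (- r^-1 * t + 2) ^+ m.+1 * derive1 (@step R) (- r^-1 * t + 2))).
  by apply/funext => x; exact: derive_cutoff.
have sF : smooth1 (fun y : R => - r^-1 * (m.+2%:R * step y ^+ m.+1 * derive1 (@step R) y)).
  apply: smooth1M; first exact: smooth1_cst.
  apply: smooth1M => //; apply: smooth1M; first exact: smooth1_cst.
  exact: smooth1X.
rewrite (derive1_affine _ _ _ sF); set y := - r^-1 * t + 2.
have d1 : is_derive y 1 (fun y : R => step y ^+ m.+1) ((m.+1%:R * step y ^+ m) *: derive1 (@step R) y).
  by have d := is_deriveX m.+1 (ds y); rewrite exprfctE in d; exact: d.
have d2 := is_deriveZ (- r^-1 * m.+2%:R) (is_deriveM d1 (ds' y)).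
have -> : derive1 (fun y : R => - r^-1 * (m.+2%:R * step y ^+ m.+1 * derive1 (@step R) y)) y =
   - r^-1 * m.+2%:R * ((step y ^+ m.+1) * derive1 (derive1 (@step R)) y +
   derive1 (@step R) y * ((m.+1%:R * step y ^+ m) * derive1 (@step R) y)).
  apply: derive1_is_derive.
  move: d2; set f1 := (X in is_derive _ _ X _); set f2 := (X in _ -> is_derive _ _ X _).
  have -> : f1 = f2.
    apply/funext => z.
    transitivity (- r^-1 * m.+2%:R * (step z ^+ m.+1 * derive1 (@step R) z)) => //.
    by rewrite /f2 !mulrA.
  by move=> d2; exact: (is_derive_eq d2).
by rewrite exprS; ring.
Qed.

(** Two derivatives cost two factors of the step, and what is left of the power,
step^m, is at most the power 1 / p of step^(m + 2) when m + 2 >= 2 p'.  This is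
what makes Young's inequality applicable in [main_term_bound]. *)
Lemma cutoff_derivatives (p : R) (m : nat) : 1 < p -> 2 <= m.+2%:R * (1 - p^-1) ->
  exists2 A, 0 < A & forall r t, 1 <= r -> 0 <= t <= 2 * r ->
   `|derive1 (cutoff r m.+2) t| <= A / r * cutoff r m.+2 t `^ (p^-1) /\
   `|derive1 (derive1 (cutoff r m.+2)) t| <= A / r ^+ 2 * cutoff r m.+2 t `^ (p^-1).
Proof.
move=> p1 mp.
have s1 := @smooth1_step R; have [ds s1'] := smooth1_derive s1.
have [ds' s1''] := smooth1_derive s1'.
have bnd (f : R -> R) : continuous f -> exists2 A, 0 < A & forall y, 0 <= y <= 2 -> `|f y| <= A.
  move=> cf; have c2 : {within `[0, 2], continuous (fun y : R => `|f y|)}.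
    apply: continuous_subspaceT => x; apply: continuous_comp; first exact: cf.
    exact: norm_continuous.
  have [m' _ H] := EVT_max (ler0n R 2) c2.
  exists (`|f m'| + 1); first by rewrite ltr_wpDl.
  by move=> y y02; apply: le_trans (H y _) _; rewrite ?in_itv//= lerDl.
have [A1 A10 H1] := bnd _ (smooth1_continuous s1').
have [A2 A20 H2] := bnd _ (smooth1_continuous s1'').
pose A := m.+2%:R * (m.+1%:R * A1 ^+ 2 + A2 + A1).
have m2 : 1 <= m.+2%:R :> R by rewrite ler1n.
have m1 : 1 <= m.+1%:R :> R by rewrite ler1n.
have A10' : 0 <= m.+1%:R * A1 ^+ 2 by rewrite mulr_ge0// exprn_ge0// ltW.
have A0 : 0 < A.
  by rewrite /A mulr_gt0//; lra.
exists A => // r t r1 /andP[t0 tr].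
have r0 : 0 < r by lra.
have y02 : 0 <= - r^-1 * t + 2 <= 2.
  have : r^-1 * t <= 2 by rewrite mulrC ler_pdivrMr.
  have : 0 <= r^-1 * t by rewrite mulr_ge0// invr_ge0 ltW.
  by move=> ? ?; apply/andP; split; lra.
have := H1 _ y02; have := H2 _ y02.
rewrite derive_cutoff derive2_cutoff /cutoff.
set y := - r^-1 * t + 2; set S := step y.
set D1 := derive1 _ y; set D2 := derive1 _ y => hD2 hD1.
have S0 : 0 <= S by exact: step_ge0.
have S1 : S <= 1 by exact: step_le1.
have Sm k : 0 <= S ^+ k by rewrite exprn_ge0.
have SmP : S ^+ m <= (S ^+ m.+2) `^ p^-1.
  have [S00|Sn0] := eqVneq S 0.
    have : (0 < m)%N.
      rewrite lt0n; apply/eqP => m0; move: mp; rewrite m0.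
      have : 0 < p^-1 by rewrite invr_gt0; lra.
      lra.
    by rewrite S00; case: (m) => // k _; rewrite expr0n powR_ge0.
  have Sgt : 0 < S by rewrite lt_def Sn0.
  rewrite -!powR_mulrn// -powRrM; apply: ger_powR; first by rewrite Sgt.
  by move: mp; rewrite -[m.+2]addn2 natrD; lra.
set P := _ `^ _ in SmP *.
have P0 : 0 <= P by exact: powR_ge0.
have AP : A * P = m.+2%:R * P * (m.+1%:R * A1 ^+ 2 + A2 + A1) by rewrite /A; ring.
split.
  rewrite normrM normrN (ger0_norm (_ : 0 <= r^-1)) ?invr_ge0 ?(ltW r0)//.
  rewrite (_ : A / r * P = r^-1 * (A * P)); last by ring.
  rewrite ler_wpM2l ?invr_ge0 ?(ltW r0)//.
  rewrite normrM ger0_norm ?mulr_ge0//.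
  have e1 : S ^+ m.+1 <= P by apply: le_trans SmP; rewrite exprS ler_piMl.
  apply: (@le_trans _ _ (m.+2%:R * P * A1)).
    by apply: ler_pM => //; rewrite ?mulr_ge0// ler_wpM2l.
  rewrite AP ler_wpM2l ?mulr_ge0//; lra.
rewrite normrM ger0_norm ?exprn_ge0 ?invr_ge0 ?(ltW r0)//.
rewrite (_ : A / r ^+ 2 * P = r^-1 ^+ 2 * (A * P)); last by rewrite exprVn; ring.
rewrite ler_wpM2l ?exprn_ge0 ?invr_ge0 ?(ltW r0)//.
rewrite normrM ger0_norm ?mulr_ge0//.
apply: (@le_trans _ _ (m.+2%:R * P * (m.+1%:R * A1 ^+ 2 + A2))).
  apply: ler_pM => //; rewrite ?mulr_ge0 ?ler_wpM2l//.
  apply: (le_trans (ler_normD _ _)); rewrite [X in X + _]normrM normrX [X in _ + X]normrM lerD//.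
    rewrite ger0_norm// ler_wpM2l//; apply: lerXn2r; rewrite ?nnegrE// ltW//.
  by rewrite (ger0_norm S0) -[leRHS]mul1r ler_pM.
rewrite AP ler_wpM2l ?mulr_ge0//; lra.
Qed.

Lemma derive_cutoff_tpow (a b r t : R) (m : nat) : 1 < t + a ->
  let G := fun t => cutoff r m t * tpow a b t in
  derive1 G t = derive1 (cutoff r m) t * (t + a) `^ (- b)
     - b * cutoff r m t * (t + a) `^ (- (b + 1)) /\
  derive1 (derive1 G) t = derive1 (derive1 (cutoff r m)) t * (t + a) `^ (- b)
     - 2 * b * derive1 (cutoff r m) t * (t + a) `^ (- (b + 1))
     + b * (b + 1) * cutoff r m t * (t + a) `^ (- (b + 2)).
Proof.
move=> ta G; have sc := smooth1_cutoff r m; have st := smooth1_tpow a b.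
have [_ sc'] := smooth1_derive sc; have [_ st'] := smooth1_derive st.
have ta1 : 1 <= t + a by exact: ltW.
have GE : derive1 G = (fun t => cutoff r m t * derive1 (tpow a b) t + derive1 (cutoff r m) t * tpow a b t).
  exact: derive1_mul.
split.
  by rewrite GE derive_tpow// !tpowE//; ring.
rewrite GE.
have s1 := smooth1M sc st'; have s2 := smooth1M sc' st.
have [d1 _] := smooth1_derive s1; have [d2 _] := smooth1_derive s2.
rewrite (derive1_is_derive (is_deriveD (d1 t) (d2 t))).
rewrite (derive1_mul sc st') (derive1_mul sc' st) derive_tpow// derive2_tpow// !tpowE//.
ring.
Qed.

End time_functions.

(** * Pointwise bounds for the truncated test function *)

(** Young's inequality for the product of m^(1/p) x w^(1/p) and m^(- 1/p) F. *)
Lemma young_weighted (R : realType) (p x w F m : R) : 1 < p -> 0 <= x -> 0 <= w ->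
  0 <= F -> 0 < m ->
  x * (w `^ p^-1 * F) <= m * w * x `^ p
     + m `^ (- (p - 1)^-1) * F `^ (p / (p - 1)).
Proof.
move=> p1 x0 w0 F0 m0.
have p0 : 0 < p by lra.
have p1' : 0 < p - 1 by lra.
have q0 : 0 < p / (p - 1) by rewrite divr_gt0.
have pq : p^-1 + (p / (p - 1))^-1 = 1 by field; apply/andP; split; lra.
have := @conjugate_powR R (m `^ p^-1 * x * w `^ p^-1) (m `^ (- p^-1) * F) p (p / (p - 1)).
rewrite !mulr_ge0 ?powR_ge0// => /(_ isT isT p0 q0 pq).
have -> : m `^ p^-1 * x * w `^ p^-1 * (m `^ (- p^-1) * F) = x * (w `^ p^-1 * F).
  have : m `^ p^-1 * m `^ (- p^-1) = 1.
    by rewrite powRN mulfV// gt_eqF// powR_gt0.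
  set A := m `^ _; set A' := m `^ _ => AA.
  transitivity (A * A' * (x * (w `^ p^-1 * F))); first by ring.
  by rewrite AA mul1r.
move/le_trans; apply; apply: lerD.
  rewrite powRM ?mulr_ge0 ?powR_ge0// powRM ?powR_ge0// -!powRrM.
  rewrite mulVf ?gt_eqF// !powRr1//; last exact: ltW.
  rewrite ler_pdivrMr// [m * _ * w]mulrAC ler_peMr ?mulr_ge0 ?powR_ge0//; exact: ltW.
rewrite powRM ?powR_ge0// -powRrM.
have -> : - p^-1 * (p / (p - 1)) = - (p - 1)^-1 by field; apply/andP; split; lra.
rewrite ler_pdivrMr// ler_peMr ?mulr_ge0 ?powR_ge0//.
by rewrite ler_pdivlMr//; lra.
Qed.

(** An exponential decay beats a linear growth: by Bernoulli's inequality
th^(2 N) = O(N^-2). *)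
Lemma geometric_small (R : realType) (th C D e : R) : 0 <= th < 1 -> 0 <= C -> 0 <= D ->
  0 < e -> exists N : nat, C * (D + 2 * N%:R) * th ^+ (2 * N) <= e.
Proof.
move=> /andP[th0 th1] C0 D0 e0.
have [->|thn0] := eqVneq th 0.
  exists 1%N; rewrite muln1 expr0n mulr0; exact: ltW.
have thp : 0 < th by rewrite lt_def thn0.
pose d := th^-1 - 1.
have d0 : 0 < d by rewrite subr_gt0 invf_gt1.
have bern j : 1 + d * j%:R <= th^-1 ^+ j.
  elim: j => [|j IH]; first by rewrite expr0 mulr0 addr0.
  rewrite exprS; apply: (@le_trans _ _ (th^-1 * (1 + d * j%:R))).
    have -> : th^-1 = 1 + d by rewrite /d; lra.
    rewrite -natr1; have : 0 <= d * d * j%:R by rewrite !mulr_ge0// ltW.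
    by nra.
  by rewrite ler_wpM2l// invr_ge0.
pose X := C * (D + 2) / (d ^+ 2 * e).
have D2 : 0 <= D + 2 by lra.
have X0 : 0 <= X by rewrite divr_ge0 ?mulr_ge0 ?exprn_ge0 ?(ltW d0) ?(ltW e0).
pose N := (Num.trunc X).+1.
have /andP[_] := trunc_itv X0; rewrite -/N => XN.
have N1 : 1 <= N%:R :> R by rewrite ler1n.
exists N.
have dN : 0 < d * N%:R by rewrite mulr_gt0//; lra.
have thN : th ^+ (2 * N) <= (d * N%:R) ^- 2.
  rewrite mulnC exprM -exprVn; apply: lerXn2r; rewrite ?nnegrE ?exprn_ge0 ?invr_ge0 ?(ltW dN)//.
  rewrite -[th ^+ N]invrK lef_pV2 ?posrE ?invr_gt0 ?exprn_gt0//.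
  by rewrite -exprVn; apply: le_trans (bern N); lra.
apply: (@le_trans _ _ (C * (D + 2) * N%:R * (d * N%:R) ^- 2)).
  apply: ler_pM; rewrite ?mulr_ge0 ?addr_ge0 ?exprn_ge0 ?mulr_ge0//.
  by rewrite -mulrA ler_wpM2l//; nra.
have -> : C * (D + 2) * N%:R * (d * N%:R) ^- 2 = X * e / N%:R.
  by rewrite /X; field; rewrite !gt_eqF//; lra.
rewrite ler_pdivrMr; last by lra.
by rewrite mulrC ler_wpM2l ?(ltW e0)// ltW.
Qed.

(** The terms of the wave operator applied to the cut-off series that contain a
derivative of the cut-off.  The one with psi1 carries the factor b + 2 k of a time
derivative of the series and is the worse one; both are bounded through
[wave_series_bound] at y = (e / tau)^2, where e stands for |x|, and tau is
comparable to r. *)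
Lemma kernel_bound (R : realType) (n : nat) (s b K A r t a e psi1 psi2 W : R) (N : nat) :
  0 < b -> 0 <= s < 1 -> (0 < n)%N ->
  0 < K -> 0 < A -> 1 <= r -> r <= t <= 2 * r -> 1 <= a ->
  (forall y, 0 <= y < 1 ->
    \sum_(0 <= k < N) (wave_coef n b k * (b + 2 * k%:R) * y ^+ k)
      <= K * (1 - y) `^ (- (1 - s))) ->
  `|psi1| <= A / r * W -> `|psi2| <= A / r ^+ 2 * W -> 0 <= W ->
  0 <= e -> e + 1 <= t + a ->
  `|\sum_(0 <= k < N) (wave_coef n b k *
      (psi2 * (t + a) `^ (- (b + 2 * k%:R))
       - 2 * (b + 2 * k%:R) * psi1 * (t + a) `^ (- (b + 2 * k%:R + 1)))
      * (e ^+ 2) ^+ k)| <=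
  W * (A * (b^-1 + 2) * K * (2 + a) `^ (1 - s) * r `^ (- (b + 1 + s))
     * (t + a - e) `^ (- (1 - s))).
Proof.
move=> b0 /andP[s0 s1] n0 K0 A0 r1 /andP[rt t2r] a1 HK Hp1 Hp2 W0 e0 et.
have r0 : 0 < r by lra.
set tau := t + a.
have tau0 : 0 < tau by rewrite /tau; lra.
have taur : r <= tau by rewrite /tau; lra.
have tau_up : tau <= (2 + a) * r.
  have : 0 <= a * (r - 1) by rewrite mulr_ge0//; lra.
  by rewrite /tau; lra.
pose y := (e / tau) ^+ 2.
have et1 : e / tau < 1 by rewrite ltr_pdivrMr// mul1r /tau; lra.
have et0 : 0 <= e / tau by rewrite divr_ge0// ltW.
have y0 : 0 <= y by rewrite exprn_ge0.
have yet : y <= e / tau by rewrite /y expr2 ler_piMl// ltW.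
have y1 : y < 1 by exact: le_lt_trans et1.
have s1' : 0 <= 1 - s by lra.
have Ar0 : 0 <= A / r ^+ 2 by rewrite divr_ge0 ?exprn_ge0 ?(ltW A0) ?(ltW r0).
have bi0 : 0 <= b^-1 + 2 by rewrite addr_ge0 ?invr_ge0 ?(ltW b0).
have term k : tau `^ (- (b + 2 * k%:R)) * (e ^+ 2) ^+ k = tau `^ (- b) * y ^+ k.
  have -> : - (b + 2 * k%:R) = - b + - (2 * k)%:R by rewrite opprD natrM.
  rewrite powRD; last by rewrite (gt_eqF tau0) implybT.
  rewrite powR_invn ?(ltW tau0)// -mulrA; congr (_ * _).
  by rewrite /y -[RHS]exprM expr_div_n mulrC -exprM.
have term1 k : tau `^ (- (b + 2 * k%:R + 1)) * (e ^+ 2) ^+ k = tau `^ (- b) / tau * y ^+ k.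
  rewrite opprD powRD; last by rewrite (gt_eqF tau0) implybT.
  by rewrite powR_inv1 ?(ltW tau0)// mulrAC term mulrAC.
set C := psi2 / b; set D := 2 * psi1 / tau.
apply: (@le_trans _ _ (\sum_(0 <= k < N) (tau `^ (- b) * (A / r ^+ 2 * W * (b^-1 + 2)) *
    (wave_coef n b k * (b + 2 * k%:R) * y ^+ k)))).
  apply: (le_trans (ler_norm_sum _ _ _)); apply: ler_sum => k _.
  have c0 := wave_coef_gt0 k n0 b0.
  have k0 : 0 <= k%:R :> R by exact: ler0n.
  have bk : 0 < b + 2 * k%:R by lra.
  have -> : wave_coef n b k * (psi2 * tau `^ (- (b + 2 * k%:R)) -
      2 * (b + 2 * k%:R) * psi1 * tau `^ (- (b + 2 * k%:R + 1))) * (e ^+ 2) ^+ k =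
    tau `^ (- b) * (wave_coef n b k * y ^+ k) *
      (psi2 - (b + 2 * k%:R) * (2 * psi1 / tau)).
    rewrite mulrBr mulrBl -!mulrA term.
    rewrite [_ `^ _ * (e ^+ 2) ^+ k]term1; ring.
  rewrite normrM ger0_norm; last by rewrite !mulr_ge0 ?powR_ge0 ?exprn_ge0// ltW.
  have -> : tau `^ (- b) * (A / r ^+ 2 * W * (b^-1 + 2)) *
     (wave_coef n b k * (b + 2 * k%:R) * y ^+ k) =
     tau `^ (- b) * (wave_coef n b k * y ^+ k) *
     ((b + 2 * k%:R) * (A / r ^+ 2 * W * b^-1 + A / r ^+ 2 * W * 2)) by ring.
  rewrite ler_wpM2l ?mulr_ge0 ?powR_ge0 ?exprn_ge0 ?(ltW c0)//.
  apply: (le_trans (ler_normB _ _)); rewrite mulrDr lerD//.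
    apply: (le_trans Hp2).
    have Q0 : 0 <= A / r ^+ 2 * W by rewrite mulr_ge0// divr_ge0 ?exprn_ge0// ltW.
    rewrite mulrCA ler_peMr//; rewrite ler_pdivlMr//; lra.
  rewrite normrM (ger0_norm (ltW bk)) ler_wpM2l ?(ltW bk)//.
  rewrite normrM normrM (ger0_norm (_ : 0 <= tau^-1)) ?invr_ge0 ?(ltW tau0)//.
  rewrite ger0_norm// [leRHS]mulrC -mulrA ler_wpM2l//.
  rewrite ler_pdivrMr//; apply: (le_trans Hp1).
  have -> : A / r ^+ 2 * W * tau = A / r * W * (tau / r) by field; rewrite gt_eqF.
  have Q0 : 0 <= A / r * W by rewrite mulr_ge0// divr_ge0// ltW.
  by rewrite ler_peMr// ler_pdivlMr// mul1r.
rewrite -mulr_sumr.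
have coef0 : 0 <= tau `^ (- b) * (A / r ^+ 2 * W * (b^-1 + 2)).
  by rewrite mulr_ge0 ?powR_ge0// mulr_ge0// mulr_ge0.
apply: (le_trans (ler_wpM2l coef0 (HK y _))); first by rewrite y0.
have te : 0 < tau - e by rewrite /tau; lra.
have h1 : (1 - y) `^ (- (1 - s)) <= ((2 + a) * r) `^ (1 - s) * (tau - e) `^ (- (1 - s)).
  rewrite !powRN -(powRN (tau - e)).
  apply: (@le_trans _ _ (((tau - e) / tau) `^ (1 - s))^-1).
    rewrite lef_pV2 ?posrE ?powR_gt0 ?subr_gt0 ?divr_gt0//.
    have le1 : (tau - e) / tau <= 1 - y by rewrite mulrBl mulfV ?gt_eqF// lerD2l lerN2.
    apply: ge0_ler_powR => //; rewrite nnegrE; last by rewrite subr_ge0 ltW.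
    by rewrite divr_ge0// ltW.
  rewrite powRM ?invr_ge0 ?(ltW te) ?(ltW tau0)// invfM -powRN mulrC.
  rewrite ler_wpM2r ?powR_ge0//.
  rewrite -[tau^-1]powR_inv1 ?(ltW tau0)// -powRrM -powRN mulN1r opprK.
  by apply: ge0_ler_powR; rewrite ?nnegrE ?mulr_ge0 ?(ltW tau0) ?(ltW r0)//; lra.
have h2 : tau `^ (- b) <= r `^ (- b).
  rewrite !powRN lef_pV2 ?posrE ?powR_gt0//.
  by apply: ge0_ler_powR; rewrite ?nnegrE ?(ltW tau0) ?(ltW r0)// ltW.
apply: (@le_trans _ _ (r `^ (- b) * (A / r ^+ 2 * W * (b^-1 + 2)) *
   (K * (((2 + a) * r) `^ (1 - s) * (tau - e) `^ (- (1 - s)))))).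
  apply: ler_pM => //.
  - by rewrite mulr_ge0 ?powR_ge0 ?(ltW K0).
  - by rewrite ler_wpM2r// mulr_ge0// mulr_ge0.
  - by rewrite ler_wpM2l// ltW.
rewrite powRM ?(ltW r0)//; last lra.
have -> : r `^ (- (b + 1 + s)) = r `^ (- b) * r ^- 2 * r `^ (1 - s).
  rewrite -powR_invn ?(ltW r0)// -!powRD; try by rewrite (gt_eqF r0) implybT.
  by congr (_ `^ _); ring.
rewrite le_eqVlt; apply/orP; left; apply/eqP; ring.
Qed.

(** * Telescoping, and linear combinations in L2 *)

(** M k stands for the integral of u against |x|^(2 k), so that the Laplace operator
brings in M (k - 1).  By the recursion of [wave_coef], the terms in which psi is
not differentiated cancel between consecutive ranks; the one of the last rank
has no partner. *)
Lemma wave_telescope (R : realType) (n : nat) (b tau psi psi1 psi2 : R) (M : nat -> R) N :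
  (0 < n)%N ->
  \sum_(0 <= k < N.+1) (wave_coef n b k *
    ((psi2 * tau `^ (- (b + 2 * k%:R)) - 2 * (b + 2 * k%:R) * psi1 * tau `^ (- (b + 2 * k%:R + 1))
      + (b + 2 * k%:R) * (b + 2 * k%:R + 1) * psi * tau `^ (- (b + 2 * k%:R + 2))) * M k
     - psi * tau `^ (- (b + 2 * k%:R)) * (2 * k%:R * (2 * k%:R + n%:R - 2) * M k.-1))) =
  \sum_(0 <= k < N.+1) (wave_coef n b k *
    (psi2 * tau `^ (- (b + 2 * k%:R)) - 2 * (b + 2 * k%:R) * psi1 * tau `^ (- (b + 2 * k%:R + 1))) * M k)
  + wave_coef n b N * ((b + 2 * N%:R) * (b + 2 * N%:R + 1)) * psi
     * tau `^ (- (b + 2 * N%:R + 2)) * M N.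
Proof.
move=> n0; elim: N => [|N IH].
  by rewrite !big_nat1 /=; ring.
rewrite big_nat_recr//= [in RHS]big_nat_recr//= IH.
rewrite -(wave_coefS b N n0).
have -> : b + 2 * N.+1%:R = b + 2 * N%:R + 2 by rewrite -natr1; ring.
set c1 := wave_coef n b N.+1.
have -> : wave_coef n b N * ((b + 2 * N%:R) * (b + 2 * N%:R + 1) / ((2 * N%:R + 2) * (2 * N%:R + n%:R))) = c1 by [].
rewrite -natr1; move: (tau `^ _) (tau `^ _) (tau `^ _) => t1 t2 t3.
set S := \sum_(0 <= _ < _) _; move: S c1 => S c1; ring.
Qed.

Section inner_linear.
Context d (T : measurableType d) (R : realType).
Variable mu : {measure set T -> \bar R}.
Implicit Types f g h : T -> R.
Local Notation L2m f := (f \in Lfun mu 2%:E).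

Lemma L2_0 : L2m (fun _ : T => 0 : R).
Proof.
apply: L2P_sqr => //.
rewrite integral0_eq ?ltry// => x _; by rewrite expr0n.
Qed.

Lemma L2Z (c : R) f : L2m f -> L2m (fun x => c * f x).
Proof.
move=> lf; have mf := L2_measurable lf; apply: L2P_sqr; first exact: measurable_funM.
have /integrableP[_] := integrableZl measurableT (c ^+ 2) (Lfun2_integrable_sqr lf).
apply: le_lt_trans; apply: ge0_le_integral_set => x _.
  by rewrite lee_fin sqr_ge0.
by rewrite -EFinM exprMn; exact: lee_abs.
Qed.

Lemma L2D f g : L2m f -> L2m g -> L2m (fun x => f x + g x).
Proof.
move=> lf lg; have := L2B lf (L2Z (-1) lg).
by rewrite (_ : _ \- _ = (fun x => f x + g x))//; apply/funext => x /=; rewrite mulN1r opprK.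
Qed.

Lemma L2_sum (N : nat) (c : nat -> R) (h : nat -> T -> R) :
  (forall k, L2m (h k)) -> L2m (fun x => \sum_(0 <= k < N) (c k * h k x)).
Proof.
move=> lh; elim: N => [|N IH].
  rewrite (_ : (fun=> _) = (fun=> 0)); first exact: L2_0.
  by apply/funext => x; rewrite big_geq.
rewrite (_ : (fun=> _) = (fun x => \sum_(0 <= k < N) (c k * h k x) + c N * h N x)).
  by apply: L2D => //; exact: L2Z.
by apply/funext => x; rewrite big_nat_recr.
Qed.

Lemma inner_sum f (N : nat) (c : nat -> R) (h : nat -> T -> R) : L2m f ->
  (forall k, L2m (h k)) ->
  inner mu f (fun x => \sum_(0 <= k < N) (c k * h k x)) =
  \sum_(0 <= k < N) (c k * inner mu f (h k)).
Proof.
move=> lf lh; elim: N => [|N IH].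
  rewrite big_geq// /inner /Rintegral integral0_eq// => x _.
  by rewrite big_geq// mulr0.
rewrite big_nat_recr//= -IH /inner -RintegralZl//; last exact: L2_integrableM.
rewrite -RintegralD//; last 2 first.
- by apply: L2_integrableM => //; exact: L2_sum.
- have := L2_integrableM lf (L2Z (c N) (lh N)); congr (mu.-integrable _ _).
  by apply/funext => x /=; rewrite mulrCA.
by apply: eq_Rintegral => x _; rewrite big_nat_recr//= mulrDr mulrCA.
Qed.

Lemma inner_ae_le f h (F : T -> R) : L2m f -> L2m h -> measurable_fun setT F ->
  (forall x, 0 <= F x) -> {ae mu, forall x, `|f x * h x| <= F x} ->
  (`|inner mu f h|%:E <= \int[mu]_x (F x)%:E)%E.
Proof.
move=> lf lh mF F0 fhF.
have i := L2_integrableM lf lh.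
rewrite /inner EFin_normr_Rintegral//.
apply: (le_trans (le_abse_integral _ _ (measurable_int _ i))) => //.
apply: ae_ge0_le_integral => //.
- apply/measurable_EFinP; apply: measurableT_comp => //.
  exact: (measurable_funM (L2_measurable lf) (L2_measurable lh)).
- by move=> x _; rewrite lee_fin.
- exact/measurable_EFinP.
- by apply: filterS fhF => x Hx _; rewrite /= lee_fin.
Qed.

Lemma inner_ae_eq f h1 h2 : L2m f -> L2m h1 -> L2m h2 ->
  {ae mu, forall x, f x * h1 x = f x * h2 x} -> inner mu f h1 = inner mu f h2.
Proof.
move=> lf l1 l2 H; rewrite /inner /Rintegral; congr fine; apply: ae_eq_integral => //.
- by apply/measurable_EFinP; exact: (measurable_funM (L2_measurable lf) (L2_measurable l1)).
- by apply/measurable_EFinP; exact: (measurable_funM (L2_measurable lf) (L2_measurable l2)).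
- by apply: filterS H => x Hx _; rewrite Hx.
Qed.

Lemma inner_ge0 f h : {ae mu, forall x, 0 <= f x} -> (forall x, 0 <= h x) ->
  L2m f -> L2m h -> 0 <= inner mu f h.
Proof.
move=> f0 h0 lf lh; rewrite fine_ge0//.
rewrite (_ : (\int[mu]_x (f x * h x)%:E = \int[mu]_x (`|f x * h x|)%:E)%E).
  by apply: integral_ge0 => x _; rewrite lee_fin.
have m1 : measurable_fun setT (fun x => f x * h x).
  exact: (measurable_funM (L2_measurable lf) (L2_measurable lh)).
apply: ae_eq_integral => //.
- exact/measurable_EFinP.
- by apply/measurable_EFinP; apply: measurableT_comp.
- by apply: filterS f0 => x fx _; rewrite ger0_norm// mulr_ge0.
Qed.

End inner_linear.

(** * The averaged inequality *)

(** The power - q of t + rho + 1 - |x|, the distance in |x| to the light cone on which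
the self-similar waves are singular.  It is at least 1 on the cone that carries
the solution. *)
Definition cone_weight (R : realType) (n : nat) (rho q t : R) (x : 'rV[R]_n) : R :=
  if euclidean_norm x <= t + rho then (t + (rho + 1) - euclidean_norm x) `^ (- q) else 0.

Definition cone_integral (R : realType) (n : nat) (rho q t : R) : \bar R :=
  (\int[lebesgue_rV R n]_x (cone_weight rho q t x)%:E)%E.

Lemma cone_weight_ge0 (R : realType) (n : nat) (rho q t : R) (x : 'rV[R]_n) : 0 <= cone_weight rho q t x.
Proof. by rewrite /cone_weight; case: ifP => // _; exact: powR_ge0. Qed.

Lemma measurable_cone_weight (R : realType) (n : nat) (rho q t : R) :
  measurable_fun setT (@cone_weight R n rho q t).
Proof.
apply: measurable_fun_ifT => //.
- apply: measurable_fun_ler => //; exact: measurable_euclidean_norm.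
- apply: (measurableT_comp (measurable_powR (- q))).
  by apply: measurable_funB => //; exact: measurable_euclidean_norm.
Qed.

Section truncated_test.
Variables (R : realType) (n : nat) (p rho : R).
Local Notation V := 'rV[R]_n.
Local Notation mu := (lebesgue_rV R n).
Local Notation leb := (@lebesgue_measure R).
Variables (u v : R -> V -> R).
Hypothesis n2 : (2 <= n)%N.
Hypothesis p1 : 1 < p.
Hypothesis rho0 : 0 < rho.
Hypothesis cu : L2_continuous mu u.
Hypothesis cv : L2_continuous mu v.
Hypothesis hut : is_time_derivative +oo%E u v.
Hypothesis heq : wave_equation +oo%E p u.
Hypothesis hsupp : support_in_cone +oo%E rho u v.
Hypothesis u0_ge0 : {ae mu, forall x, 0 <= u 0 x}.
Hypothesis v0_ge0 : {ae mu, forall x, 0 <= v 0 x}.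

Let a : R := rho + 1.
Let p0 : 0 < p. Proof. by apply: lt_trans p1. Qed.
Let n0 : (0 < n)%N. Proof. exact: ltnW. Qed.
Local Notation g t := (fine (pmass p u t)).

Lemma cone_ae t : 0 <= t ->
  {ae mu, forall x, t + rho < euclidean_norm x -> u t x = 0 /\ v t x = 0}.
Proof. by move=> t0; apply: hsupp; split; rewrite ?ltry. Qed.

Lemma innerZr (f h : V -> R) (c : R) : f \in Lfun mu 2%:E -> L2 h ->
  inner mu f (fun x => c * h x) = c * inner mu f h.
Proof.
move=> lf lh; rewrite /inner -RintegralZl//; last exact: L2_integrableM.
by apply: eq_Rintegral => x _; rewrite mulrCA.
Qed.

Lemma chi_cone (B : R) (x : V) : euclidean_norm x <= B -> chi B x = 1.
Proof. by move=> xB; apply: chi1 => i; exact: le_trans (coord_le_norm x i) xB. Qed.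

Lemma hpoly_cone (B : R) k (x : V) : euclidean_norm x <= B ->
  hpoly B k x = (euclidean_norm x ^+ 2) ^+ k.
Proof. by move=> xB; rewrite /hpoly chi_cone// mulr1 rsqE. Qed.

(** On the support of u the cut-off of [hpoly] is constant, so that the Laplace
operator acts as on |x|^(2 k). *)
Lemma moment_lap (B t : R) k : 0 <= t -> t + rho < B ->
  moment u (space_lap (hpoly B k)) t =
  2 * k%:R * (2 * k%:R + n%:R - 2) * moment u (hpoly B k.-1) t.
Proof.
have rp := rho0.
move=> t0 tB; have B0 : 0 <= B by lra.
have lu := cu.1 t t0; have lh := L2_hpoly n k.-1 B0.
rewrite !momentE// -innerZr//; apply: inner_ae_eq => //.
- apply: (@L2_space_lap _ _ _ (B + 1)); first lra.
  + exact: measurable_hpoly.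
  + exact: smooth_hpoly.
  + by move=> x xB; rewrite /hpoly chi0 ?mulr0.
- exact: L2Z.
apply: filterS (cone_ae t0) => x Hx.
have [xt|tx] := leP (euclidean_norm x) (t + rho); last first.
  by have [-> _] := Hx tx; rewrite !mul0r.
have xB : euclidean_norm x <= B by lra.
rewrite space_lap_hpoly; last by move=> i; apply: le_lt_trans (coord_le_norm x i) _; lra.
by rewrite hpoly_cone// rsqE.
Qed.

Lemma time_integral_sum (N : nat) (c : nat -> R) (X : nat -> R -> R) (t1 t2 : R) :
  (forall k, continuous (X k)) ->
  continuous (fun t => \sum_(0 <= k < N) (c k * X k t)) /\
  \int[leb]_(t in `[t1, t2]) (\sum_(0 <= k < N) (c k * X k t)) =
  \sum_(0 <= k < N) (c k * \int[leb]_(t in `[t1, t2]) X k t).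
Proof.
move=> cX; elim: N => [|N [cS IH]].
  split; last by rewrite [RHS]big_geq// /Rintegral integral0_eq// => t _; rewrite big_geq.
  rewrite (_ : (fun=> _) = (fun=> 0)); first exact: cst_continuous.
  by apply/funext => t; rewrite big_geq.
have cN : continuous (fun t => c N * X N t).
  by apply: continuousTM; [exact: cst_continuous|exact: cX].
have E : (fun t => \sum_(0 <= k < N.+1) (c k * X k t)) =
    (fun t => \sum_(0 <= k < N) (c k * X k t) + c N * X N t).
  by apply/funext => t; rewrite big_nat_recr.
rewrite E; split; first exact: continuousTD.
by rewrite (time_integralD t1 t2 cS cN) IH big_nat_recr//= (time_integralZ _ t1 t2 (cX N)).
Qed.

Section fixed.
Variables (s b : R) (m : nat).
Hypothesis s01 : 0 <= s < 1.
Hypothesis bE : b = (n%:R - 1) / 2 - s.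
Hypothesis b0 : 0 < b.
Hypothesis mp : 2 <= m.+2%:R * (1 - p^-1).

Local Notation cc := (wave_coef n b).
Local Notation psi r := (cutoff r m.+2).

(** The time factor of the k-th term of the test function psi_r Phi_b. *)
Definition temporal (r : R) (k : nat) (t : R) : R := cutoff r m.+2 t * tpow a (b + 2 * k%:R) t.

Lemma smooth1_temporal r k : smooth1 (temporal r k).
Proof. by apply: smooth1M; [exact: smooth1_cutoff|exact: smooth1_tpow]. Qed.

Lemma temporalE r k t : 0 <= t -> temporal r k t = psi r t * (t + a) `^ (- (b + 2 * k%:R)).
Proof. by have rp := rho0; move=> t0; rewrite /temporal tpowE// /a; lra. Qed.

Let X r k (t : R) : R := derive1 (derive1 (temporal r k)) t * moment u (hpoly (2 * r + rho + 1) k) t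
  - temporal r k t * moment u (space_lap (hpoly (2 * r + rho + 1) k)) t.
Let Y r k : R := derive1 (temporal r k) 0 * moment u (hpoly (2 * r + rho + 1) k) 0
  - temporal r k 0 * moment v (hpoly (2 * r + rho + 1) k) 0.

Lemma continuous_X r k : 1 <= r -> continuous (X r k).
Proof.
have rp := rho0.
move=> r1; have B0 : 0 <= 2 * r + rho + 1 by lra.
have [_ sG'] := smooth1_derive (smooth1_temporal r k).
have [_ sG''] := smooth1_derive sG'.
have c1 := smooth1_continuous (smooth1_temporal r k).
have c2 := smooth1_continuous sG''.
have U1 := continuous_moment cu (L2_hpoly n k B0).
have U2 : continuous (moment u (space_lap (hpoly (2 * r + rho + 1) k))).
  apply: continuous_moment => //; apply: (@L2_space_lap _ _ _ (2 * r + rho + 1 + 1)).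
  - lra.
  - exact: measurable_hpoly.
  - exact: smooth_hpoly.
  - by move=> x xB; rewrite /hpoly chi0 ?mulr0.
exact: (continuousTB (continuousTM c2 U1) (continuousTM c1 U2)).
Qed.

(** The weak inequality for each term |x|^(2 k) tau^(- b - 2 k) of the test function,
weighted by its coefficient.  On the left only k = 0 is kept; for the other terms
the non-negativity of |u|^p is enough. *)
Lemma sum_weak r t0 N : 1 <= r -> 0 < t0 ->
  \int[leb]_(t in `[t0, 2 * r]) (temporal r 0 t * g t) <=
  \int[leb]_(t in `[0, 2 * r]) (\sum_(0 <= k < N.+1) (cc k * X r k t)) +
  \sum_(0 <= k < N.+1) (cc k * Y r k).
Proof.
have rp := rho0.
move=> r1 t00.
have Wk k : \int[leb]_(t in `[t0, 2 * r]) ((k == 0)%:R * (temporal r k t * g t)) <=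
    \int[leb]_(t in `[0, 2 * r]) X r k t + Y r k.
  have B0 : 0 <= 2 * r + rho + 1 + 1 by lra.
  apply: (weak_inequality p0 cu cv hut heq hsupp B0) => //.
  - exact: smooth_hpoly.
  - exact: measurable_hpoly.
  - by move=> x; exact: hpoly_ge0.
  - by move=> x xB; rewrite /hpoly chi0 ?mulr0.
  - move=> x xr; case: k => [|k]; last exact: hpoly_ge0.
    by rewrite hpoly_cone ?expr0//; lra.
  - exact: smooth1_temporal.
  - by move=> t t_ge0; rewrite temporalE// mulr_ge0 ?cutoff_ge0 ?powR_ge0.
  - by move=> t rt; rewrite /temporal cutoff0 ?mul0r//; lra.
  - lra.
have [_ ->] := time_integral_sum N.+1 cc 0 (2 * r) (fun k => @continuous_X r k r1).
rewrite -big_split/=.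
apply: (@le_trans _ _ (\sum_(0 <= k < N.+1) (cc k * (k == 0%N)%:R *
    \int[leb]_(t in `[t0, 2 * r]) (temporal r 0 t * g t)))).
  rewrite big_nat_recl//= mul1r mul1r lerDl sumr_ge0// => k _.
  by rewrite mulr0 mul0r.
apply: ler_sum => k _; rewrite -mulrDr -mulrA ler_wpM2l//.
  exact/ltW/wave_coef_gt0.
apply: le_trans (Wk k); case: k => [|k] /=.
  by rewrite mul1r; under [leRHS]eq_Rintegral do rewrite mul1r.
rewrite mul0r; apply: Rintegral_ge0 => t _; by rewrite mul0r.
Qed.

Lemma interior_terms_telescope r N t : 1 <= r -> 0 <= t <= 2 * r ->
  \sum_(0 <= k < N.+1) (cc k * X r k t) =
  \sum_(0 <= k < N.+1) (cc k * (derive1 (derive1 (psi r)) t * (t + a) `^ (- (b + 2 * k%:R))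
     - 2 * (b + 2 * k%:R) * derive1 (psi r) t * (t + a) `^ (- (b + 2 * k%:R + 1)))
     * moment u (hpoly (2 * r + rho + 1) k) t)
  + cc N * ((b + 2 * N%:R) * (b + 2 * N%:R + 1)) * psi r t
     * (t + a) `^ (- (b + 2 * N%:R + 2)) * moment u (hpoly (2 * r + rho + 1) N) t.
Proof.
have rp := rho0.
move=> r1 /andP[t0 tr].
rewrite -(wave_telescope b (t + a) (psi r t) (derive1 (psi r) t)
  (derive1 (derive1 (psi r)) t) (fun k => moment u (hpoly (2 * r + rho + 1) k) t) N n0).
apply: eq_bigr => k _; rewrite /X moment_lap//; last by lra.
have ta : 1 < t + a by rewrite /a; lra.
have [_ ->] := derive_cutoff_tpow (b + 2 * k%:R) r m.+2 ta.
by rewrite temporalE// !mulrA.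
Qed.

(** At t = 0 the cut-off is constant, the function tau^(- b - 2 k) decreases and the
data are non-negative: every term has the right sign, and k = 0 alone is kept. *)
Lemma initial_terms_le r N : 1 <= r ->
  \sum_(0 <= k < N.+1) (cc k * Y r k) <=
  - (b * a `^ (- (b + 1)) * moment u (hpoly rho 0) 0 + a `^ (- b) * moment v (hpoly rho 0) 0).
Proof.
have rp := rho0.
move=> r1; have a1 : 1 < 0 + a by rewrite /a; lra.
have B0 : 0 <= 2 * r + rho + 1 by lra.
have YE k : Y r k = - ((b + 2 * k%:R) * a `^ (- (b + 2 * k%:R + 1)) * moment u (hpoly (2 * r + rho + 1) k) 0
     + a `^ (- (b + 2 * k%:R)) * moment v (hpoly (2 * r + rho + 1) k) 0).
  rewrite /Y temporalE//.
  have [-> _] := derive_cutoff_tpow (b + 2 * k%:R) r m.+2 a1.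
  have r0 : 0 < r by lra.
  have [-> _] := derive_cutoff1 m.+2 r0 r0.
  by rewrite cutoff1 ?(ltW r0)// add0r; ring.
have U0 k : 0 <= moment u (hpoly (2 * r + rho + 1) k) 0.
  rewrite momentE//; apply: inner_ge0 => //; last exact: L2_hpoly.
    by move=> x; exact: hpoly_ge0.
  exact: cu.1.
have V0 k : 0 <= moment v (hpoly (2 * r + rho + 1) k) 0.
  rewrite momentE//; apply: inner_ge0 => //; last exact: L2_hpoly.
    by move=> x; exact: hpoly_ge0.
  exact: cv.1.
have c00 : cc 0 = 1 by [].
rewrite big_nat_recl// c00 mul1r -[leRHS]addr0 lerD//; last first.
  apply: sumr_le0 => k _; rewrite mulr_ge0_le0//; first exact/ltW/wave_coef_gt0.
  have k0 : 0 <= k.+1%:R :> R by exact: ler0n.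
  by have b0' := b0; rewrite YE oppr_le0 addr_ge0// !mulr_ge0 ?powR_ge0//; lra.
rewrite YE mulr0 addr0.
have E (w : R -> V -> R) : L2_continuous mu w ->
    {ae mu, forall x, 0 + rho < euclidean_norm x -> w 0 x = 0} ->
    moment w (hpoly (2 * r + rho + 1) 0) 0 = moment w (hpoly rho 0) 0.
  move=> cw w0; rewrite (momentE w _ (lexx 0)) (momentE w _ (lexx 0)).
  apply: (inner_ae_eq (cw.1 0 (lexx 0)) (L2_hpoly n 0 B0) (L2_hpoly n 0 (ltW rp))).
  apply: filterS w0 => x Hx.
  have [xt|tx] := leP (euclidean_norm x) (0 + rho); last by rewrite Hx// !mul0r.
  rewrite add0r in xt; rewrite !hpoly_cone//; lra.
rewrite (E u cu) ?(E v cv)//.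
- by apply: filterS (cone_ae (lexx 0)) => x Hx /Hx [].
- by apply: filterS (cone_ae (lexx 0)) => x Hx /Hx [].
Qed.

(** The solution lives where |x| <= t + rho, and (t + rho) / (t + a) is at most th < 1
for t <= 2 r.  The last term is therefore of the order of N th^(2 N), uniformly
in t. *)
Lemma last_term_small r e : 1 <= r -> 0 < e ->
  exists N, forall t, 0 <= t <= 2 * r ->
  `|cc N * ((b + 2 * N%:R) * (b + 2 * N%:R + 1)) * psi r t
     * (t + a) `^ (- (b + 2 * N%:R + 2)) * moment u (hpoly (2 * r + rho + 1) N) t| <= e.
Proof.
have rp := rho0; have b0' := b0; move=> r1 e0.
have B0 : 0 <= 2 * r + rho + 1 by lra.
have [K K0 HK] := wave_coef_bound n2 s01 bE b0.
have cabs := L2_continuous_abs cu.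
have cm := continuous_moment cabs (L2_hpoly n 0 B0).
have cn : {within `[0, 2 * r], continuous (moment (fun t x => `|u t x|) (hpoly (2 * r + rho + 1) 0))}.
  exact: continuous_subspaceT.
have r2 : 0 <= 2 * r by lra.
have [c0 _ Hm] := EVT_max r2 cn.
pose L := Num.max 0 (moment (fun t x => `|u t x|) (hpoly (2 * r + rho + 1) 0) c0).
have L0 : 0 <= L by rewrite le_max lexx.
pose th := (2 * r + rho) / (2 * r + a).
have ra : 0 < 2 * r + a by rewrite /a; lra.
have th01 : 0 <= th < 1.
  by rewrite divr_ge0 ?(ltW ra) ?ltr_pdivrMr ?mul1r//=; rewrite /a; lra.
have KL : 0 <= K * L by rewrite mulr_ge0// ltW.
have b1 : 0 <= b + 1 by lra.
have [N HN] := geometric_small th01 KL b1 e0.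
exists N => t /andP[t0 tr].
apply: le_trans HN.
set U := moment u _ t.
have N0 : 0 <= N%:R :> R by exact: ler0n.
have t_rho : 0 <= t + rho by lra.
have ta : 1 < t + a by rewrite /a; lra.
have ta0 : 0 < t + a by lra.
(* L bounds the integral of |u| over the cone, uniformly on [0, 2 r] *)
have UB : `|U| <= (t + rho) ^+ (2 * N) * L.
  have lu := cu.1 t t0; have lU := cabs.1 t t0.
  have lh := L2_hpoly n 0 B0; have lhN := L2_hpoly n N B0.
  apply: (@le_trans _ _ ((t + rho) ^+ (2 * N) * inner mu (fun x => `|u t x|) (hpoly (2 * r + rho + 1) 0))).
    rewrite -innerZr// -lee_fin /U momentE//.
    set F := fun x => `|u t x| * ((t + rho) ^+ (2 * N) * hpoly (2 * r + rho + 1) 0 x).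
    have lz := L2Z ((t + rho) ^+ (2 * N)) lh.
    apply: (@le_trans _ _ (\int[mu]_x (F x)%:E)%E).
      apply: inner_ae_le => //.
      - exact: (measurable_funM (L2_measurable lU) (L2_measurable lz)).
      - by move=> x; rewrite /F mulr_ge0// mulr_ge0 ?exprn_ge0// hpoly_ge0.
      apply: filterS (cone_ae t0) => x Hx.
      have [xt|tx] := leP (euclidean_norm x) (t + rho); last first.
        have [-> _] := Hx tx; rewrite mul0r normr0 /F.
        by rewrite mulr_ge0// mulr_ge0 ?exprn_ge0// hpoly_ge0.
      rewrite normrM /F ler_wpM2l// !hpoly_cone ?expr0 ?mulr1; [|lra|lra].
      have xn0 : 0 <= euclidean_norm x by exact: sqrtr_ge0.
      rewrite ger0_norm ?exprn_ge0// -exprM.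
      exact: lerXn2r.
    by rewrite /inner fineK//; apply: integrable_fin_num => //; exact: L2_integrableM.
  rewrite ler_wpM2l ?exprn_ge0// -(momentE (fun t x => `|u t x|) _ t0).
  by rewrite /L le_max Hm ?orbT// in_itv/= t0.
have c_ge0 : 0 <= cc N * (b + 2 * N%:R).
  by rewrite mulr_ge0 ?(ltW (wave_coef_gt0 _ _ _))//; lra.
have cK : cc N * (b + 2 * N%:R) <= K.
  apply: (le_trans (HK N)); rewrite -[leRHS]mulr1 ler_wpM2l ?(ltW K0)//.
  rewrite -[leRHS](powRr0 N.+1%:R); apply: ler_powR; first by rewrite ler1n.
  by rewrite oppr_le0; case/andP: s01.
have pw : (t + a) `^ (- (b + 2 * N%:R + 2)) * (t + rho) ^+ (2 * N) <= th ^+ (2 * N).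
  have -> : - (b + 2 * N%:R + 2) = - (b + 2) + - (2 * N)%:R by rewrite natrM; ring.
  rewrite powRD; last by rewrite (gt_eqF ta0) implybT.
  rewrite powR_invn ?(ltW ta0)// -mulrA.
  apply: (@le_trans _ _ (((t + rho) / (t + a)) ^+ (2 * N))).
    rewrite expr_div_n [_ ^-1 * _]mulrC ler_piMl ?divr_ge0 ?exprn_ge0 ?(ltW ta0)//.
    rewrite -[leRHS](powRr0 (t + a)); apply: ler_powR; first exact: ltW.
    by rewrite oppr_le0; lra.
  have th0 : 0 <= th by case/andP: th01.
  apply: lerXn2r; rewrite ?nnegrE//; first by rewrite divr_ge0// ltW.
  rewrite /th ler_pdivrMr// mulrAC ler_pdivlMr// /a; nra.
have psi1 : psi r t <= 1 by exact: cutoff_le1.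
have psi0 : 0 <= psi r t by exact: cutoff_ge0.
have bN : 0 <= b + 2 * N%:R + 1 by lra.
rewrite normrM ger0_norm; last first.
  by rewrite (mulrA (cc N)) mulr_ge0 ?powR_ge0// mulr_ge0// mulr_ge0.
have -> : K * L * (b + 1 + 2 * N%:R) * th ^+ (2 * N) =
   K * (b + 2 * N%:R + 1) * 1 * (th ^+ (2 * N) * L) by ring.
apply: (@le_trans _ _ (cc N * (b + 2 * N%:R) * (b + 2 * N%:R + 1) * psi r t *
   ((t + a) `^ (- (b + 2 * N%:R + 2)) * (t + rho) ^+ (2 * N) * L))).
  rewrite (mulrA (cc N)) -[leLHS]mulrA ler_wpM2l//.
    by rewrite mulr_ge0// mulr_ge0.
  by rewrite -mulrA ler_wpM2l ?powR_ge0.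
apply: ler_pM.
- by rewrite mulr_ge0// mulr_ge0.
- by rewrite mulr_ge0// mulr_ge0 ?powR_ge0 ?exprn_ge0.
- apply: ler_pM => //; first by rewrite mulr_ge0.
  by rewrite ler_wpM2r.
- by rewrite ler_wpM2r.
Qed.

Let q : R := (1 - s) * (p / (p - 1)).

(** Young's inequality, applied at each x of the cone to |u| and to the kernel of
[kernel_bound].  The bound does not depend on the rank of truncation. *)
Lemma main_term_bound : exists2 C, 0 < C &
  forall r e N t, 1 <= r -> 0 < e -> r <= t <= 2 * r ->
  (`|\sum_(0 <= k < N) (cc k * (derive1 (derive1 (psi r)) t * (t + a) `^ (- (b + 2 * k%:R))
     - 2 * (b + 2 * k%:R) * derive1 (psi r) t * (t + a) `^ (- (b + 2 * k%:R + 1)))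
     * moment u (hpoly (2 * r + rho + 1) k) t)|%:E <=
  e%:E * ((psi r t)%:E * pmass p u t) +
  (C * e `^ (- (p - 1)^-1) * r `^ (- (b + 1 + s) * (p / (p - 1))))%:E * cone_integral n rho q t)%E.
Proof.
have rp := rho0; have pp := p1.
have [A A0 HA] := cutoff_derivatives p1 mp.
have [K K0 HK] := wave_series_bound n2 s01 bE b0.
have a1 : 1 <= a by rewrite /a; lra.
pose K1 := A * (b^-1 + 2) * K * (2 + a) `^ (1 - s).
have K10 : 0 < K1.
  apply: mulr_gt0; last by apply: powR_gt0; lra.
  apply: mulr_gt0 => //; apply: mulr_gt0 => //.
  by rewrite addr_gt0// invr_gt0.
exists (K1 `^ (p / (p - 1))); first exact: powR_gt0.
move=> r e N t r1 e0 rt.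
have [rt1 tr] := andP rt.
have r0 : 0 < r by lra.
have t0 : 0 <= t by lra.
have B0 : 0 <= 2 * r + rho + 1 by lra.
have t0r : 0 <= t <= 2 * r by rewrite t0.
have [HA1 HA2] := HA r t r1 t0r.
set W := psi r t `^ p^-1 in HA1 HA2.
have W0 : 0 <= W by exact: powR_ge0.
have psi0 : 0 <= psi r t by exact: cutoff_ge0.
pose c k := cc k * (derive1 (derive1 (psi r)) t * (t + a) `^ (- (b + 2 * k%:R))
     - 2 * (b + 2 * k%:R) * derive1 (psi r) t * (t + a) `^ (- (b + 2 * k%:R + 1))).
have lu := cu.1 t t0.
have lh k := L2_hpoly n k B0.
rewrite (_ : \sum_(0 <= k < N) _ = inner mu (u t) (fun x => \sum_(0 <= k < N) (c k * hpoly (2 * r + rho + 1) k x))); last first.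
  by rewrite (inner_sum N c lu lh); apply: eq_bigr => k _; rewrite momentE.
pose kap := (p - 1)^-1.
pose C2 := K1 `^ (p / (p - 1)) * e `^ (- kap) * r `^ (- (b + 1 + s) * (p / (p - 1))).
have C20 : 0 <= C2 by rewrite /C2 !mulr_ge0 ?powR_ge0.
pose F1 (x : V) : R := (e * psi r t) * `|u t x| `^ p.
pose F2 (x : V) : R := C2 * cone_weight rho q t x.
have mup := measurable_up p cu t0.
have mF1 : measurable_fun setT F1 by apply: measurable_funM.
have mF2 : measurable_fun setT F2.
  by apply: measurable_funM => //; exact: measurable_cone_weight.
have ep0 : 0 <= e * psi r t by rewrite mulr_ge0// ltW.
have F10 x : 0 <= F1 x by rewrite /F1 mulr_ge0// powR_ge0.
have F20 x : 0 <= F2 x by rewrite /F2 mulr_ge0// cone_weight_ge0.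
apply: (@le_trans _ _ (\int[mu]_x (F1 x + F2 x)%:E)%E); last first.
  rewrite (_ : (\int[mu]_x (F1 x + F2 x)%:E = \int[mu]_x ((F1 x)%:E + (F2 x)%:E))%E)//.
  rewrite ge0_integralD//; first last.
  - exact/measurable_EFinP.
  - by move=> x _; rewrite lee_fin.
  - exact/measurable_EFinP.
  - by move=> x _; rewrite lee_fin.
  rewrite leeD//.
    by rewrite muleA -EFinM -(pmassZ p cu t0 ep0).
  rewrite /cone_integral -ge0_integralZl_EFin//.
  - by move=> x _; rewrite lee_fin cone_weight_ge0.
  - by apply/measurable_EFinP; exact: measurable_cone_weight.
apply: inner_ae_le => //.
- exact: (L2_sum N c lh).
- by apply: measurable_funD.
- by move=> x; rewrite addr_ge0.
apply: filterS (cone_ae t0) => x Hx.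
have [xt|tx] := leP (euclidean_norm x) (t + rho); last first.
  by have [-> _] := Hx tx; rewrite mul0r normr0 addr_ge0.
have xn0 : 0 <= euclidean_norm x by exact: sqrtr_ge0.
have et : euclidean_norm x + 1 <= t + a by rewrite /a; lra.
rewrite normrM (eq_bigr (fun k => c k * (euclidean_norm x ^+ 2) ^+ k)); last first.
  by move=> k _; rewrite hpoly_cone//; lra.
have kb := kernel_bound b0 s01 n0 K0 A0 r1 rt a1 (HK N) HA1 HA2 W0 xn0 et.
apply: (le_trans (ler_wpM2l (normr_ge0 _) kb)).
rewrite -/K1.
set Fx := K1 * _ * _.
have Fx0 : 0 <= Fx.
  apply: mulr_ge0; last exact: powR_ge0.
  by apply: mulr_ge0; [exact: ltW|exact: powR_ge0].
apply: (le_trans (young_weighted p1 (normr_ge0 (u t x)) psi0 Fx0 e0)).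
apply: lerD => //.
rewrite /F2 /C2 /cone_weight xt /Fx.
rewrite (powRM _ (mulr_ge0 (ltW K10) (powR_ge0 _ _)) (powR_ge0 _ _)).
rewrite (powRM _ (ltW K10) (powR_ge0 _ _)) -!powRrM.
rewrite (_ : - (1 - s) * (p / (p - 1)) = - q); last by rewrite /q; ring.
by rewrite -/a -/kap le_eqVlt; apply/orP; left; apply/eqP; ring.
Qed.

(** The pairing of the initial data with the first term tau^(- b) of the test
function and with minus its time derivative. *)
Definition data_size : R := b * a `^ (- (b + 1)) * moment u (hpoly rho 0) 0
  + a `^ (- b) * moment v (hpoly rho 0) 0.

(** The rank N is chosen after r so that the last term of the truncated series
costs at most half of the contribution of the data.  Before time r the cut-off
is constant and the main term vanishes, hence the right-hand side only involves
[r, 2 r]. *)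
Lemma averaged_inequality : 0 < data_size -> exists2 C, 0 < C &
  forall r e t0, 1 <= r -> 0 < e -> 0 < t0 ->
  ((data_size / 2 + \int[leb]_(t in `[t0, (2 * r)%R]) (temporal r 0 t * g t))%:E <=
  \int[leb]_(t in `[r, (2 * r)%R]) (e%:E * ((psi r t)%:E * pmass p u t) +
  (C * e `^ (- (p - 1)^-1) * r `^ (- (b + 1 + s) * (p / (p - 1))))%:E * cone_integral n rho q t))%E.
Proof.
move=> ds0; have [C C0 HC] := main_term_bound.
exists C => // r e t0 r1 e0 t00.
have r0 : 0 < r by apply: lt_le_trans r1.
have ds4 : 0 < data_size / (4 * r) by rewrite divr_gt0// mulr_gt0.
have [N HN] := last_term_small r1 ds4.
have := sum_weak N r1 t00; have := initial_terms_le N r1; rewrite -/data_size.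
pose S t := \sum_(0 <= k < N.+1) (cc k * X r k t).
have [cS _] := time_integral_sum N.+1 cc 0 (2 * r) (fun k => @continuous_X r k r1).
set IY := \sum_(0 <= k < N.+1) _; set IX := Rintegral _ _ (fun t => \sum_(0 <= k < N.+1) _).
set I0 := Rintegral _ _ _.
(* subtracted as a constant density on [0, 2 r], the last term costs half of
   data_size in all *)
pose d := data_size / (4 * r).
have cd : continuous (fun _ : R => d) by exact: cst_continuous.
have cS' : continuous (fun t => S t - d) := continuousTB cS cd.
have EX : IX = \int[leb]_(t in `[0, 2 * r]) (S t - d) + d * (2 * r).
  have e1 := time_integralB 0 (2 * r) cS cd.
  have e2 : \int[leb]_(t in `[0, 2 * r]) (fun=> d) t = d * (2 * r).
    have lE : leb `[0, 2 * r]%classic = (2 * r)%:E.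
      by rewrite lebesgue_measure_itv/= lte_fin ifT ?mulr_gt0// -EFinB subr0.
    by rewrite Rintegral_cst//; congr (_ * _); rewrite -[RHS]/(fine (2 * r)%:E) -lE.
  by rewrite [X in _ = X + _]e1 e2 subrK.
rewrite EX => h1 h2.
have dr : d * (2 * r) = data_size / 2.
  by rewrite /d; field; rewrite gt_eqF.
have h3 : data_size / 2 + I0 <= \int[leb]_(t in `[0, 2 * r]) (S t - d).
  by move: h1 h2; rewrite dr; set I1 := Rintegral _ _ _; move: I0 I1 IY => z1 z2 z3; lra.
apply: (@le_trans _ _ (\int[leb]_(t in `[0, 2 * r]) (S t - d))%:E).
  by rewrite lee_fin.
have iS := integrable_continuous 0 (2 * r) cS'.
rewrite /Rintegral fineK; last exact: integrable_fin_num.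
rewrite integralE; apply: (@le_trans _ _ (\int[leb]_(t in `[0%R, (2 * r)%R]) ((EFin \o (fun t => (S t - d)%R))^\+ t))%E).
  by rewrite -[leRHS]sube0; apply: leeB => //; exact: integral_ge0.
rewrite integral_mkcond [leRHS]integral_mkcond; apply: ge0_le_integral_set => t _.
  by rewrite patchE; case: ifP.
have rhs0 : (0 <= e%:E * ((psi r t)%:E * pmass p u t) +
  (C * e `^ (- (p - 1)^-1) * r `^ (- (b + 1 + s) * (p / (p - 1))))%:E * cone_integral n rho q t)%E.
  apply: adde_ge0; apply: mule_ge0.
  - by rewrite lee_fin ltW.
  - by apply: mule_ge0; [rewrite lee_fin cutoff_ge0|exact: pmass_ge0].
  - by rewrite lee_fin mulr_ge0 ?powR_ge0// mulr_ge0 ?powR_ge0// ltW.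
  - by apply: integral_ge0 => x _; rewrite lee_fin cone_weight_ge0.
rewrite patchE; case: ifPn => [|_]; last by rewrite patchE; case: ifP.
rewrite inE/= in_itv/= => tr.
have := interior_terms_telescope N r1 tr; rewrite -/(S t) => St.
have := HN t tr; rewrite ler_norml => /andP[_ tailt].
set J := (X in S t = X + _) in St.
have SJ : S t - d <= J by rewrite St lerBlDr lerD2l.
rewrite funeposE patchE; case: ifPn => rt.
  rewrite ge_max rhs0 andbT.
  have rt' : r <= t <= 2 * r by move: rt; rewrite inE/= in_itv.
  apply: le_trans (HC r e N.+1 t r1 e0 rt').
  by rewrite lee_fin; apply: le_trans SJ _; exact: ler_norm.
have tltr : t < r.
  by move: rt; rewrite notin_setE/= in_itv/= (andP tr).2 andbT => /negP; rewrite -ltNge.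
have [d1 d2] := derive_cutoff1 m.+2 r0 tltr.
have J0 : J = 0.
  by apply: big1 => k _; rewrite d1 d2 !(mul0r, mulr0) subr0 !(mul0r, mulr0).
by rewrite ge_max lexx andbT lee_fin -J0.
Qed.

End fixed.
End truncated_test.

(** * Integrals of the weight of the light cone *)

Section cone_integrals.
Variables (R : realType) (n : nat) (rho q : R).
Local Notation V := 'rV[R]_n.
Local Notation mu := (lebesgue_rV R n).
Local Notation leb := (@lebesgue_measure R).
Hypothesis rho0 : 0 < rho.

Lemma measurable_cone_weight_pair :
  measurable_fun setT (fun z : measurableTypeR R * V => cone_weight rho q z.1 z.2).
Proof.
have m2 : measurable_fun setT (fun z : measurableTypeR R * V => euclidean_norm z.2).
  exact: (measurableT_comp (@measurable_euclidean_norm R n) measurable_snd).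
have m1 (c : R) : measurable_fun setT (fun z : measurableTypeR R * V => z.1 + c).
  by apply: measurable_funD => //; exact: measurable_fst.
apply: measurable_fun_ifT => //; first exact: measurable_fun_ler.
apply: (measurableT_comp (measurable_powR (- q))).
exact: (measurable_funB (m1 _) m2).
Qed.

Lemma measurable_cone_integral : measurable_fun setT (cone_integral n rho q : measurableTypeR R -> \bar R).
Proof.
have m2 : measurable_fun setT (fun z : measurableTypeR R * V => (cone_weight rho q z.1 z.2)%:E).
  by apply/measurable_EFinP; exact: measurable_cone_weight_pair.
by apply: (measurable_fun_fubini_tonelli_F _ m2) => z; rewrite lee_fin cone_weight_ge0.
Qed.

(** At a fixed x the weight is the power - q of an affine function of t, with
primitive P, on the times when x lies in the cone. *)
Lemma cone_weight_time_integral (P : R -> R) (L r : R) (x : V) : 1 <= r ->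
  (forall y : R, 0 < y -> is_derive y 1 P (y `^ (- q))) ->
  (forall y1 y2 : R, 1 <= y1 <= y2 -> y2 <= 2 * r + rho + 1 -> P y2 - P y1 <= L) ->
  0 <= L ->
  (\int[leb]_(t in `[r, (2 * r)%R]) (cone_weight rho q t x)%:E <= L%:E)%E.
Proof.
have rp := rho0; move=> r1 dP HP L0.
set e := euclidean_norm x; have e0 : 0 <= e by exact: sqrtr_ge0.
(* the time at which x enters the cone, if after r *)
pose t1 := Num.max r (e - rho).
have rt1 : r <= t1 by rewrite le_max lexx.
have et1 : e - rho <= t1 by rewrite le_max lexx orbT.
have [tr|rt] := ltP t1 (2 * r); last first.
  rewrite [leLHS](_ : _ = (\int[leb]_(t in [set (2 * r)%R]) (cone_weight rho q t x)%:E)%E).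
    by rewrite integral_set1 lee_fin.
  rewrite integral_mkcond [RHS]integral_mkcond; apply: eq_integral => t _.
  rewrite !patchE; case: ifPn => [|/negP]; rewrite inE/= in_itv/=.
    move=> /andP[h1 h2]; case: ifPn => //; rewrite notin_setE/= => /eqP t2.
    rewrite /cone_weight -/e ifF//; apply/negP => h3.
    have : t < 2 * r by rewrite lt_neqAle t2.
    have : t1 <= t by rewrite ge_max h1/=; lra.
    lra.
  move=> h; case: ifPn => //; rewrite inE/= => t2; exfalso; apply: h.
  by rewrite t2 lexx andbT; lra.
pose f (t : R) := (t + (rho + 1) - e) `^ (- q).
pose F (t : R) := P (1 * t + (rho + 1 - e)).
have dF t : t1 <= t -> is_derive t 1 F (f t).
  move=> tt; have y0 : 0 < 1 * t + (rho + 1 - e) by lra.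
  have := is_derive_affine (dP _ y0); rewrite mul1r /f.
  by rewrite mul1r addrA.
have cF t : t1 <= t -> {for t, continuous F}.
  by move=> /dF [d _]; apply: differentiable_continuous; apply/derivable1_diffP.
have cf : {within `[t1, 2 * r], continuous f}.
  apply: derivable_within_continuous => t; rewrite in_itv/= => /andP[tt _].
  have y0 : 0 < 1 * t + (rho + 1 - e) by lra.
  have [d _] := is_derive_affine (is_derive1_powR (- q) y0).
  rewrite (_ : f = fun z => (1 * z + (rho + 1 - e)) `^ (- q))//.
  by apply/funext => z; rewrite /f mul1r -addrA.
apply: (@le_trans _ _ (\int[leb]_(t in `[t1, (2 * r)%R]) (f t)%:E)%E).
  rewrite integral_mkcond [leRHS]integral_mkcond; apply: ge0_le_integral_set => t _.
    by rewrite patchE; case: ifP => // _; rewrite lee_fin cone_weight_ge0.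
  rewrite !patchE; have [tt|tt] := boolP (t1 <= t <= 2 * r).
    rewrite [X in (_ <= X)%E]ifT; last by rewrite inE/= in_itv.
    case: ifP => _; last by rewrite lee_fin powR_ge0.
    by rewrite lee_fin /cone_weight -/e; case: ifP => // _; exact: powR_ge0.
  rewrite [X in (_ <= X)%E]ifF; last by apply/negP; rewrite inE/= in_itv/=; exact/negP.
  case: ifP => //; rewrite inE/= in_itv/= => /andP[h1 h2].
  rewrite /cone_weight -/e ifF//; apply/negP => h3; move: tt; rewrite h2 andbT.
  by rewrite ge_max h1/= => /negP; apply; lra.
rewrite (@continuous_FTC2 _ _ F)//.
- rewrite -EFinB lee_fin; apply: HP; last lra.
  by apply/andP; split; lra.
- split.
  + by move=> t; rewrite in_itv/= => /andP[tt _]; have [] := dF t (ltW tt).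
  + by apply: cvg_at_right_filter; exact: cF.
  + by apply: cvg_at_left_filter; apply: cF; exact: ltW.
- move=> t; rewrite in_itv/= => /andP[tt _]; exact: (derive1_is_derive (dF t (ltW tt))).
Qed.

Lemma cone_weight_out t (x : V) (B : R) : t + rho <= B -> ~ box B x -> cone_weight rho q t x = 0.
Proof.
move=> tB /not_box[i xi]; rewrite /cone_weight ifF//; apply/negP => h.
have := le_trans (coord_le_norm x i) (le_trans h tB).
by rewrite leNgt xi.
Qed.

(** Integrating first in time gains one power of r over a crude bound of the weight,
and in space the cone is enclosed in a cube. *)
Lemma cone_integral_bound (P : R -> R) (L r : R) : 1 <= r ->
  (forall y : R, 0 < y -> is_derive y 1 P (y `^ (- q))) ->
  (forall y1 y2 : R, 1 <= y1 <= y2 -> y2 <= 2 * r + rho + 1 -> P y2 - P y1 <= L) ->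
  0 <= L ->
  (\int[leb]_(t in `[r, (2 * r)%R]) cone_integral n rho q t <= (L * (2 * (2 * r + rho)) ^+ n)%:E)%E.
Proof.
have rp := rho0; move=> r1 dP HP L0.
pose f (z : measurableTypeR R * V) : \bar R :=
  (if r <= z.1 <= 2 * r then (cone_weight rho q z.1 z.2) else 0)%:E.
have mf : measurable_fun setT f.
  apply/measurable_EFinP; apply: measurable_fun_ifT => //; last exact: measurable_cone_weight_pair.
  by apply: measurable_and; apply: measurable_fun_ler => //; exact: measurable_fst.
have f0 z : (0 <= f z)%E by rewrite /f lee_fin; case: ifP => // _; exact: cone_weight_ge0.
rewrite integral_mkcond.
rewrite [leLHS](_ : _ = \int[leb]_t \int[mu]_x f (t, x))%E; last first.
  apply: eq_integral => t _; rewrite patchE /f/=.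
  case: ifPn => [|/negP]; rewrite inE/= in_itv/= => tr; first by rewrite tr.
  by rewrite integral0_eq// => x _; rewrite ifF//; exact/negP.
rewrite (fubini_tonelli f mf f0).
apply: (@le_trans _ _ (\int[mu]_(x in box (2 * r + rho)) (cst L%:E x))%E).
  rewrite [leRHS]integral_mkcond; apply: ge0_le_integral_set => x _.
    by apply: integral_ge0 => t _.
  have E : (\int[leb]_t f (t, x) = \int[leb]_(t in `[r, (2 * r)%R]) (cone_weight rho q t x)%:E)%E.
    rewrite [RHS]integral_mkcond; apply: eq_integral => t _.
    rewrite patchE /f/= (_ : (t \in `[r, (2 * r)%R]%classic) = (r <= t <= 2 * r)).
      by case: (r <= t <= 2 * r).
    by apply/idP/idP; rewrite inE/= in_itv.
  rewrite E patchE; case: ifPn => [_|xB]; first exact: (cone_weight_time_integral x r1 dP HP L0).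
  rewrite integral0_eq// => t; rewrite /= in_itv/= => /andP[h1 h2].
  rewrite (@cone_weight_out t x (2 * r + rho))//; first by rewrite lerD2r.
  by move=> h; move/negP: xB; apply; rewrite inE.
rewrite integral_cst; last exact: measurable_box.
rewrite [X in (_ * X)%E]box_measure; last by lra.
by rewrite -EFinM.
Qed.

End cone_integrals.

Lemma cone_integral_log (R : realType) (n : nat) (rho r : R) : 0 < rho -> 1 <= r ->
  (\int[@lebesgue_measure R]_(t in `[r, (2 * r)%R]) cone_integral n rho 1 t <=
    (ln (2 * r + rho + 1) * (2 * (2 * r + rho)) ^+ n)%:E)%E.
Proof.
move=> rho0 r1; apply: (@cone_integral_bound R n rho 1 rho0 (@ln R)) => //.
- move=> y y0; rewrite powR_inv1 ?(ltW y0)//; exact: is_derive1_ln.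
- move=> y1 y2 /andP[h1 h2] h3.
  have l1 : 0 <= ln y1 by exact: ln_ge0.
  have l2 : ln y2 <= ln (2 * r + rho + 1) by rewrite ler_ln ?posrE//; lra.
  lra.
- by apply: ln_ge0; lra.
Qed.

Lemma cone_integral_power (R : realType) (n : nat) (rho r q : R) : 0 < rho -> 1 <= r -> 1 < q ->
  (\int[@lebesgue_measure R]_(t in `[r, (2 * r)%R]) cone_integral n rho q t <=
    ((q - 1)^-1 * (2 * (2 * r + rho)) ^+ n)%:E)%E.
Proof.
move=> rho0 r1 q1; have q0 : 0 < q - 1 by lra.
apply: (@cone_integral_bound R n rho q rho0 (fun y => - (q - 1)^-1 * y `^ (1 - q))) => //.
- move=> y y0; have d := is_deriveZ (- (q - 1)^-1) (is_derive1_powR (1 - q) y0).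
  apply: (is_derive_eq d).
  rewrite /GRing.scale/= mulrA (_ : - (q - 1)^-1 * (1 - q) = 1) ?mul1r; last by field; lra.
  by congr (_ `^ _); lra.
- move=> y1 y2 /andP[h1 h2] h3.
  have p1 : 0 <= (q - 1)^-1 * y2 `^ (1 - q) by rewrite mulr_ge0 ?powR_ge0// invr_ge0 ltW.
  have p2 : (q - 1)^-1 * y1 `^ (1 - q) <= (q - 1)^-1.
    rewrite ler_piMr ?invr_ge0 ?(ltW q0)//.
    by rewrite -[leRHS](powRr0 y1); apply: ler_powR => //; lra.
  lra.
- by rewrite invr_ge0 ltW.
Qed.

(** * The critical exponent and the growth argument *)

Lemma powR_negative_onto (R : realType) (q A d : R) : 0 < q -> 0 < A -> 0 < d ->
  exists2 e, 0 < e & A * e `^ (- q) = d.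
Proof.
move=> q0 A0 d0; exists ((d / A) `^ (- q^-1)); first exact/powR_gt0/divr_gt0.
rewrite -powRrM mulrNN mulVf ?gt_eqF// powRr1 ?divr_ge0 ?(ltW A0) ?(ltW d0)//.
by rewrite mulrCA divff ?mulr1// gt_eqF.
Qed.

(** By Bernoulli's inequality (1 + d)^(2 j) >= (1 + d j)^2, and a quadratic growth
is enough to beat a linear one. *)
Lemma linear_vs_geometric (R : realType) (S : nat -> R) (d C : R) (k0 : nat) :
  0 < d -> (forall k, (k0 <= k)%N -> 0 < S k) ->
  (forall k, (k0 <= k)%N -> (1 + d) * S k <= S k.+1) ->
  (forall k, (k0 <= k)%N -> S k <= C * k%:R) -> False.
Proof.
move=> d0 S0 SS SC.
have Sj j : (1 + d) ^+ j * S k0 <= S (k0 + j)%N.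
  elim: j => [|j IH]; first by rewrite expr0 mul1r addn0.
  rewrite addnS exprS -mulrA; apply: le_trans (SS _ (leq_addr _ _)).
  by rewrite ler_wpM2l//; lra.
have bern j : 1 + d * j%:R <= (1 + d) ^+ j.
  elim: j => [|j IH]; first by rewrite expr0 mulr0 addr0.
  rewrite exprS; apply: (@le_trans _ _ ((1 + d) * (1 + d * j%:R))).
    rewrite -natr1; have : 0 <= d * d * j%:R by rewrite !mulr_ge0// ltW.
    by nra.
  by rewrite ler_wpM2l//; lra.
have s0 := S0 k0 (leqnn _).
have H j : (1 + d * j%:R) ^+ 2 * S k0 <= C * (k0%:R + (2 * j)%:R).
  rewrite -natrD; apply: le_trans (SC _ (leq_addr _ _)).
  apply: le_trans (Sj (2 * j)%N); rewrite ler_wpM2r ?(ltW s0)//.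
  rewrite mulnC exprM; apply: lerXn2r; rewrite ?nnegrE//.
    by rewrite addr_ge0// mulr_ge0// ltW.
  by apply: le_trans (bern j); rewrite addr_ge0// mulr_ge0// ltW.
set s := S k0 in H s0; set k := k0%:R : R in H.
pose B := (`|C| * (k + 2) + 1) / (d ^+ 2 * s).
have k_0 : 0 <= k by exact: ler0n.
have B0 : 0 <= B by rewrite divr_ge0// ?mulr_ge0 ?exprn_ge0// ?addr_ge0// ?mulr_ge0// ?addr_ge0// ltW.
have := H (Num.trunc B).+1; have /andP[_] := trunc_itv B0.
set j := (Num.trunc B).+1 => Bj.
have j1 : 1 <= j%:R :> R by rewrite ler1n.
have : `|C| * (k + 2) + 1 < j%:R * (d ^+ 2 * s).
  by move: Bj; rewrite ltr_pdivrMr// mulr_gt0// exprn_gt0.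
move=> h1; apply/negP; rewrite -ltNge natrM.
have : C * (k + 2 * j%:R) <= `|C| * (k + 2) * j%:R.
  apply: (@le_trans _ _ (`|C| * (k + 2 * j%:R))).
    by rewrite ler_wpM2r ?ler_norm// addr_ge0// mulr_ge0.
  by rewrite -mulrA ler_wpM2l//; nra.
move/le_lt_trans; apply.
apply: (@lt_le_trans _ _ (j%:R * (d ^+ 2 * s) * j%:R)).
  by rewrite ltr_pM2r; lra.
have : 0 <= d * j%:R * s by rewrite !mulr_ge0// ltW.
by nra.
Qed.

(** The lower bound on M gives S k >= ka c k, so that for E large the last term of
the hypothesis is at most S k / 2, and S k <= 2 E M k.  The increments of S are
then proportional to S, while E = ka shows that S grows at most linearly. *)
Lemma critical_growth (R : realType) (S M : nat -> R) (ka c C q : R) :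
  0 < ka -> 0 < c -> 0 < C -> 0 < q -> 0 <= S 0%N ->
  (forall k, c <= M k) -> (forall k, S k + ka * M k <= S k.+1) ->
  (forall E k, 0 < E -> (1 <= k)%N ->
     S k + ka * M k <= E * M k + C * E `^ (- q) * k%:R) -> False.
Proof.
move=> ka0 c0 C0 q0 S0 cM SM H.
have Slow k : ka * c * k%:R <= S k.
  elim: k => [|k IH]; first by rewrite mulr0.
  apply: le_trans (SM k); rewrite -natr1 mulrDr mulr1 lerD//.
  by rewrite ler_wpM2l ?(ltW ka0).
have kc0 : 0 < ka * c by rewrite mulr_gt0.
have kc2 : 0 < ka * c / 2 by rewrite divr_gt0.
have [E E0 EE] := powR_negative_onto q0 C0 kc2.
have Spos k : (1 <= k)%N -> 0 < S k.
  by move=> k1; apply: lt_le_trans (Slow k); rewrite mulr_gt0// ltr0n.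
apply: (@linear_vs_geometric R S (ka / (2 * E)) (C * ka `^ (- q)) 1%N) => //.
- by rewrite divr_gt0// mulr_gt0.
- move=> k k1; have := H E k E0 k1; rewrite EE => h.
  have Mk : 0 <= ka * M k by rewrite mulr_ge0 ?(ltW ka0)// (le_trans _ (cM k))// ltW.
  have h2 : S k <= 2 * E * M k by have := Slow k; lra.
  apply: le_trans (SM k); rewrite mulrDl mul1r lerD2l.
  rewrite mulrAC -mulrA ler_pM2l// ler_pdivrMr ?mulr_gt0//; lra.
- by move=> k k1; have := H ka k ka0 k1; lra.
Qed.

Section critical_exponent.
Variables (R : realType) (n : nat) (p : R).
Hypothesis n2 : (2 <= n)%N.
Hypothesis p0 : 0 < p.
Hypothesis pc : (n%:R - 1) * p ^+ 2 - (n%:R + 1) * p - 2 = 0.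

Lemma critical_gt1 : 1 < p.
Proof.
have n2' : 2 <= n%:R :> R by rewrite ler_nat.
rewrite ltNge; apply/negP => p1; have p0' := p0; have pc' := pc.
have h : 0 <= (n%:R - 1) * (p * (1 - p)) by apply: mulr_ge0; [|apply: mulr_ge0]; lra.
by move: n2' pc' h; move: (n%:R) => N N2 e h; lra.
Qed.

(** The exponent of growth in r of the integral of |u|^p over r < t < 2 r. *)
Definition mass_power : R := (n%:R - 1) / 2 - p^-1.

Lemma mass_power_gt0 : 0 < mass_power.
Proof.
have n2' : 2 <= n%:R :> R by rewrite ler_nat.
have p0' := p0; have pc' := pc.
rewrite /mass_power subr_gt0 -[p^-1]mul1r ltr_pdivrMr// ltNge; apply/negP => h.
have h2 : 0 <= p * (1 - (n%:R - 1) / 2 * p) by apply: mulr_ge0; lra.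
have h3 : 0 < (n%:R - 1) * p by apply: mulr_gt0; lra.
by move: n2' pc' h2 h3; move: (n%:R) => N N2 e h2 h3; lra.
Qed.

Let nE : n%:R = (p ^+ 2 + p + 2) / (p * (p - 1)).
Proof.
have p1 := critical_gt1; have p0' := p0; have pc' := pc.
have d0 : p * (p - 1) != 0 by rewrite gt_eqF// mulr_gt0//; lra.
by apply: (mulIf d0); rewrite divfK//; move: pc'; move: (n%:R) => N e; lra.
Qed.

(** The power of r that is left in the averaged inequality with s = 0 and
e = E r^(- mass_power) is 0. *)
Lemma free_wave_balance :
  - mass_power * - (p - 1)^-1 + - ((n%:R - 1) / 2 + 1) * (p / (p - 1)) + n%:R = 0.
Proof.
have p1 := critical_gt1; have p0' := p0.
by rewrite /mass_power nE; field; lra.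
Qed.

(** The same cancellation for s = 1 / p.  Each of the two identities is equivalent
to the quadratic equation of the critical exponent. *)
Lemma critical_balance :
  - mass_power * - (p - 1)^-1 + - (mass_power + 1 + p^-1) * (p / (p - 1)) + n%:R = 0.
Proof.
have p1 := critical_gt1; have p0' := p0.
by rewrite /mass_power nE; field; lra.
Qed.

End critical_exponent.

(** * The averaged inequality between real numbers *)

(** If the pairing vanished, f would vanish almost everywhere on the ball where the
cut-off is 1. *)
Lemma inner_hpoly_gt0 (R : realType) (n : nat) (rho : R) (f : 'rV[R]_n -> R) :
  0 < rho -> L2 f -> {ae lebesgue_rV R n, forall x, 0 <= f x} ->
  {ae lebesgue_rV R n, forall x, rho < euclidean_norm x -> f x = 0} ->
  ~ {ae lebesgue_rV R n, forall x, f x = 0} ->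
  0 < inner (lebesgue_rV R n) f (hpoly rho 0).
Proof.
move=> r0 lf f0 fs nf.
have h0 (x : 'rV[R]_n) : 0 <= hpoly rho 0 x by rewrite /hpoly expr0 mul1r chi_ge0.
have lh := L2_hpoly n 0 (ltW r0).
rewrite lt_neqAle inner_ge0// andbT; apply/negP => /eqP e; apply: nf.
have i := L2_integrableM lf lh.
have mi := measurable_int _ i.
have : (\int[lebesgue_rV R n]_x `|(f x * hpoly rho 0 x)%:E| = 0)%E.
  transitivity (\int[lebesgue_rV R n]_x (f x * hpoly rho 0 x)%:E)%E.
    apply: ae_eq_integral => //.
      exact: (measurableT_comp _ mi).
    apply: filterS f0 => x fx _; rewrite gee0_abs// lee_fin mulr_ge0//.
  rewrite -(fineK (integrable_fin_num measurableT i)); congr EFin.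
  exact: esym e.
move/(ae_eq_integral_abs _ measurableT mi).1 => h.
apply: filterS2 fs h => x xs /(_ I)/=.
have [xr|/xs//] := leP (euclidean_norm x) rho.
by rewrite /hpoly expr0 mul1r chi_cone// mulr1 => -[].
Qed.

Section mass_integrals.
Variables (R : realType) (n : nat) (p rho : R).
Local Notation V := 'rV[R]_n.
Local Notation mu := (lebesgue_rV R n).
Local Notation leb := (@lebesgue_measure R).
Variables (u v : R -> V -> R).
Hypothesis n2 : (2 <= n)%N.
Hypothesis p1 : 1 < p.
Hypothesis rho0 : 0 < rho.
Hypothesis cu : L2_continuous mu u.
Hypothesis cv : L2_continuous mu v.
Hypothesis hut : is_time_derivative +oo%E u v.
Hypothesis heq : wave_equation +oo%E p u.
Hypothesis hsupp : support_in_cone +oo%E rho u v.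
Hypothesis u0_ge0 : {ae mu, forall x, 0 <= u 0 x}.
Hypothesis v0_ge0 : {ae mu, forall x, 0 <= v 0 x}.

Let p0 : 0 < p. Proof. by apply: lt_trans p1. Qed.
Local Notation g t := (fine (pmass p u t)).

Lemma mass_ge0 t : 0 <= g t.
Proof. by rewrite fine_ge0// pmass_ge0. Qed.

Lemma weight_le (c d : R) (F : R -> R) t : 0 < c -> (forall t, 0 <= t -> 0 <= F t <= 1) ->
  `[c, d]%classic t -> 0 <= F t <= 1.
Proof. by move=> c0 F01; rewrite /= in_itv/= => /andP[ct _]; apply: F01; lra. Qed.

Lemma measurable_mass (c d : R) (F : R -> R) : 0 < c -> continuous F ->
  measurable_fun `[c, d] (fun t => F t * g t).
Proof.
move=> c0 cF; have mg := measurable_int _ (integrable_pmass p0 cu heq hsupp d c0).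
apply: measurable_funM.
  by apply: measurable_funTS; exact: continuous_measurable_fun.
exact: (measurableT_comp (fine_measurable measurableT) mg).
Qed.

Lemma integrable_mass (c d : R) (F : R -> R) : 0 < c -> continuous F ->
  (forall t, 0 <= t -> 0 <= F t <= 1) ->
  leb.-integrable `[c, d] (EFin \o (fun t => F t * g t)).
Proof.
move=> c0 cF F01; have ig := integrable_pmass p0 cu heq hsupp d c0.
apply: (le_integrable _ _ _ ig) => //.
  by apply/measurable_EFinP; exact: measurable_mass.
move=> t /(weight_le c0 F01) /andP[F0 F1] /=.
rewrite ger0_norm ?mulr_ge0 ?mass_ge0// gee0_abs ?pmass_ge0//.
apply: (@le_trans _ _ (g t)%:E); first by rewrite lee_fin ler_piMl ?mass_ge0.
have := pmass_ge0 p u t; by case: (pmass p u t) => [z| |]//=; rewrite leey.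
Qed.

(** The integral of |u|^p in space may be infinite at some times, but only at
almost none. *)
Lemma mass_ereal (c d : R) (F : R -> R) : 0 < c -> continuous F ->
  (forall t, 0 <= t -> 0 <= F t <= 1) ->
  (\int[leb]_(t in `[c, d]) ((F t)%:E * pmass p u t) =
   (\int[leb]_(t in `[c, d]) (F t * g t))%:E)%E.
Proof.
move=> c0 cF F01; have ig := integrable_pmass p0 cu heq hsupp d c0.
have iF := integrable_mass d c0 cF F01.
rewrite /Rintegral fineK; last exact: integrable_fin_num.
apply: ge0_ae_eq_integral => //.
- apply: emeasurable_funM; last exact: measurable_int ig.
  by apply/measurable_EFinP/measurable_funTS; exact: continuous_measurable_fun.
- exact: measurable_int iF.
- by move=> t /(weight_le c0 F01)/andP[F0 _]; rewrite mule_ge0 ?pmass_ge0// lee_fin.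
- by move=> t /(weight_le c0 F01)/andP[F0 _]; rewrite lee_fin mulr_ge0 ?mass_ge0.
apply: filterS (integrable_ae _ ig) => // t + tcd => /(_ tcd) ft.
by rewrite EFinM fineK.
Qed.

Lemma averaged_inequality_real s b m : 0 <= s < 1 -> b = (n%:R - 1) / 2 - s -> 0 < b ->
  2 <= m.+2%:R * (1 - p^-1) -> 0 < data_size rho u v b ->
  exists2 C, 0 < C & forall r e Z : R, 1 <= r -> 0 < e ->
  (\int[leb]_(t in `[r, (2 * r)%R]) cone_integral n rho ((1 - s) * (p / (p - 1))) t <= Z%:E)%E ->
  data_size rho u v b / 2 +
    \int[leb]_(t in `[1, 2 * r]) (temporal rho b m r 0 t * g t) <=
  e * \int[leb]_(t in `[r, 2 * r]) (cutoff r m.+2 t * g t) +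
  C * e `^ (- (p - 1)^-1) * r `^ (- (b + 1 + s) * (p / (p - 1))) * Z.
Proof.
move=> s01 bE b0 mp ds.
have [C C0 H] := averaged_inequality n2 p1 rho0 cu cv hut heq hsupp u0_ge0 v0_ge0 s01 bE b0 mp ds.
exists C => // r e Z r1 e0 HZ.
have r0 : 0 < r by lra.
rewrite -lee_fin; apply: le_trans (H r e 1 r1 e0 ltr01) _.
set K := C * _ * _; have K0 : 0 <= K by rewrite mulr_ge0 ?powR_ge0// mulr_ge0 ?powR_ge0// ltW.
clearbody K.
have cpsi : continuous (cutoff r m.+2) by exact: smooth1_continuous (smooth1_cutoff r m.+2).
have mg : measurable_fun `[r, (2 * r)%R] (pmass p u).
  exact: (measurable_int _ (integrable_pmass p0 cu heq hsupp (2 * r) r0)).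
have mpsi : measurable_fun `[r, (2 * r)%R] (fun t => ((cutoff r m.+2 t)%:E * pmass p u t)%E).
  apply: emeasurable_funM => //; apply/measurable_EFinP.
  by apply: measurable_funTS; exact: continuous_measurable_fun.
have mZ := measurable_cone_integral n rho ((1 - s) * (p / (p - 1))).
rewrite ge0_integralD//.
- rewrite ge0_integralZl_EFin//; last 2 first.
  + by move=> t _; rewrite mule_ge0 ?pmass_ge0// lee_fin cutoff_ge0.
  + exact: ltW.
  rewrite ge0_integralZl_EFin//; last 2 first.
  + by move=> t _; apply: integral_ge0 => x _; rewrite lee_fin cone_weight_ge0.
  + exact: measurable_funTS.
  rewrite (mass_ereal _ r0 cpsi) => [|t _]; last by rewrite cutoff_ge0 cutoff_le1.
  rewrite -EFinM EFinD; apply: leeD => //.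
  by rewrite EFinM; apply: lee_wpmul2l; rewrite ?lee_fin.
- move=> t _; rewrite mule_ge0 ?lee_fin ?(ltW e0)//.
  by rewrite mule_ge0 ?pmass_ge0// lee_fin cutoff_ge0.
- exact: emeasurable_funM.
- move=> t _; rewrite mule_ge0 ?lee_fin//.
  by apply: integral_ge0 => x _; rewrite lee_fin cone_weight_ge0.
- by apply: emeasurable_funM => //; exact: measurable_funTS.
Qed.

End mass_integrals.

(** * Blow-up *)

(** The choice e = E r^(- b) in the averaged inequality, when the powers of r
balance. *)
Lemma scale_cancel (R : realType) (n : nat) (E r b q X C D : R) : 0 < E -> 0 < r ->
  - b * - q + X + n%:R = 0 ->
  C * (E * r `^ (- b)) `^ (- q) * r `^ X * (D * r ^+ n) = C * D * E `^ (- q).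
Proof.
move=> E0 r0 e; have Er := ltW E0.
rewrite powRM ?powR_ge0// -powRrM -(powR_mulrn n (ltW r0)).
have -> : C * (E `^ (- q) * r `^ (- b * - q)) * r `^ X * (D * r `^ n%:R) =
    C * D * E `^ (- q) * (r `^ (- b * - q) * r `^ X * r `^ n%:R) by ring.
have rn : r != 0 by rewrite gt_eqF.
by rewrite -!powRD ?rn ?implybT// e powRr0 mulr1.
Qed.

Section blow_up.
Variables (R : realType) (n : nat) (p rho : R).
Local Notation V := 'rV[R]_n.
Local Notation mu := (lebesgue_rV R n).
Local Notation leb := (@lebesgue_measure R).
Variables (u v : R -> V -> R).
Hypothesis n2 : (2 <= n)%N.
Hypothesis p0 : 0 < p.
Hypothesis pc : (n%:R - 1) * p ^+ 2 - (n%:R + 1) * p - 2 = 0.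
Hypothesis rho0 : 0 < rho.
Hypothesis cu : L2_continuous mu u.
Hypothesis cv : L2_continuous mu v.
Hypothesis hut : is_time_derivative +oo%E u v.
Hypothesis heq : wave_equation +oo%E p u.
Hypothesis hsupp : support_in_cone +oo%E rho u v.
Hypothesis u0_ge0 : {ae mu, forall x, 0 <= u 0 x}.
Hypothesis v0_ge0 : {ae mu, forall x, 0 <= v 0 x}.
Hypothesis data_neq0 : ~ {ae mu, forall x, u 0 x = 0} \/ ~ {ae mu, forall x, v 0 x = 0}.

Let p1 : 1 < p. Proof. exact: critical_gt1 n2 p0 pc. Qed.
Local Notation g t := (fine (pmass p u t)).
Local Notation be := (mass_power n p).
Let be0 : 0 < be. Proof. exact: mass_power_gt0 n2 p0 pc. Qed.

Lemma data_size_gt0 b : 0 < b -> 0 < data_size rho u v b.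
Proof.
have rp := rho0; move=> b0; rewrite /data_size !momentE//.
have a0 : 0 < rho + 1 by lra.
have [lu lv] := (cu.1 0 (lexx _), cv.1 0 (lexx _)).
have cone : {ae mu, forall x, rho < euclidean_norm x -> u 0 x = 0 /\ v 0 x = 0}.
  by have := cone_ae hsupp (lexx 0); rewrite add0r.
have su : {ae mu, forall x, rho < euclidean_norm x -> u 0 x = 0}.
  by apply: filterS cone => x H /H[].
have sv : {ae mu, forall x, rho < euclidean_norm x -> v 0 x = 0}.
  by apply: filterS cone => x H /H[].
have h0 (x : V) : 0 <= hpoly rho 0 x by exact: hpoly_ge0.
have lh := L2_hpoly n 0 (ltW rho0).
have Iu : 0 <= inner mu (u 0) (hpoly rho 0) by exact: inner_ge0.
have Iv : 0 <= inner mu (v 0) (hpoly rho 0) by exact: inner_ge0.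
have [nu|nv] := data_neq0.
- apply: ltr_pwDl; last by rewrite mulr_ge0 ?powR_ge0.
  by rewrite !mulr_gt0 ?powR_gt0//; exact: inner_hpoly_gt0.
- apply: ltr_wpDl; first by rewrite mulr_ge0 ?mulr_ge0 ?powR_ge0 ?(ltW b0).
  by rewrite mulr_gt0 ?powR_gt0//; exact: inner_hpoly_gt0.
Qed.

(* the cut-off is raised to the power m + 2, which must be at least 2 p / (p - 1) *)
Let m : nat := Num.trunc (2 / (1 - p^-1)).
Let mp : 2 <= m.+2%:R * (1 - p^-1).
Proof.
have q0 : 0 < 1 - p^-1 by rewrite subr_gt0 invf_lt1.
rewrite -ler_pdivrMr//.
have B0 : 0 <= 2 / (1 - p^-1) by rewrite divr_ge0// ltW.
have /andP[_ /ltW h] := trunc_itv B0.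
by apply: le_trans h _; rewrite ler_nat.
Qed.

Local Notation psi r := (cutoff r m.+2).
Definition dyadic_mass (r : R) : R := \int[leb]_(t in `[r, 2 * r]) (psi r t * g t).
Local Notation K := dyadic_mass.
Local Notation box_const := ((2 * (2 + rho)) ^+ n : R).

Lemma box_scale r : 1 <= r -> (2 * (2 * r + rho)) ^+ n <= box_const * r ^+ n.
Proof.
have rp := rho0; move=> r1; rewrite -exprMn; apply: lerXn2r; rewrite ?nnegrE.
- by lra.
- by rewrite !mulr_ge0//; lra.
- by have := ler_peMr (ltW rp) r1; lra.
Qed.

Let box_const_gt0 : 0 < box_const.
Proof. by have rp := rho0; rewrite exprn_gt0// mulr_gt0//; lra. Qed.

Lemma temporal01 r b t : 0 <= b -> 0 <= t -> 0 <= temporal rho b m r 0 t <= 1.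
Proof.
have rp := rho0; move=> b0 t0; rewrite temporalE// mulr0 addr0.
have ta : 1 <= t + (rho + 1) by lra.
rewrite mulr_ge0 ?cutoff_ge0 ?powR_ge0//= -[leRHS]mulr1 ler_pM ?cutoff_ge0 ?powR_ge0 ?cutoff_le1//.
by rewrite -[leRHS](powRr0 (t + (rho + 1))); apply: ler_powR => //; rewrite oppr_le0.
Qed.

(** The averaged inequality with s = 0, whose left-hand side is at least d / 2.
The parameter E is chosen such that the last term is d / 4. *)
Lemma dyadic_mass_ge : exists2 c, 0 < c & forall r, 1 <= r -> c <= r `^ (- be) * K r.
Proof.
have rp := rho0; have p1' := p1; have b0' := be0.
pose b : R := (n%:R - 1) / 2.
have b0 : 0 < b by have := n2; rewrite -(ler_nat R) /b; lra.
have s01 : 0 <= (0 : R) < 1 by apply/andP; split; [exact: lexx|exact: ltr01].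
have bE : b = (n%:R - 1) / 2 - 0 by rewrite subr0.
have ds := data_size_gt0 b0.
have [C C0 H] := averaged_inequality_real n2 p1 rho0 cu cv hut heq hsupp u0_ge0 v0_ge0 s01 bE b0 mp ds.
set d := data_size _ _ _ _ in ds H.
have q0 : 0 < (p - 1)^-1 by rewrite invr_gt0; lra.
have A0 : 0 < C * ((p - 1) * box_const) by rewrite !mulr_gt0//; lra.
have d4 : 0 < d / 4 by lra.
have [E E0 EE] := powR_negative_onto q0 A0 d4.
exists (d / 4 / E); first by rewrite divr_gt0.
move=> r r1; have r0 : 0 < r by lra.
have e0 : 0 < E * r `^ (- be) by rewrite mulr_gt0 ?powR_gt0.
have qq : (1 - 0) * (p / (p - 1)) - 1 = (p - 1)^-1 by field; lra.
have q1 : 1 < (1 - 0) * (p / (p - 1)) by rewrite -subr_gt0 qq.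
have := cone_integral_power n rho0 r1 q1; rewrite qq invrK => ZB.
have pm : 0 <= p - 1 by lra.
have ZB' : (\int[leb]_(t in `[r, (2 * r)%R]) cone_integral n rho ((1 - 0) * (p / (p - 1))) t <=
    ((p - 1) * box_const * r ^+ n)%:E)%E.
  by apply: le_trans ZB _; rewrite lee_fin -mulrA ler_wpM2l// box_scale.
have := H r _ _ r1 e0 ZB'.
have -> : b + 1 + 0 = (n%:R - 1) / 2 + 1 by rewrite addr0.
rewrite (scale_cancel _ _ E0 r0 (free_wave_balance n2 p0 pc)) EE.
have I0 : 0 <= \int[leb]_(t in `[1, 2 * r]) (temporal rho b m r 0 t * g t).
  apply: Rintegral_ge0 => t; rewrite /= in_itv/= => /andP[t1 _].
  have t0 : 0 <= t by lra.
  by have /andP[h _] := temporal01 r (ltW b0) t0; rewrite mulr_ge0 ?mass_ge0.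
rewrite -/(K r) => h; rewrite ler_pdivrMr//.
move: h I0; move: (Rintegral _ _ _) (K r) (r `^ (- be)) => I1 k z h I0; lra.
Qed.

(** The averaged inequality with s = 1 / p, for which the weight of the cone has
exponent 1 and its integral a logarithm. *)
Lemma critical_inequality : exists2 C, 0 < C & forall r E, 1 <= r -> 0 < E ->
  \int[leb]_(t in `[1, 2 * r]) (temporal rho be m r 0 t * g t) <=
  E * (r `^ (- be) * K r) + C * E `^ (- (p - 1)^-1) * ln (2 * r + rho + 1).
Proof.
have rp := rho0; have p1' := p1; have b0' := be0.
have s01 : 0 <= p^-1 < 1 by rewrite invr_ge0 ltW//= invf_lt1.
have ds := data_size_gt0 be0.
have [C C0 H] := averaged_inequality_real n2 p1 rho0 cu cv hut heq hsupp u0_ge0 v0_ge0 s01 (erefl be) be0 mp ds.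
set d := data_size _ _ _ _ in ds H.
exists (C * box_const); first by rewrite mulr_gt0.
move=> r E r1 E0; have r0 : 0 < r by lra.
have e0 : 0 < E * r `^ (- be) by rewrite mulr_gt0 ?powR_gt0.
have qq : (1 - p^-1) * (p / (p - 1)) = 1 by field; lra.
have l0 : 0 <= ln (2 * r + rho + 1) by apply: ln_ge0; lra.
have ZB' : (\int[leb]_(t in `[r, (2 * r)%R]) cone_integral n rho ((1 - p^-1) * (p / (p - 1))) t <=
    (ln (2 * r + rho + 1) * box_const * r ^+ n)%:E)%E.
  rewrite qq; apply: le_trans (cone_integral_log n rho0 r1) _.
  by rewrite lee_fin -mulrA ler_wpM2l// box_scale.
have := H r _ _ r1 e0 ZB'.
rewrite (scale_cancel _ _ E0 r0 (critical_balance n2 p0 pc)) -/(K r).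
move: l0 ds; move: (Rintegral _ _ _) (K r) (r `^ (- be)) (ln _) (E `^ _) (box_const) => I1 k z l y D l0 ds h.
have -> : C * D * y * l = C * (l * D) * y by ring.
lra.
Qed.

Lemma mass_split (F : R -> R) r : 1 <= r -> continuous F ->
  (forall t, 0 <= t -> 0 <= F t <= 1) ->
  \int[leb]_(t in `[1, 2 * r]) (F t * g t) =
  \int[leb]_(t in `[1, r]) (F t * g t) + \int[leb]_(t in `[r, 2 * r]) (F t * g t).
Proof.
move=> r1 cF F01; have r0 : 0 < r by lra.
have i1 := integrable_mass p1 cu heq hsupp (2 * r) ltr01 cF F01.
have i2 := integrable_mass p1 cu heq hsupp (2 * r) r0 cF F01.
have := Rintegral_itvB i1 (x := r).
rewrite !bnd_simp => /(_ r1) h.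
have r2 : r <= 2 * r by lra.
have i3 : leb.-integrable `]r, 2 * r] (EFin \o (fun t => F t * g t)).
  by apply: integrableS i2 => //; apply: subset_itvr; rewrite bnd_simp.
by rewrite -(Rintegral_itv_obnd_cbnd i3) -(h r2) addrC subrK.
Qed.

Local Notation ka := ((rho + 3) `^ (- be)).

(** On [r, 2 r] one has t + rho + 1 <= (rho + 3) r, whence the constant ka. *)
Lemma dyadic_mass_le_weighted (F : R -> R) r : 1 <= r -> continuous F ->
  (forall t, 0 <= t -> 0 <= F t <= 1) ->
  (forall t, r <= t <= 2 * r -> psi r t * (t + (rho + 1)) `^ (- be) <= F t) ->
  ka * (r `^ (- be) * K r) <= \int[leb]_(t in `[r, 2 * r]) (F t * g t).
Proof.
have rp := rho0; have b0' := be0.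
move=> r1 cF F01 H; have r0 : 0 < r by lra.
have cpsi : continuous (psi r) by exact: smooth1_continuous (smooth1_cutoff r m.+2).
have psi01 t : 0 <= t -> 0 <= psi r t <= 1 by move=> _; rewrite cutoff_ge0 cutoff_le1.
have i1 := integrable_mass p1 cu heq hsupp (2 * r) r0 cpsi psi01.
have i2 := integrable_mass p1 cu heq hsupp (2 * r) r0 cF F01.
rewrite mulrA /dyadic_mass -RintegralZl//.
apply: le_Rintegral => //.
  exact: (integrableZl _ _ i1).
move=> t; rewrite /= in_itv/= => /andP[rt tr].
have rt2 : r <= t <= 2 * r by rewrite rt tr.
rewrite mulrA; apply: ler_wpM2r; first exact: mass_ge0.
apply: le_trans (H t rt2); rewrite mulrC; apply: ler_wpM2l; first exact: cutoff_ge0.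
rewrite -powRM; [|lra|lra].
have ta : 0 < t + (rho + 1) by lra.
have ra : 0 < (rho + 3) * r by rewrite mulr_gt0//; lra.
rewrite !powRN lef_pV2 ?posrE ?powR_gt0//.
apply: ge0_ler_powR; rewrite ?nnegrE ?(ltW be0) ?(ltW ta) ?(ltW ra)//.
have : rho <= rho * r by rewrite ler_peMr ?(ltW rp).
lra.
Qed.

(** The integrals over [1, 2^k] and [2^k, 2^(k + 1)] are those of [critical_growth]. *)
Lemma blow_up : False.
Proof.
have rp := rho0; have p1' := p1; have b0' := be0.
have [c c0 Hc] := dyadic_mass_ge.
have [C C0 HC] := critical_inequality.
pose w : R -> R := tpow (rho + 1) be.
have cw : continuous w by exact: smooth1_continuous (smooth1_tpow _ _).
have wE t : 0 <= t -> w t = (t + (rho + 1)) `^ (- be).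
  by move=> t0; rewrite /w tpowE//; lra.
have w01 t : 0 <= t -> 0 <= w t <= 1.
  move=> t0; rewrite wE// powR_ge0/=.
  by rewrite -[leRHS](powRr0 (t + (rho + 1))); apply: ler_powR; lra.
pose S k : R := \int[leb]_(t in `[1, 2 ^+ k]) (w t * g t).
pose M k : R := (2 ^+ k) `^ (- be) * K (2 ^+ k).
have tk1 k : 1 <= 2 ^+ k :> R by rewrite exprn_ege1// ler1n.
pose L : R := ln 2 + ln (rho + 3).
have L2 : 0 < ln 2 :> R by rewrite ln_gt0// ltr1n.
have L3 : 0 < ln (rho + 3) by rewrite ln_gt0//; lra.
have q0 : 0 < (p - 1)^-1 by rewrite invr_gt0; lra.
have CL : 0 < C * L by rewrite mulr_gt0// /L; lra.
apply: (@critical_growth R S M ka c (C * L) (p - 1)^-1) => //.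
- by apply: powR_gt0; lra.
- apply: Rintegral_ge0 => t; rewrite /= in_itv/= => /andP[t1 _].
  have t0 : 0 <= t by lra.
  by have /andP[h _] := w01 t t0; rewrite mulr_ge0 ?mass_ge0.
- by move=> k; apply: Hc; exact: tk1.
- move=> k; rewrite /S exprS (mass_split (tk1 k) cw w01) lerD2l.
  apply: (dyadic_mass_le_weighted (tk1 k) cw w01) => t /andP[kt _].
  have t0 : 0 <= t by apply: le_trans kt; apply: le_trans (tk1 k).
  by rewrite wE// ler_piMl ?powR_ge0 ?cutoff_le1.
move=> E k E0 k1; set r : R := 2 ^+ k.
have r1 : 1 <= r := tk1 k; have r0 : 0 < r by lra.
have cT : continuous (temporal rho be m r 0) by exact: smooth1_continuous (smooth1_temporal _ _ _ _ _).
have T01 t : 0 <= t -> 0 <= temporal rho be m r 0 t <= 1 by exact: temporal01 (ltW be0).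
have TE t : 0 <= t -> temporal rho be m r 0 t = psi r t * (t + (rho + 1)) `^ (- be).
  by move=> t0; rewrite temporalE// mulr0 addr0.
have := HC r E r1 E0; rewrite (mass_split r1 cT T01).
have -> : \int[leb]_(t in `[1, r]) (temporal rho be m r 0 t * g t) = S k.
  apply: eq_Rintegral => t; rewrite inE/= in_itv/= => /andP[t1 tr].
  have t0 : 0 <= t by lra.
  by rewrite TE// cutoff1// mul1r wE.
have low : ka * M k <= \int[leb]_(t in `[r, 2 * r]) (temporal rho be m r 0 t * g t).
  by apply: (dyadic_mass_le_weighted r1 cT T01) => t /andP[rt _]; rewrite TE//; lra.
have lnr : ln (2 * r + rho + 1) <= L * k%:R.
  have r3 : 2 * r + rho + 1 <= (rho + 3) * r.
    have : rho <= rho * r by rewrite ler_peMr ?(ltW rp).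
    lra.
  have pr : 0 < 2 * r + rho + 1 by lra.
  have p3 : 0 < rho + 3 by lra.
  have lr : ln r = ln 2 * k%:R by rewrite /r lnXn// mulr_natr.
  apply: (@le_trans _ _ (ln ((rho + 3) * r))); first by rewrite ler_ln ?posrE ?mulr_gt0.
  rewrite lnM ?posrE// lr /L mulrDl addrC lerD2l ler_peMr ?(ltW L3)//.
  by rewrite ler1n.
have := ler_wpM2l (mulr_ge0 (ltW C0) (powR_ge0 E (- (p - 1)^-1))) lnr.
rewrite -/(M k); move: low; move: (Rintegral _ _ _) (S k) (M k) (ln _) (E `^ _) => I1 s z l y low.
have -> : C * L * y * k%:R = C * y * (L * k%:R) by ring.
lra.
Qed.

End blow_up.

Theorem theorem1p1 (R : realType) (n : nat) (p rho : R)
    (u0 u1 : 'rV[R]_n -> R) (T : \bar R) (u ut : R -> 'rV[R]_n -> R)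
    (hn : (2 <= n)%N)
    (hp : 0 < p)
    (hpc : (n%:R - 1) * p ^+ 2 - (n%:R + 1) * p - 2 = 0)
    (hrho : 0 < rho)
    (hu0 : H1 u0) (hu1 : L2 u1)
    (hsupp0 : {ae lebesgue_rV R n, forall x,
       rho < euclidean_norm x -> u0 x = 0 /\ u1 x = 0})
    (hu0_ge0 : {ae lebesgue_rV R n, forall x, 0 <= u0 x})
    (hu1_ge0 : {ae lebesgue_rV R n, forall x, 0 <= u1 x})
    (hpos : ~ {ae lebesgue_rV R n, forall x, u0 x = 0} \/
            ~ {ae lebesgue_rV R n, forall x, u1 x = 0})
    (hT : (0 < T)%E)
    (hcont : continuous_H1L2 T u ut)
    (hut : is_time_derivative T u ut)
    (heq : wave_equation T p u)
    (hinit : initial_data u ut u0 u1)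
    (hsupp : support_in_cone T rho u ut) :
  (T < +oo)%E.
Proof.
case: T hT hcont hut heq hsupp => [t||] => // hT hcont hut heq hsupp.
  by rewrite ltry.
exfalso.
have [cu cv] := continuous_H1L2_L2 hcont.
have uE : {ae lebesgue_rV R n, forall x, u 0 x = u0 x} by apply: filterS hinit => x [].
have vE : {ae lebesgue_rV R n, forall x, ut 0 x = u1 x} by apply: filterS hinit => x [].
apply: (blow_up hn hp hpc hrho cu cv hut heq hsupp).
- by apply: filterS2 uE hu0_ge0 => x ->.
- by apply: filterS2 vE hu1_ge0 => x ->.
case: hpos => h; [left|right] => z; apply: h.
- by apply: filterS2 uE z => x ->.
- by apply: filterS2 vE z => x ->.
Qed.
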